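(* Let $n\ge 0$ be an integer, $d=n+1$, and let $(\mathcal V,\omega)$ be an $\mathsf{NP}$-manifold of degree $n$, presented in homogeneous Darboux coordinates. Then the graded algebra of functions $\mathscr C^\infty(\mathcal V)$ is endowed with a structure of $\mathsf{dGra}_d$-algebra: the maps $\mathsf{dRep}^{(d)}_N:\mathsf{dGra}_d(N)\otimes\mathscr C^\infty(\mathcal V)^{\otimes N}\to\mathscr C^\infty(\mathcal V)$, $N\ge1$, defined on a directed graph $\gamma$ with $N$ vertices by $$\mathsf{dRep}^{(d)}_N(\gamma)(f_1\otimes\cdots\otimes f_N)=\mu_N\Big(\prod_{(i,j)\in E_\gamma}\bar\Delta_{ij}\,(f_1\otimes\cdots\otimes f_N)\Big)$$ assemble into a morphism of operads of graded vector spaces $\mathsf{dRep}^{(d)}:\mathsf{dGra}_d\to\mathsf{End}_{\mathscr C^\infty(\mathcal V)}$.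
   Context: Base field $\mathbb K$ of characteristic $0$. For a graded vector space $V$, $V[k]^m=V^{k+m}$. **Directed graph operad.** $\mathsf{gra}_{N,k}$ is the set of directed multigraphs (multiple edges and tadpoles allowed, connectedness not required) with $N$ vertices labelled $1,\dots,N$ and $k$ directed edges labelled $1,\dots,k$. For $d$ even, $\mathsf{dGra}_d(N)=\prod_{k\ge0}(\mathbb K\langle\mathsf{gra}_{N,k}\rangle\otimes_{\mathbb S_k}\mathrm{sgn}_k)[k(d-1)]$; for $d$ odd, $\mathsf{dGra}_d(N)=\prod_{k\ge0}(\mathbb K\langle\mathsf{gra}_{N,k}\rangle_{\mathbb S_k})[k(d-1)]$ (coinvariants for permutation of edge labels). So each edge has degree $1-d$, and permuting edge labels gives the signature if $d$ is even and no sign if $d$ is odd. $\mathbb S_N$ acts on the right by relabelling vertex $i$ as $\sigma^{-1}(i)$. Partial composition $\gamma\circ_i\gamma'$ ($\gamma$ with $M$ vertices, $\gamma'$ with $N$ vertices): remove vertex $i$ of $\gamma$, insert $\gamma'$ in its place, and sum over all ways of reconnecting the edges of $\gamma$ formerly attached to vertex $i$ to vertices of $\gamma'$; labels of vertices $1,\dots,i-1$ of $\gamma$ are unchanged, labels of $\gamma'$ are shifted by $i-1$, labels of the last $M-i$ vertices of $\gamma$ are shifted by $N-1$, and edges of $\gamma$ come before edges of $\gamma'$. The unit is the one-vertex graph without edges. **$\mathsf{NP}$-manifolds.** An $\mathsf{NP}$-manifold of degree $n$ is an $\mathbb N$-graded manifold with a symplectic $2$-form $\omega$ of intrinsic degree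 $n$. Darboux coordinates (degrees in parentheses): for $n$ odd, $x^\mu(0),\psi^{\alpha_k}(k),\chi_{\alpha_k}(n-k),p_\mu(n)$ with $1\le k\le\frac{n-1}2$, and $\omega=dx^\mu\wedge dp_\mu+\sum_k d\psi^{\alpha_k}\wedge d\chi_{\alpha_k}$; for $n$ even, $x^\mu(0),\psi^{\alpha_k}(k),\xi^a(n/2),\chi_{\alpha_k}(n-k),p_\mu(n)$ with $1\le k\le\frac n2-1$, and $\omega=dx^\mu\wedge dp_\mu+\sum_k d\psi^{\alpha_k}\wedge d\chi_{\alpha_k}+\frac12\kappa_{ab}d\xi^a\wedge d\xi^b$ with $\kappa$ a constant invertible matrix, $\kappa_{ab}=-(-1)^{n/2}\kappa_{ba}$, inverse $\kappa^{ab}$ (for $n=0$ only the coordinates $\xi^a$ occur). **The operators.** $\mu_N(f_1\otimes\cdots\otimes f_N)=f_1\cdots f_N$. The product over edges is taken in the order of edge labels (smallest label leftmost). For an edge from vertex $i$ to vertex $j$ (summation over all repeated indices, including $k$, understood): - $d$ even: $\bar\Delta_{ij}=\frac{\partial}{\partial x^\mu_{(i)}}\frac{\partial}{\partial p_\mu^{(j)}}+\frac{\partial}{\partial\psi^{\alpha_k}_{(i)}}\frac{\partial}{\partial\chi_{\alpha_k}^{(j)}}$; - $d$ odd: $\bar\Delta_{ij}=\frac{\partial}{\partial x^\mu_{(i)}}\frac{\partial}{\partial p_\mu^{(j)}}+\frac{\partial}{\partial\psi^{\alpha_k}_{(i)}}\frac{\partial}{\partial\chi_{\alpha_k}^{(j)}}+\frac12\frac{\partial}{\partial\xi^a_{(i)}}\kappa^{ab}\frac{\partial}{\partial\xi^b_{(j)}}$.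 The sub/superscript $(i)$ means that the (left) derivative acts on the $i$-th tensor factor, with Koszul signs. $\mathsf{End}_V$ denotes the endomorphism operad of $V$, with right action $(\theta\cdot\sigma)(f_1,\dots,f_N)=\theta(f_{\sigma^{-1}(1)},\dots,f_{\sigma^{-1}(N)})$ (with Koszul signs).
   Formalization: For n=0 (d=1), dGra_1(N) is taken as finite linear combinations of graphs instead of the infinite product over k, on which the formula is undefined (infinite sums of operators of unbounded order diverge on smooth functions); nothing changes for n≥1. *)

(* Defs.v *)
From HB Require Import structures.
From mathcomp Require Import all_boot all_order all_algebra all_fingroup.
From mathcomp Require Import generic_quotient ring_quotient.
From mathcomp Require Import all_classical all_reals all_analysis.
From mathcomp Require Import freeg zify.

Set Implicit Arguments.
Unset Strict Implicit.
Unset Printing Implicit Defensive.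

Import Order.TTheory GRing.Theory Num.Theory numFieldNormedType.Exports.
Local Open Scope classical_set_scope.
Local Open Scope quotient_scope.
Local Open Scope ring_scope.

Section LmodQuotient.
Variables (K : fieldType) (V : lmodType K) (S : {pred V}).
Hypothesis S_closed : submod_closed S.

Definition lmquot_ideal : zmodClosed V :=
  HB.pack S (GRing.isZmodClosed.Build V S (GRing.submod_closedB S_closed)).

Definition lmquot := Quotient.quot lmquot_ideal.
HB.instance Definition _ := GRing.Zmodule.on lmquot.

Definition lmclass (v : V) : lmquot := \pi_(Quotient.quot lmquot_ideal) v.

Lemma lmclassD u v : lmclass (u + v) = lmclass u + lmclass v.
Proof. by rewrite /lmclass pi_addr. Qed.

Lemma lmclassN u : lmclass (- u) = - lmclass u.
Proof. by rewrite /lmclass pi_oppr. Qed.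

Lemma lmclass_eq u v : (lmclass u = lmclass v) <-> u - v \in S.
Proof.
rewrite (Quotient.idealrBE lmquot_ideal); split => [h|/eqP //].
by apply/eqP.
Qed.

Definition lmrepr (x : lmquot) : V := repr (x : (Quotient.quot lmquot_ideal)).

Lemma lmreprK x : lmclass (lmrepr x) = x.
Proof. exact: reprK. Qed.

Definition lmscale (a : K) (x : lmquot) : lmquot := lmclass (a *: lmrepr x).

Lemma lmclassZ_ a v : lmclass (a *: v) = lmscale a (lmclass v).
Proof.
apply/lmclass_eq; rewrite -scalerBr; apply: (GRing.submod_closed_semi S_closed).2.
by apply/lmclass_eq; rewrite lmreprK.
Qed.

Fact lmscaleA a b x : lmscale a (lmscale b x) = lmscale (a * b) x.
Proof. by rewrite -(lmreprK x) -!lmclassZ_ scalerA. Qed.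
Fact lmscale1 x : lmscale 1 x = x.
Proof. by rewrite -(lmreprK x) -!lmclassZ_ scale1r. Qed.
Fact lmscaleDr a x y : lmscale a (x + y) = lmscale a x + lmscale a y.
Proof.
by rewrite -(lmreprK x) -(lmreprK y) -lmclassD -!lmclassZ_ scalerDr lmclassD.
Qed.
Fact lmscaleDl x a b : lmscale (a + b) x = lmscale a x + lmscale b x.
Proof. by rewrite -(lmreprK x) -!lmclassZ_ scalerDl lmclassD. Qed.

HB.instance Definition _ := GRing.Zmodule_isLmodule.Build K lmquot
  lmscaleA lmscale1 lmscaleDr lmscaleDl.

Fact lmclass_linear : linear lmclass.
Proof. by move=> a u v; rewrite lmclassD lmclassZ_. Qed.
HB.instance Definition _ :=
  GRing.isLinear.Build K V lmquot *:%R lmclass lmclass_linear.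

End LmodQuotient.

(* A graded vector space is its total space together with the projections on   *)
(* the homogeneous components; every vector has finitely many components.      *)
Section GradedSpaces.
Variable K : fieldType.

Record gvect := GVect {
  gv_sort :> lmodType K;
  gv_comp : int -> gv_sort -> gv_sort;
  gv_comp_linear : forall p, linear (gv_comp p);
  gv_compK : forall p q v,
    gv_comp p (gv_comp q v) = if p == q then gv_comp q v else 0;
  gv_comp_sum : forall v,
    exists2 s : seq int, uniq s & v = \sum_(p <- s) gv_comp p v }.

Definition hom (V : gvect) (p : int) (v : V) := gv_comp p v = v.

Definition parity (p : int) : bool := odd `|p|%N.

Definition gv_par (V : gvect) (b : bool) (v : V) : V :=
  \sum_(p \in [set p | parity p = b]) gv_comp p v.

(* The operator v |-> (-1)^|v| v when [b], the identity otherwise.              *)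
Definition gv_sign (V : gvect) (b : bool) (v : V) : V :=
  if b then gv_par false v - gv_par true v else v.

End GradedSpaces.

Section GradedTheory.
Variables (K : fieldType) (V : gvect K).
Implicit Types (u v : V) (p q : int) (b : bool).

Lemma gv_comp0 p : gv_comp p (0 : V) = 0.
Proof. by have := @gv_comp_linear _ V p (-1) 0 0; rewrite !scaleN1r !addNr. Qed.

Lemma gv_compZD p a u v : gv_comp p (a *: u + v) = a *: gv_comp p u + gv_comp p v.
Proof. exact: gv_comp_linear. Qed.

Lemma gv_comp_sumr p (I : Type) (s : seq I) (F : I -> V) :
  gv_comp p (\sum_(i <- s) F i) = \sum_(i <- s) gv_comp p (F i).
Proof.
elim: s => [|i s IHs]; first by rewrite !big_nil gv_comp0.
by rewrite !big_cons -IHs -[F i]scale1r gv_compZD !scale1r.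
Qed.

Lemma gv_comp_fin v : exists s : seq int, [/\ uniq s,
  v = \sum_(p <- s) gv_comp p v & forall p, p \notin s -> gv_comp p v = 0].
Proof.
have [s us vs] := gv_comp_sum v; exists s; split=> // p ps.
rewrite {1}vs gv_comp_sumr big1_seq // => q /andP[_ qs].
by rewrite gv_compK; case: eqP ps qs => [-> /negPf->|].
Qed.

Lemma gv_parE b v (s : seq int) : uniq s ->
    (forall p, p \notin s -> gv_comp p v = 0) ->
  gv_par b v = \sum_(p <- s | parity p == b) gv_comp p v.
Proof.
move=> us vs; rewrite /gv_par (fsbigE [seq p <- s | parity p == b]).
- rewrite big_filter_cond; apply: eq_bigl => p.
  by apply/andP/eqP => [[/eqP]|pb] //; split; [apply/eqP|rewrite inE].
- exact: filter_uniq.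
- by move=> p /=; rewrite mem_filter => /andP[/eqP].
- by move=> p /= pb; rewrite mem_filter pb eqxx /= => /vs.
Qed.

Lemma gv_par_linear b : linear (@gv_par K V b).
Proof.
move=> a u v; have [s [us _ ss]] := gv_comp_fin u.
have [t [ut _ tt]] := gv_comp_fin v.
pose r := undup (s ++ t).
have rs p : p \notin r -> p \notin s /\ p \notin t.
  by rewrite mem_undup mem_cat negb_or => /andP.
rewrite !(@gv_parE b _ r) ?undup_uniq //.
- rewrite scaler_sumr -big_split; apply: eq_bigr => p _ /=.
  exact: gv_compZD.
- by move=> p /rs[_ /tt].
- by move=> p /rs[/ss].
- by move=> p /rs[/ss us' /tt vs']; rewrite gv_compZD us' vs' scaler0 addr0.
Qed.

Lemma gv_sign_linear b : linear (@gv_sign K V b).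
Proof.
case: b => // a u v /=; rewrite !gv_par_linear scalerBr opprD.
by rewrite -!addrA; congr (_ + _); rewrite !addrA; congr (_ + _); rewrite addrC.
Qed.

Lemma gv_par_hom b p v : hom p v -> gv_par b v = if parity p == b then v else 0.
Proof.
move=> hv; rewrite (@gv_parE b v [:: p]) //; last first.
  by move=> q; rewrite inE -hv gv_compK => /negPf ->.
by rewrite big_cons big_nil; case: ifP => _; rewrite ?addr0.
Qed.

Lemma gv_sign_hom b p v : hom p v ->
  gv_sign b v = (-1) ^+ (b && parity p) *: v.
Proof.
move=> hv; case: b => /=; last by rewrite expr0 scale1r.
rewrite !(gv_par_hom _ hv); case: (parity p) => /=.
- by rewrite expr1 scaleN1r sub0r.
- by rewrite expr0 scale1r subr0.
Qed.

Lemma hom0 p : hom p (0 : V).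
Proof. exact: gv_comp0. Qed.

Lemma homZD p a u v : hom p u -> hom p v -> hom p (a *: u + v).
Proof. by move=> hu hv; rewrite /hom gv_compZD hu hv. Qed.

Lemma homZ p a u : hom p u -> hom p (a *: u).
Proof. by move=> hu; rewrite -[_ *: _]addr0; apply: homZD hu (hom0 p). Qed.

End GradedTheory.

Section OperadDefs.
Variable K : fieldType.

(* [op_sort N p] is the degree [p] part in arity [N.+1]; composing arities     *)
(* [M.+1] and [N.+1] yields arity [(M + N).+1]. Only the structure maps of an  *)
(* operad enter the notion of a morphism, so its axioms are not recorded.      *)
Record operad_data := Operad {
  op_sort : nat -> int -> lmodType K;
  op_act : forall N p, 'S_N.+1 -> op_sort N p -> op_sort N p;
  op_circ : forall M N p q,
    'I_M.+1 -> op_sort M p -> op_sort N q -> op_sort (M + N)%N (p + q);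
  op_unit : op_sort 0%N 0 }.

Record operad_mor (P Q : operad_data) := OperadMor {
  op_mor :> forall N p, {linear op_sort P N p -> op_sort Q N p};
  op_mor_act : forall N p (s : 'S_N.+1) (x : op_sort P N p),
    op_mor N p (op_act s x) = op_act s (op_mor N p x);
  op_mor_circ : forall M N p q (i : 'I_M.+1)
      (x : op_sort P M p) (y : op_sort P N q),
    op_mor (M + N)%N (p + q) (op_circ i x y) =
    op_circ i (op_mor M p x) (op_mor N q y);
  op_mor_unit : op_mor 0%N 0 (op_unit P) = op_unit Q }.

End OperadDefs.

Section Insertion.
Variables (M N : nat) (i : 'I_M.+1).

(* Inserting a graph with vertices 'I_N.+1 at the vertex [i] of a graph with   *)
(* vertices 'I_M.+1: [outer j] is the new label of an old vertex j <> i,       *)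
(* [inner w] that of an inserted vertex [w], and [collapse] sends a vertex of  *)
(* the result to the vertex of the outer graph it comes from.                  *)
Definition outer (j : 'I_M.+1) : 'I_(M + N).+1 :=
  inord (if (j < i)%N then j : nat else (j + N)%N).

Definition inner (w : 'I_N.+1) : 'I_(M + N).+1 := inord (i + w).

Definition collapse (v : 'I_(M + N).+1) : 'I_M.+1 :=
  inord (if (v < i)%N then v : nat else if (v <= i + N)%N then i : nat else (v - N)%N).

End Insertion.

Section EndOperad.
Variables (K : fieldType) (V : gvect K).

Definition upd N (f : 'I_N -> V) (i : 'I_N) (u : V) : 'I_N -> V :=
  fun j => if j == i then u else f j.

Definition multilinear N (t : ('I_N -> V) -> V) : Prop :=
  forall (f : 'I_N -> V) i a u v,
    t (upd f i (a *: u + v)) = a *: t (upd f i u) + t (upd f i v).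

Definition map_degree N (p : int) (t : ('I_N -> V) -> V) : Prop :=
  forall (d : 'I_N -> int) (f : 'I_N -> V),
    (forall i, hom (d i) (f i)) -> hom (p + \sum_i d i) (t f).

(* Linear maps V^{(x) N.+1} -> V of degree [p], as multilinear maps.           *)
Definition end_pred N p : {pred ('I_N.+1 -> V) -> V} :=
  fun t => `[< multilinear t /\ map_degree p t >].

Arguments end_pred : clear implicits.

Lemma end_closed N p : submod_closed (end_pred N p).
Proof.
split=> [|a s t]; rewrite !inE.
  split=> [f i a u v|d f _]; first by rewrite scaler0 addr0.
  exact: hom0.
move=> [sl sd] [tl td]; split.
- move=> f i b u v; rewrite !fctE /= sl tl !scalerDr !addrA; congr (_ + _).
  by rewrite -!addrA; congr (_ + _); [rewrite !scalerA mulrC|rewrite addrC].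
- by move=> d f hf; apply: homZD; [exact: sd|exact: td].
Qed.
HB.instance Definition _ N p :=
  GRing.isSubmodClosed.Build K (('I_N.+1 -> V) -> V) (end_pred N p) (@end_closed N p).

Record endo N p := Endo {
  endo_fun :> ('I_N.+1 -> V) -> V; _ : endo_fun \in end_pred N p }.
HB.instance Definition _ N p := [isSub for @endo_fun N p].
HB.instance Definition _ N p := [Choice of endo N p by <:].
HB.instance Definition _ N p := [SubChoice_isSubLmodule of endo N p by <:].

Lemma endo_lin N p (t : endo N p) : multilinear t.
Proof. by case: t => t /= /asboolP[]. Qed.
Lemma endo_deg N p (t : endo N p) : map_degree p t.
Proof. by case: t => t /= /asboolP[]. Qed.

Lemma endo_upd0 N (t : ('I_N -> V) -> V) : multilinear t ->
  forall (f : 'I_N -> V) i, f i = 0 -> t f = 0.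
Proof.
move=> tl f i fi.
have -> : f = upd f i 0.
  by apply/funext => j; rewrite /upd; case: eqP => // ->.
by have := tl f i (-1) 0 0; rewrite !scaleN1r !addNr.
Qed.

(* Koszul sign of f_1 (x) ... (x) f_N |-> f_{s^-1 1} (x) ... (x) f_{s^-1 N},   *)
(* where [e a] is the parity of f_a.                                           *)
Definition koszul_sign N (s : 'S_N) (e : {ffun 'I_N -> bool}) : K :=
  \prod_(a < N) \prod_(b < N | (a < b)%N && (s b < s a)%N) (-1) ^+ (e a && e b).

(* Each factor is split into its even and odd parts, so that the Koszul sign   *)
(* of every term is defined.                                                   *)
Definition end_act_fun N (s : 'S_N) (t : ('I_N -> V) -> V) (f : 'I_N -> V) : V :=
  \sum_(e : {ffun 'I_N -> bool})
    koszul_sign s e *: t (fun i => gv_par (e (s^-1%g i)) (f (s^-1%g i))).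

(* [q] is the degree of [t']; the Koszul sign is that of [t'] moving past the  *)
(* factors on the left of the slot [i].                                        *)
Definition end_circ_fun M N (q : int) (i : 'I_M.+1)
    (t : ('I_M.+1 -> V) -> V) (t' : ('I_N.+1 -> V) -> V)
    (f : 'I_(M + N).+1 -> V) : V :=
  t (fun j => if j == i then t' (fun w => f (inner i w))
              else if (j < i)%N then gv_sign (parity q) (f (outer N i j))
              else f (outer N i j)).

End EndOperad.

Section InsertionTheory.
Variables (M N : nat) (i : 'I_M.+1).
Implicit Types (j : 'I_M.+1) (w : 'I_N.+1) (v : 'I_(M + N).+1).

Lemma outerE j : outer N i j = (if (j < i)%N then j : nat else (j + N)%N) :> nat.
Proof. by rewrite inordK //; have := ltn_ord j; case: ifP; lia. Qed.

Lemma innerE w : inner i w = (i + w)%N :> nat.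
Proof. by rewrite inordK //; have := ltn_ord i; have := ltn_ord w; lia. Qed.

Lemma collapseE v : collapse (N := N) i v =
  (if (v < i)%N then v : nat else if (v <= i + N)%N then i : nat else (v - N)%N)
  :> nat.
Proof.
have hi := ltn_ord i; have hv := ltn_ord v.
rewrite inordK //. case: ifP => h1; last case: ifP => h2. all: lia.
Qed.

Lemma collapse_inner w : collapse i (inner i w) = i.
Proof.
apply/val_inj; rewrite [LHS]collapseE innerE /=.
by have := ltn_ord w; case: ifP; [lia|case: ifP; lia].
Qed.

Lemma collapse_outer j : collapse i (outer N i j) = j.
Proof.
apply/val_inj; rewrite [LHS]collapseE outerE /=.
case: (ltngtP j i) => [ji|ij|ji] /=.
- by rewrite ji.
- rewrite ltnNge leq_eqVlt ltn_addr ?orbT //= leqNgt ltn_add2r ij /=; lia.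
- by rewrite ltnNge ji leq_addr /= leqnn.
Qed.

Lemma insertionP v :
  (exists w, v = inner i w) \/ (exists2 j, j != i & v = outer N i j).
Proof.
have hi := ltn_ord i; have hv := ltn_ord v.
case: (ltnP v i) => vi.
  right; have vM : (v < M.+1)%N by lia.
  exists (Ordinal vM); first by rewrite -val_eqE /=; lia.
  by apply/val_inj; rewrite [RHS]outerE /= vi.
case: (leqP v (i + N)) => viN.
  left; have wN : (v - i < N.+1)%N by lia.
  by exists (Ordinal wN); apply/val_inj; rewrite [RHS]innerE /=; lia.
right; have vM : (v - N < M.+1)%N by lia.
exists (Ordinal vM); first by rewrite -val_eqE /=; lia.
by apply/val_inj; rewrite [RHS]outerE /=; case: ifP => h; lia.
Qed.

Lemma inner_inj : injective (inner (N := N) i).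
Proof.
move=> w w' /(congr1 (@nat_of_ord _)); rewrite !innerE => h.
by apply/val_inj => /=; lia.
Qed.

Lemma outer_inj : injective (outer N i).
Proof. exact: can_inj collapse_outer. Qed.

Lemma inner_neq_outer w j : j != i -> inner i w != outer N i j.
Proof.
apply: contra_neq => /(congr1 (collapse (N := N) i)).
by rewrite collapse_inner collapse_outer.
Qed.

Lemma big_insertion (T : nmodType) (F : 'I_(M + N).+1 -> T) :
  \sum_v F v = \sum_w F (inner i w) + \sum_(j | j != i) F (outer N i j).
Proof.
rewrite (bigID (fun v => collapse i v == i)) /=; congr (_ + _).
  rewrite (reindex_onto (inner i) (fun v => inord (v - i))) /=.
    apply: eq_bigl => w; rewrite collapse_inner eqxx innerE addKn.
    by rewrite inord_val eqxx.
  move=> v; case: (insertionP v) => [[w ->] _|[j ji ->]].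
    by rewrite innerE addKn inord_val.
  by rewrite collapse_outer (negPf ji).
rewrite (reindex_onto (outer N i) (collapse i)) /=.
  by apply: eq_bigl => j; rewrite collapse_outer eqxx andbT.
move=> v; case: (insertionP v) => [[w ->]|[j ji -> _]].
  by rewrite collapse_inner eqxx.
by rewrite collapse_outer.
Qed.

End InsertionTheory.

Arguments end_pred {K} V N p.
Section EndOperad.
Variables (K : fieldType) (V : gvect K).

Lemma end_act_in N p (s : 'S_N.+1) (t : endo V N p) :
  end_act_fun s t \in end_pred V N p.
Proof.
have tl := endo_lin t; have td := endo_deg t.
rewrite inE; split=> [f i a u v|d f hf]; rewrite /end_act_fun.
- rewrite scaler_sumr -big_split; apply: eq_bigr => e _ /=.
  have E x : (fun j => gv_par (e (s^-1%g j)) (upd f i x (s^-1%g j))) =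
      upd (fun j => gv_par (e (s^-1%g j)) (f (s^-1%g j))) (s i)
        (gv_par (e i) x).
    apply/funext => j; rewrite /upd -(inj_eq (@perm_inj _ s)) permKV.
    by case: eqP => // ->; rewrite permK.
  by rewrite !E gv_par_linear tl scalerDr !scalerA mulrC.
- apply: big_ind => [|x y hx hy|e _]; first exact: hom0.
    by rewrite -[x]scale1r; apply: homZD.
  apply: homZ; rewrite (reindex_inj (@perm_inj _ (s^-1)%g)) /=.
  apply: td => i; rewrite (gv_par_hom _ (hf _)).
  by case: ifP => _; [exact: hf|exact: hom0].
Qed.

Definition end_act N p (s : 'S_N.+1) (t : endo V N p) : endo V N p :=
  Endo (end_act_in s t).

Lemma end_circ_in M N p q (i : 'I_M.+1) (t : endo V M p) (t' : endo V N q) :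
  end_circ_fun q i t t' \in end_pred V (M + N)%N (p + q).
Proof.
have tl := endo_lin t; have td := endo_deg t.
have tl' := endo_lin t'; have td' := endo_deg t'.
rewrite inE; split=> [f k a u v|d f hf]; rewrite /end_circ_fun.
- case: (insertionP i k) => [[w ->]|[j ji ->]].
    pose g (j : 'I_M.+1) := if (j < i)%N then gv_sign (parity q) (f (outer N i j))
                else f (outer N i j).
    have E x : (fun j : 'I_M.+1 => if j == i then t' (fun w0 => upd f (inner i w) x (inner i w0))
              else if (j < i)%N then gv_sign (parity q) (upd f (inner i w) x (outer N i j))
              else upd f (inner i w) x (outer N i j)) =
        upd g i (t' (upd (fun w => f (inner i w)) w x)).
      apply/funext => j; rewrite /upd; case: eqVneq => [_|ji].
        congr (t' _); apply/funext => w0.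
        by rewrite (inj_eq (@inner_inj M N i)).
      by rewrite /g eq_sym (negPf (inner_neq_outer _ ji)).
    by rewrite !E tl' tl.
  pose g (j : 'I_M.+1) := if j == i then t' (fun w => f (inner i w)) else
                if (j < i)%N then gv_sign (parity q) (f (outer N i j))
                else f (outer N i j).
  have E x : (fun j0 : 'I_M.+1 => if j0 == i then t' (fun w0 => upd f (outer N i j) x (inner i w0))
            else if (j0 < i)%N then gv_sign (parity q) (upd f (outer N i j) x (outer N i j0))
            else upd f (outer N i j) x (outer N i j0)) =
      upd g j (if (j < i)%N then gv_sign (parity q) x else x).
    apply/funext => j0; rewrite /upd /g (inj_eq (@outer_inj M N i)).
    case: (eqVneq j0 i) => [ij0|j0i].
      rewrite ij0 eq_sym (negPf ji); congr (t' _); apply/funext => w0.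
      by rewrite (negPf (inner_neq_outer _ ji)).
    by case: (eqVneq j0 j) => [->|].
  rewrite !E; case: ifP => _; last exact: tl.
  by rewrite gv_sign_linear tl.
- rewrite (big_insertion i d) -addrA.
  have -> : q + (\sum_w d (inner i w) + \sum_(j | j != i) d (outer N i j)) =
      \sum_j (if j == i then q + \sum_w d (inner i w) else d (outer N i j)).
    rewrite [RHS](bigD1 i) //= eqxx addrA; congr (_ + _).
    by apply: eq_bigr => j /negPf ->.
  apply: td => j; case: eqP => [_|_]; first by apply: td' => w; exact: hf.
  case: ifP => _; last exact: hf.
  by rewrite (gv_sign_hom _ (hf _)); apply: homZ; exact: hf.
Qed.

Definition end_circ M N p q (i : 'I_M.+1) (t : endo V M p) (t' : endo V N q) :
  endo V (M + N)%N (p + q) := Endo (end_circ_in i t t').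

Lemma end_unit_in : (fun f : 'I_1 -> V => f ord0) \in end_pred V 0 0.
Proof.
rewrite inE; split=> [f i a u v|d f hf]; first by rewrite /upd !ord1 eqxx.
by rewrite big_ord1 add0r.
Qed.

Definition EndOp : operad_data K :=
  Operad end_act end_circ (Endo end_unit_in : endo V 0 0).

End EndOperad.

Section FreeLift.
Variables (K : fieldType) (G : choiceType) (L : lmodType K) (f : G -> L).

Lemma fglift_sumE u : fglift f u = \sum_(g <- dom u) coeff g u *: f g.
Proof.
rewrite -{1}[u]freeg_sumE.
have addf := lift_is_additive f.
elim: (dom u) => [|g s IH]; first by rewrite !big_nil; have := addf 0 0; rewrite !subrr.
rewrite !big_cons -IH.
have := addf (<<coeff g u *g g>>) (- \sum_(j <- s) <<coeff j u *g j>>).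
have := addf 0 (\sum_(j <- s) <<coeff j u *g j>>).
have -> : fglift f 0 = 0 by have := addf 0 0; rewrite !subrr.
by rewrite !sub0r opprK => -> ->; rewrite opprK liftU.
Qed.

Lemma fglift_linear : linear (fglift f).
Proof.
have addf := lift_is_additive f.
have f0 : fglift f 0 = 0 by have := addf 0 0; rewrite !subrr.
have fD u v : fglift f (u + v) = fglift f u + fglift f v.
  have := addf u (0 - v); rewrite (addf 0 v) f0 !sub0r !opprK => ->.
  by [].
have fS (I : eqType) (s : seq I) (F : I -> {freeg G / K}) :
    fglift f (\sum_(j <- s) F j) = \sum_(j <- s) fglift f (F j).
  by elim: s => [|j s IH]; rewrite ?big_nil // !big_cons fD IH.
move=> a u v; rewrite fD; congr (_ + _).
rewrite (fglift_sumE u) scaler_sumr [a *: u]/(fgscale a u) fS.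
by apply: eq_bigr => g _; rewrite liftU scalerA.
Qed.

Lemma fglift0 : fglift f 0 = 0.
Proof. by have := lift_is_additive f 0 0; rewrite !subrr. Qed.

End FreeLift.

Section BlockPerm.
Variables k l : nat.

Definition ord_perm (s : 'S_k) (t : 'S_l) (a : 'I_(k + l)) : 'I_(k + l) :=
  match fintype.split a with inl x => lshift l (s x) | inr y => rshift k (t y) end.

Lemma ord_perm_inj s t : injective (ord_perm s t).
Proof.
move=> a b; rewrite /ord_perm.
by case: (split_ordP a) => x ->; case: (split_ordP b) => y -> /eqP;
  rewrite ?(eq_lshift, eq_rshift, eq_lrshift, eq_rlshift) // => /eqP/perm_inj ->.
Qed.

Definition block_perm s t : 'S_(k + l) := perm (@ord_perm_inj s t).

Lemma block_permL s t x : block_perm s t (lshift l x) = lshift l (s x).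
Proof. by rewrite permE /ord_perm (unsplitK (inl x)). Qed.
Lemma block_permR s t x : block_perm s t (rshift k x) = rshift k (t x).
Proof. by rewrite permE /ord_perm (unsplitK (inr x)). Qed.

Lemma block_permP (s : 'S_(k + l)) (t : 'S_k) (u : 'S_l) :
  (forall x, s (lshift l x) = lshift l (t x)) ->
  (forall x, s (rshift k x) = rshift k (u x)) -> s = block_perm t u.
Proof.
move=> sl sr; apply/permP => a; case: (split_ordP a) => x ->.
  by rewrite block_permL.
by rewrite block_permR.
Qed.

Lemma block_permM s t s' t' :
  (block_perm s t * block_perm s' t' = block_perm (s * s') (t * t'))%g.
Proof.
by apply: block_permP => x; rewrite !permM ?block_permL ?block_permR.
Qed.

Lemma block_perm1 : (block_perm 1 1 = 1)%g.
Proof. by symmetry; apply: block_permP => x; rewrite !perm1. Qed.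

Lemma block_permML s s' :
  (block_perm (s * s') 1 = block_perm s 1 * block_perm s' 1)%g.
Proof. by rewrite block_permM mulg1. Qed.
Lemma block_permMR t t' :
  (block_perm 1 (t * t') = block_perm 1 t * block_perm 1 t')%g.
Proof. by rewrite block_permM mulg1. Qed.

Lemma odd_block_permL (s : 'S_k) : block_perm s 1%g = s :> bool.
Proof.
have [ts -> /allP dts] := prod_tpermP s.
elim: ts dts => [|[x y] ts IH] dts; first by rewrite big_nil block_perm1 !odd_perm1.
have xy : x != y by apply: (dts (x, y)); rewrite mem_head.
rewrite big_cons block_permML !odd_permM IH /=.
  congr (_ (+) _); rewrite odd_tperm xy.
  suff -> : block_perm (tperm x y) 1 = tperm (lshift l x) (lshift l y).
    by rewrite odd_tperm eq_lshift xy.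
  symmetry; apply: block_permP => z; last by rewrite perm1 tpermD // eq_lrshift.
  by rewrite -(inj_tperm _ _ _ (@lshift_inj k l)).
by move=> e ets; apply: dts; rewrite inE ets orbT.
Qed.

Lemma odd_block_permR (t : 'S_l) : block_perm 1%g t = t :> bool.
Proof.
have [ts -> /allP dts] := prod_tpermP t.
elim: ts dts => [|[x y] ts IH] dts; first by rewrite big_nil block_perm1 !odd_perm1.
have xy : x != y by apply: (dts (x, y)); rewrite mem_head.
rewrite big_cons block_permMR !odd_permM IH /=.
  congr (_ (+) _); rewrite odd_tperm xy.
  suff -> : block_perm 1 (tperm x y) = tperm (rshift k x) (rshift k y).
    by rewrite odd_tperm eq_rshift xy.
  symmetry; apply: block_permP => z; first by rewrite perm1 tpermD // eq_rlshift.
  by rewrite -(inj_tperm _ _ _ (@rshift_inj k l)).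
by move=> e ets; apply: dts; rewrite inE ets orbT.
Qed.

End BlockPerm.

Section DGra.
Variables (K : fieldType) (d : nat).

(* A directed multigraph with vertices 'I_N.+1 and k labelled edges is the     *)
(* list of its k edges (source, target) in the order of their labels.          *)
Definition edge N : choiceType := ('I_N.+1 * 'I_N.+1)%type.

Definition graph_deg N (g : seq (edge N)) : int := (size g)%:Z * (1 - d%:Z).

Definition hgraph N (p : int) := {g : seq (edge N) | graph_deg g == p}.

(* The basis vector of the graph [g] (0 if [g] does not have degree [p]).      *)
Definition gvec N p (g : seq (edge N)) : {freeg (hgraph N p) / K} :=
  oapp (fun h : hgraph N p => << 1 *g h >>) 0 (insub g).

Definition edge_sign k (t : 'S_k) : K := if odd d then 1 else (-1) ^+ t.

Definition edge_perm N k (t : 'S_k) (g : k.-tuple (edge N)) : seq (edge N) :=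
  [tuple tnth g (t a) | a < k].

(* The subspace spanned by the vectors (g . t - edge_sign t g).                *)
Inductive edge_rel N p : {freeg (hgraph N p) / K} -> Prop :=
| EdgeRel0 : edge_rel 0
| EdgeRelS c k (g : k.-tuple (edge N)) (t : 'S_k) x : edge_rel x ->
    edge_rel (c *: (gvec p (edge_perm t g) - edge_sign t *: gvec p g) + x).

Definition edge_relp N p : {pred {freeg (hgraph N p) / K}} :=
  fun x => `[< edge_rel x >].
Arguments edge_relp : clear implicits.

Lemma edge_relp_closed N p : submod_closed (edge_relp N p).
Proof.
split=> [|a x y]; rewrite !inE; first exact: EdgeRel0.
move=> hx hy; elim: hx => [|c k g t z _ IH]; first by rewrite scaler0 add0r.
by rewrite scalerDr scalerA -addrA; apply: EdgeRelS.
Qed.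

(* The degree [p] part of dGra_d(N.+1). For d <> 1 all graphs of degree [p]    *)
(* have the same number of edges. For d = 1 every graph has degree 0, and the  *)
(* elements are finite linear combinations of graphs: the operators associated *)
(* with graphs cannot be summed over infinitely many numbers of edges.         *)
Definition dgra N p : lmodType K := lmquot (@edge_relp_closed N p).

Definition gclass N p (x : {freeg (hgraph N p) / K}) : dgra N p :=
  lmclass (@edge_relp_closed N p) x.
Definition grepr N p (x : dgra N p) : {freeg (hgraph N p) / K} := lmrepr x.

Definition relabel N (s : 'S_N.+1) (g : seq (edge N)) : seq (edge N) :=
  [seq (s^-1%g e.1, s^-1%g e.2) | e <- g].

Definition act_free N p (s : 'S_N.+1) :
    {freeg (hgraph N p) / K} -> {freeg (hgraph N p) / K} :=
  fglift (fun g => gvec p (relabel s (val g))).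

(* A way of reconnecting the edges of [g] at the vertex [i] to vertices of [h] *)
(* is a list [r] of edges of the result that collapses to [g].                 *)
Definition insertion M N p (i : 'I_M.+1) (g : seq (edge M)) (h : seq (edge N)) :
    {freeg (hgraph (M + N) p) / K} :=
  \sum_(r : (size g).-tuple (edge (M + N))
        | [seq (collapse i e.1, collapse i e.2) | e <- r] == g)
    gvec p (r ++ [seq (inner i e.1, inner i e.2) | e <- h]).

Definition circ_free M N p q (i : 'I_M.+1)
    (x : {freeg (hgraph M p) / K}) (y : {freeg (hgraph N q) / K}) :
    {freeg (hgraph (M + N) (p + q)) / K} :=
  fglift (fun g => fglift (fun h => insertion (p + q) i (val g) (val h)) y) x.

Definition dgra_act N p (s : 'S_N.+1) (x : dgra N p) : dgra N p :=
  gclass (act_free s (grepr x)).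
Definition dgra_circ M N p q (i : 'I_M.+1) (x : dgra M p) (y : dgra N q) :
  dgra (M + N)%N (p + q) := gclass (circ_free i (grepr x) (grepr y)).

Lemma edge_relP N p x : reflect (edge_rel x) (x \in edge_relp N p).
Proof. exact: asboolP. Qed.

Lemma edge_relZD N p a (x y : {freeg (hgraph N p) / K}) :
  edge_rel x -> edge_rel y -> edge_rel (a *: x + y).
Proof.
move=> /edge_relP hx /edge_relP hy.
by apply/edge_relP; apply: (edge_relp_closed N p).2.
Qed.

Lemma edge_rel_sum N p (I : Type) (s : seq I) (P : pred I)
    (F : I -> {freeg (hgraph N p) / K}) :
  (forall j, P j -> edge_rel (F j)) -> edge_rel (\sum_(j <- s | P j) F j).
Proof.
move=> h; apply: big_ind => //; first exact: EdgeRel0.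
by move=> x y hx hy; rewrite -[x]scale1r; apply: edge_relZD.
Qed.

Lemma gclass_eq N p (x y : {freeg (hgraph N p) / K}) :
  gclass x = gclass y <-> edge_rel (x - y).
Proof.
rewrite (lmclass_eq (@edge_relp_closed N p)).
by split => /edge_relP.
Qed.

Lemma greprK N p (x : dgra N p) : gclass (grepr x) = x.
Proof. exact: lmreprK. Qed.

Lemma gvec_in N p (h : hgraph N p) : gvec p (val h) = << 1 *g h >>.
Proof. by rewrite /gvec valK. Qed.

Lemma gvec_out N p (g : seq (edge N)) : graph_deg g != p -> gvec p g = 0.
Proof. by move=> gp; rewrite /gvec insubF // (negPf gp). Qed.

Lemma edge_rel_perm N p k (g : k.-tuple (edge N)) (t : 'S_k) :
  edge_rel (gvec p (edge_perm t g) - edge_sign t *: gvec p g).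
Proof.
by have := EdgeRelS 1 g t (EdgeRel0 N p); rewrite scale1r addr0.
Qed.

Lemma lift_gvec (L : lmodType K) N p (F : seq (edge N) -> L) g :
  fglift (fun h : hgraph N p => F (val h)) (gvec p g)
    = if graph_deg g == p then F g else 0.
Proof.
case: ifPn => gp; last first.
  by rewrite gvec_out // fglift0.
have := gvec_in (exist _ g gp : hgraph N p) => /= ->.
by rewrite liftU scale1r.
Qed.

Lemma size_edge_perm N k (g : k.-tuple (edge N)) (t : 'S_k) :
  size (edge_perm t g) = size g.
Proof. by rewrite size_tuple size_tuple. Qed.

Lemma map_edge_perm M N (F : edge M -> edge N) k (g : k.-tuple (edge M))
    (t : 'S_k) :
  map F (edge_perm t g) = edge_perm t [tuple of map F g].
Proof.
rewrite /edge_perm /= -map_comp; apply: eq_map => a /=.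
by rewrite tnth_map.
Qed.

Lemma edge_perm_catL N k l (g : k.-tuple (edge N)) (h : l.-tuple (edge N))
    (t : 'S_k) :
  edge_perm t g ++ h = edge_perm (block_perm t 1) [tuple of g ++ h].
Proof.
have -> : edge_perm t g ++ h = [tuple of [tuple tnth g (t a) | a < k] ++ h] by [].
congr (tval _); apply: eq_from_tnth => a; rewrite [RHS]tnth_mktuple.
case: (split_ordP a) => x ->.
  by rewrite block_permL !tnth_lshift tnth_mktuple.
by rewrite block_permR !tnth_rshift perm1.
Qed.

Lemma edge_perm_catR N k l (g : k.-tuple (edge N)) (h : l.-tuple (edge N))
    (t : 'S_l) :
  tval g ++ edge_perm t h = edge_perm (block_perm 1 t) [tuple of g ++ h].
Proof.
have -> : tval g ++ edge_perm t h = [tuple of g ++ [tuple tnth h (t a) | a < l]] by [].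
congr (tval _); apply: eq_from_tnth => a; rewrite [RHS]tnth_mktuple.
case: (split_ordP a) => x ->.
  by rewrite block_permL !tnth_lshift perm1.
by rewrite block_permR !tnth_rshift tnth_mktuple.
Qed.

Lemma edge_rel_catL N p k (g : k.-tuple (edge N)) (h : seq (edge N)) (t : 'S_k) :
  edge_rel (gvec p (edge_perm t g ++ h) - edge_sign t *: gvec p (g ++ h)).
Proof.
have := edge_rel_perm p [tuple of g ++ in_tuple h] (block_perm t 1).
by rewrite -edge_perm_catL /edge_sign odd_block_permL.
Qed.

Lemma edge_rel_catR N p k (g : seq (edge N)) (h : k.-tuple (edge N)) (t : 'S_k) :
  edge_rel (gvec p (g ++ edge_perm t h) - edge_sign t *: gvec p (g ++ h)).
Proof.
have := edge_rel_perm p [tuple of in_tuple g ++ h] (block_perm 1 t).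
by rewrite -edge_perm_catR /edge_sign odd_block_permR.
Qed.

Lemma act_free_rel N p s (x : {freeg (hgraph N p) / K}) :
  edge_rel x -> edge_rel (act_free s x).
Proof.
elim=> [|c k g t y _ IH].
  by rewrite /act_free fglift0; exact: EdgeRel0.
rewrite /act_free fglift_linear; apply: edge_relZD => //.
rewrite addrC -scaleNr fglift_linear.
rewrite !(lift_gvec _ (fun h => gvec p (relabel s h))) /graph_deg size_edge_perm.
case: ifP => _; last by rewrite scaler0 addr0; exact: EdgeRel0.
rewrite addrC scaleNr /relabel map_edge_perm.
exact: (edge_rel_perm _ [tuple of map _ g]).
Qed.

Lemma dgra_act_class N p s (x : {freeg (hgraph N p) / K}) :
  dgra_act s (gclass x) = gclass (act_free s x).
Proof.
apply/gclass_eq; rewrite /dgra_act addrC -scaleN1r -fglift_linear scaleN1r.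
by apply: act_free_rel; rewrite addrC; apply/gclass_eq; rewrite greprK.
Qed.

Lemma insertionE M N p (i : 'I_M.+1) k (g : k.-tuple (edge M)) (h : seq (edge N)) :
  insertion p i g h =
  \sum_(r : k.-tuple (edge (M + N))
        | [seq (collapse i e.1, collapse i e.2) | e <- r] == g)
    gvec p (r ++ [seq (inner i e.1, inner i e.2) | e <- h]).
Proof.
by case: g => g /= /eqP e; case: k / e.
Qed.

Lemma insertion_relL M N p (i : 'I_M.+1) k (g : k.-tuple (edge M))
    (h : seq (edge N)) (t : 'S_k) :
  edge_rel (insertion p i (edge_perm t g) h - edge_sign t *: insertion p i g h).
Proof.
pose pt (u : 'S_k) (r : k.-tuple (edge (M + N))) := [tuple tnth r (u a) | a < k].
have ptK u : cancel (pt u) (pt u^-1%g).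
  by move=> r; apply: eq_from_tnth => a; rewrite !tnth_mktuple permKV.
have pt_inj u : injective (pt u) by apply: can_inj (ptK u).
rewrite !insertionE (reindex_inj (pt_inj t)) /=.
rewrite (eq_bigl (fun r : k.-tuple (edge (M + N)) =>
    [seq (collapse i e.1, collapse i e.2) | e <- r] == g)).
  rewrite scaler_sumr -sumrB; apply: edge_rel_sum => r _.
  exact: edge_rel_catL.
move=> r; rewrite -[map _ _]/(map _ (edge_perm t r)) map_edge_perm.
have pmK (u : 'S_k) : injective (fun r : k.-tuple (edge M) => edge_perm u r).
  move=> r1 r2 /val_inj e; apply: eq_from_tnth => a.
  by have := congr1 (fun z => tnth z (u^-1%g a)) e; rewrite !tnth_mktuple permKV.
by apply/eqP/eqP => [/pmK <- //|e]; congr edge_perm; apply/val_inj.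
Qed.

Lemma insertion_relR M N p (i : 'I_M.+1) k (g : seq (edge M))
    (h : k.-tuple (edge N)) (t : 'S_k) :
  edge_rel (insertion p i g (edge_perm t h) - edge_sign t *: insertion p i g h).
Proof.
rewrite /insertion scaler_sumr -sumrB; apply: edge_rel_sum => r _.
rewrite map_edge_perm; exact: (edge_rel_catR _ _ [tuple of map _ h]).
Qed.

Lemma circ_free_relL M N p q (i : 'I_M.+1) (x : {freeg (hgraph M p) / K})
    (y : {freeg (hgraph N q) / K}) : edge_rel x -> edge_rel (circ_free i x y).
Proof.
elim=> [|c k g t z _ IH]; first by rewrite /circ_free fglift0; exact: EdgeRel0.
rewrite /circ_free fglift_linear; apply: edge_relZD => //.
rewrite [gvec _ _ + _]addrC -scaleNr fglift_linear.
rewrite !(lift_gvec _ (fun g =>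
  fglift (fun h : hgraph N q => insertion (p + q) i g (val h)) y)).
rewrite /graph_deg size_edge_perm; case: ifP => _; last first.
  by rewrite scaler0 addr0; exact: EdgeRel0.
rewrite [_ *: _ + fglift _ _]addrC scaleNr !fglift_sumE scaler_sumr -sumrB.
apply: edge_rel_sum => h _; rewrite scalerA mulrC -scalerA -scalerBr.
rewrite -[_ *: _]addr0; apply: edge_relZD; last exact: EdgeRel0.
exact: insertion_relL.
Qed.

Lemma circ_free_linear M N p q (i : 'I_M.+1) (x : {freeg (hgraph M p) / K}) :
  linear (circ_free i x : {freeg (hgraph N q) / K} -> _).
Proof.
move=> a u v; rewrite /circ_free !(fglift_sumE _ x) scaler_sumr -big_split.
apply: eq_bigr => g _ /=; rewrite fglift_linear scalerDr !scalerA.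
by rewrite [a * _]mulrC.
Qed.

Lemma circ_free_relR M N p q (i : 'I_M.+1) (x : {freeg (hgraph M p) / K})
    (y : {freeg (hgraph N q) / K}) : edge_rel y -> edge_rel (circ_free i x y).
Proof.
rewrite /circ_free fglift_sumE => hy; apply: edge_rel_sum => g _.
rewrite -[_ *: _]addr0; apply: edge_relZD; last exact: EdgeRel0.
elim: hy => [|c k h t z _ IH]; first by rewrite fglift0; exact: EdgeRel0.
rewrite fglift_linear; apply: edge_relZD => //.
rewrite [gvec _ _ + _]addrC -scaleNr fglift_linear.
rewrite !(lift_gvec _ (fun h => insertion (p + q) i (val g) h)).
rewrite /graph_deg size_edge_perm; case: ifP => _; last first.
  by rewrite scaler0 addr0; exact: EdgeRel0.
rewrite [_ *: _ + _]addrC scaleNr; exact: insertion_relR.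
Qed.

Lemma dgra_circ_class M N p q (i : 'I_M.+1) (x : {freeg (hgraph M p) / K})
    (y : {freeg (hgraph N q) / K}) :
  dgra_circ i (gclass x) (gclass y) = gclass (circ_free i x y).
Proof.
rewrite /dgra_circ; set x' := grepr _; set y' := grepr _.
transitivity (gclass (circ_free i x' y)).
  apply/gclass_eq; rewrite [circ_free _ _ _ - _]addrC -scaleN1r -circ_free_linear scaleN1r [- _ + _]addrC.
  by apply: circ_free_relR; apply/gclass_eq; rewrite greprK.
apply/gclass_eq; rewrite [circ_free _ _ _ - _]addrC -scaleN1r /circ_free -fglift_linear scaleN1r [- _ + _]addrC.
by apply: circ_free_relL; apply/gclass_eq; rewrite greprK.
Qed.

Definition dGra : operad_data K :=
  Operad dgra_act dgra_circ (gclass (gvec 0 [::] : {freeg (hgraph 0 0) / K})).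

Definition graph_class N (g : seq (edge N)) : op_sort dGra N (graph_deg g) :=
  gclass (gvec (graph_deg g) g).

End DGra.

Section Smooth.
Variables (R : realType) (b : nat) (U : set 'rV[R]_b).
Implicit Types (f g : 'rV[R]_b -> R^o) (k : nat).

(* Functions of class C^k on the open set [U].                                 *)
Fixpoint Ck k f : Prop :=
  (forall x, U x -> {for x, continuous f}) /\
  if k is k'.+1 then forall j : 'I_b,
    (forall x, U x -> derivable f x (delta_mx 0 j)) /\
    Ck k' (fun x => 'D_(delta_mx 0 j) f x)
  else True.

Definition smooth f : Prop := forall k, Ck k f.

Hypothesis oU : open U.

Lemma near_U f g x : U x -> (forall y, U y -> f y = g y) -> {near x, f =1 g}.
Proof.
move=> Ux fg; near=> y; apply: fg; near: y; exact: open_nbhs_nbhs.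
Unshelve. all: by end_near. Qed.

Lemma Ck_ext k f g : (forall x, U x -> f x = g x) -> Ck k f -> Ck k g.
Proof.
have cont (h h' : 'rV[R]_b -> R^o) : (forall x, U x -> h x = h' x) ->
    (forall x, U x -> {for x, continuous h}) -> forall x, U x -> {for x, continuous h'}.
  move=> hh' ch x Ux; rewrite /prop_for /continuous_at -hh' //.
  apply: cvg_trans (ch x Ux); apply: near_eq_cvg.
    exact: (nbhs_filter x).
  exact: near_U Ux hh'.
elim: k f g => [|k IH] f g fg /= [cf df]; split=> //; try exact: cont fg cf.
move=> j; have [dj Cj] := df j; split.
  by move=> x Ux; apply: near_eq_derivable (dj x Ux); exact: near_U Ux fg.
apply: IH Cj => x Ux; apply: near_eq_derive; exact: near_U Ux fg.
Qed.

Lemma CkS k f : Ck k.+1 f -> Ck k f.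
Proof.
elim: k f => [|k IH] f; first by case.
by case=> cf df; split=> // j; have [dj /IH] := df j.
Qed.

Lemma Ck_cst k (c : R^o) : Ck k (fun=> c).
Proof.
have cc (e : R^o) : forall x : 'rV[R]_b, U x -> {for x, continuous (fun=> e)}.
  by move=> x _; exact: cst_continuous.
elim: k c => [|k IH] c /=; split=> //; try exact: cc.
move=> j; split; first by move=> x _; exact: derivable_cst.
by apply: Ck_ext (IH 0) => x _; rewrite derive_cst.
Qed.

Lemma Ck_lin k (c : R) f g : Ck k f -> Ck k g -> Ck k (c *: f + g).
Proof.
have cl (h h' : 'rV[R]_b -> R^o) :
    (forall x, U x -> {for x, continuous h}) ->
    (forall x, U x -> {for x, continuous h'}) ->
    forall x, U x -> {for x, continuous (c *: h + h')}.
  move=> ch ch' x Ux; apply: continuousD; last exact: ch'.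
  by apply: (@continuousZl_tmp _ _ _ h c); exact: ch.
elim: k f g => [|k IH] f g /= [cf df] [cg dg]; split=> //; try exact: cl.
move=> j; have [fj Cf] := df j; have [gj Cg] := dg j; split.
  by move=> x Ux; apply: derivableD; [apply: derivableZ; exact: fj|exact: gj].
apply: Ck_ext (IH _ _ Cf Cg) => x Ux.
rewrite deriveD ?deriveZ //; [exact: fj|apply: derivableZ; exact: fj|exact: gj].
Qed.

Lemma Ck_mul k f g : Ck k f -> Ck k g -> Ck k (f * g).
Proof.
have cm (h h' : 'rV[R]_b -> R^o) :
    (forall x, U x -> {for x, continuous h}) ->
    (forall x, U x -> {for x, continuous h'}) ->
    forall x, U x -> {for x, continuous (h * h')}.
  by move=> ch ch' x Ux; apply: (@continuousM _ _ h h'); [exact: ch|exact: ch'].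
elim: k f g => [|k IH] f g hf hg; have [cf df] := hf; have [cg dg] := hg;
  split=> //; try exact: cm.
move=> j; have [fj Cf] := df j; have [gj Cg] := dg j; split.
  by move=> x Ux; apply: derivableM; [exact: fj|exact: gj].
apply: Ck_ext (Ck_lin 1 (IH _ _ (CkS hf) Cg) (IH _ _ (CkS hg) Cf)) => x Ux.
by rewrite deriveM; [rewrite scale1r|exact: fj|exact: gj].
Qed.

Lemma Ck_der k j f : Ck k.+1 f -> Ck k (fun x => 'D_(delta_mx 0 j) f x).
Proof. by case=> _ /(_ j)[]. Qed.

Lemma smooth_cst (c : R) : smooth (fun=> c : R^o).
Proof. by move=> k; exact: Ck_cst. Qed.
Lemma smooth_lin (c : R) f g : smooth f -> smooth g -> smooth (c *: f + g).
Proof. by move=> hf hg k; exact: Ck_lin. Qed.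
Lemma smooth_mul f g : smooth f -> smooth g -> smooth (f * g).
Proof. by move=> hf hg k; exact: Ck_mul. Qed.
Lemma smooth_der j f : smooth f -> smooth (fun x => 'D_(delta_mx 0 j) f x).
Proof. by move=> hf k; exact: Ck_der. Qed.
Lemma smooth_ext f g : (forall x, U x -> f x = g x) -> smooth f -> smooth g.
Proof. by move=> fg hf k; exact: Ck_ext fg (hf k). Qed.
Lemma smooth_sum (I : Type) (s : seq I) (P : pred I) (F : I -> 'rV[R]_b -> R^o) :
  (forall j, P j -> smooth (F j)) -> smooth (\sum_(j <- s | P j) F j).
Proof.
move=> h; apply: big_ind => //; first exact: (smooth_cst 0).
by move=> f g hf hg; rewrite -[f]scale1r; exact: smooth_lin.
Qed.

End Smooth.

(* An N-graded domain: coordinates with their degrees; the coordinates of      *)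
(* degree 0 range over the open set [gd_body].                                 *)
Record gdomain (R : realType) := GDomain {
  gd_coord : finType;
  gd_deg : gd_coord -> nat;
  gd_body : set 'rV[R]_#|[pred c | gd_deg c == 0%N]|;
  gd_open : open gd_body }.

Section Functions.
Variables (R : realType) (D : gdomain R).
Local Notation C := (gd_coord D).
Local Notation deg := (@gd_deg R D).
Local Notation U := (@gd_body R D).
Local Notation point := 'rV[R]_#|[pred c | deg c == 0%N]|.

(* A monomial in the coordinates of positive degree, ordered as in the         *)
(* enumeration of [C], is given by its exponents; an odd one has exponent <= 1. *)
Definition monom := {ffun C -> nat}.
Implicit Types (m a : monom) (c : C).

Definition admissible m : bool :=
  [forall c, ((deg c == 0%N) ==> (m c == 0%N)) && (odd (deg c) ==> (m c <= 1)%N)].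

Definition mdeg m : nat := \sum_c m c * deg c.

Definition before c c' : bool := (enum_rank c < enum_rank c')%N.

(* The number of transpositions of odd coordinates that order the product of   *)
(* the monomials [m] and [m'].                                                 *)
Definition reorder m m' : nat :=
  \sum_c \sum_(c' | before c' c && odd (deg c) && odd (deg c')) m c * m' c'.

(* A function on the graded domain is a polynomial in the coordinates of       *)
(* positive degree whose coefficients are smooth on [U]; a smooth function on  *)
(* [U] is represented by its extension by 0.                                   *)
Definition cinf_pred : {pred monom -> point -> R^o} := fun F =>
  `[< [/\ forall m, smooth U (F m),
          forall m x, ~ U x -> F m x = 0,
          forall m, ~~ admissible m -> F m = 0
        & exists s : seq monom, forall m, m \notin s -> F m = 0] >].

Lemma cinf_closed : submod_closed cinf_pred.
Proof.
split=> [|a F G]; rewrite !inE.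
  by split=> //; [move=> m; exact: smooth_cst (@gd_open R D) 0|exists [::]].
move=> [sF oF aF [s Fs]] [sG oG aG [t Gt]]; split.
- by move=> m; apply: (smooth_lin (@gd_open R D)); [exact: sF|exact: sG].
- by move=> m x Ux; rewrite -[LHS]/(a *: F m x + G m x) oF // oG // scaler0 addr0.
- by move=> m am; rewrite -[LHS]/(a *: F m + G m) aF // aG // scaler0 addr0.
- exists (s ++ t) => m; rewrite mem_cat negb_or => /andP[ms mt].
  by rewrite -[LHS]/(a *: F m + G m) Fs // Gt // scaler0 addr0.
Qed.
HB.instance Definition _ :=
  GRing.isSubmodClosed.Build R (monom -> point -> R^o) cinf_pred cinf_closed.

Record cinf := Cinf {
  cinf_fun :> monom -> point -> R^o; _ : cinf_fun \in cinf_pred }.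
HB.instance Definition _ := [isSub for cinf_fun].
HB.instance Definition _ := [Choice of cinf by <:].
HB.instance Definition _ := [SubChoice_isSubLmodule of cinf by <:].

Lemma cinfP (f : cinf) : cinf_fun f \in cinf_pred. Proof. exact: valP. Qed.

Lemma cinf_eqP (f g : cinf) : (forall m x, f m x = g m x) -> f = g.
Proof. by move=> h; apply/val_inj/funext => m; apply/funext => x; exact: h. Qed.

Lemma cinfZDE (a : R) (f g : cinf) m x :
  (a *: f + g) m x = a * f m x + g m x.
Proof. by []. Qed.

Definition one_fun m (x : point) : R^o :=
  if (m == [ffun=> 0%N]) && (x \in U) then 1 else 0.

(* The coefficient of [m] collects the products of monomials m1 + m2 = m.      *)
Definition mul_fun (F G : monom -> point -> R^o) m (x : point) : R^o :=
  if admissible m then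
    \sum_(a : {dffun forall c : C, 'I_(m c).+1})
      let m1 := [ffun c => nat_of_ord (a c)] in
      let m2 := [ffun c => (m c - a c)%N] in
      (-1) ^+ reorder m1 m2 * F m1 x * G m2 x
  else 0.

Definition unit_vec c : point := \row_j (enum_val j == c)%:R.

(* Left derivative: d/dz_c moves past the odd coordinates before [c].          *)
Definition partial_fun c (F : monom -> point -> R^o) m (x : point) : R^o :=
  if deg c == 0%N then (if x \in U then 'D_(unit_vec c) (F m) x else 0)
  else (-1) ^+ (\sum_(c' | before c' c && odd (deg c) && odd (deg c')) m c')
       * (m c).+1%:R * F [ffun c' => (m c' + (c' == c))%N] x.

Lemma one_in : one_fun \in cinf_pred.
Proof.
rewrite inE; split.
- move=> m; case: (eqVneq m [ffun=> 0%N]) => m0.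
    apply: (smooth_ext (@gd_open R D)) (smooth_cst (@gd_open R D) 1) => x Ux.
    by rewrite /one_fun m0 eqxx mem_set.
  apply: (smooth_ext (@gd_open R D)) (smooth_cst (@gd_open R D) 0) => x Ux.
  by rewrite /one_fun (negPf m0).
- by move=> m x Ux; rewrite /one_fun memNset // andbF.
- move=> m am; apply/funext => x; rewrite /one_fun; case: eqP => // m0.
  case/negP: am; rewrite m0; apply/forallP => c.
  by rewrite !ffunE eqxx !implybT.
- by exists [:: [ffun=> 0%N]] => m; rewrite inE => m0; apply/funext => x;
    rewrite /one_fun (negPf m0).
Qed.

Lemma mul_in F G : F \in cinf_pred -> G \in cinf_pred ->
  mul_fun F G \in cinf_pred.
Proof.
rewrite !inE => -[sF oF aF [s Fs]] [sG oG aG [t Gt]]; split.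
- move=> m; rewrite /mul_fun; case: (admissible m); last exact: smooth_cst (@gd_open R D) 0.
  set E := (X in smooth _ X).
  have -> : E = \sum_(a : {dffun forall c : C, 'I_(m c).+1})
      (fun=> (-1) ^+ reorder [ffun c => nat_of_ord (a c)] [ffun c => (m c - a c)%N] : R^o)
        * F [ffun c => nat_of_ord (a c)] * G [ffun c => (m c - a c)%N].
    by apply/funext => x; rewrite fct_sumE.
  apply: (smooth_sum (@gd_open R D)) => a _.
  apply: (smooth_mul (@gd_open R D)) => //; apply: (smooth_mul (@gd_open R D)) => //.
  exact: smooth_cst (@gd_open R D) _.
- move=> m x Ux; rewrite /mul_fun; case: ifP => // _.
  by apply: big1 => a _ /=; rewrite oF // mulr0 mul0r.
- by move=> m am; apply/funext => x; rewrite /mul_fun (negPf am).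
- exists [seq ([ffun c => (a c + b c)%N] : monom) | a : monom <- s, b : monom <- t] => m mst.
  apply/funext => x; rewrite /mul_fun; case: ifP => // _.
  apply: big1 => a _ /=.
  set m1 := [ffun c => _]; set m2 := [ffun c => (_ - _)%N].
  case: (boolP (m1 \in s)) => [m1s|/Fs ->]; last by rewrite mulr0 mul0r.
  case: (boolP (m2 \in t)) => [m2t|/Gt ->]; last by rewrite mulr0.
  case/negP: mst; apply/allpairsP; exists (m1, m2); split=> //.
  apply/ffunP => c; rewrite !ffunE subnKC //.
  by rewrite -ltnS.
Qed.

Lemma smooth_unit c f : smooth U f -> smooth U (fun x => 'D_(unit_vec c) f x).
Proof.
move=> sf; case: (boolP (deg c == 0%N)) => c0.
  have -> : unit_vec c = delta_mx 0 (enum_rank_in (c0 : c \in [pred c | deg c == 0%N]) c).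
    apply/rowP => j; rewrite !mxE eqxx /=; congr (nat_of_bool _)%:R.
    apply/eqP/eqP => [jc|->]; last by rewrite enum_rankK_in.
    by apply: enum_val_inj; rewrite enum_rankK_in.
  exact: smooth_der.
have -> : unit_vec c = 0.
  apply/rowP => j; rewrite !mxE; case: eqP => // jc.
  by case/negP: c0; rewrite -jc; have := enum_valP j.
apply: (smooth_ext (@gd_open R D)) (smooth_cst (@gd_open R D) 0) => x Ux.
by rewrite derive0.
Qed.

Lemma partial_in c F : F \in cinf_pred -> partial_fun c F \in cinf_pred.
Proof.
rewrite !inE => -[sF oF aF [s Fs]]; split.
- move=> m; rewrite /partial_fun; case: (deg c == 0%N).
    apply: (smooth_ext (@gd_open R D)) (smooth_unit c (sF m)) => x Ux.
    by rewrite mem_set.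
  set k := (_ * _); apply: (smooth_ext (@gd_open R D))
    (smooth_mul (@gd_open R D) (smooth_cst (@gd_open R D) k) (sF _)) => x Ux.
  by [].
- move=> m x Ux; rewrite /partial_fun; case: ifP => _; first by rewrite memNset.
  by rewrite oF // mulr0.
- move=> m am; apply/funext => x; rewrite /partial_fun; case: ifP => c0.
    by rewrite aF // derive_cst if_same.
  rewrite aF ?mulr0 //; apply: contra am => /forallP h; apply/forallP => c'.
  have := h c'; rewrite ffunE => /andP[/implyP h1 /implyP h2].
  apply/andP; split; apply/implyP => /[dup] d'.
    by move/h1; rewrite addn_eq0 => /andP[].
  by move/h2; apply: leq_trans; exact: leq_addr.
- exists (s ++ [seq ([ffun c' => (m c' - (c' == c))%N] : monom) | m : monom <- s]) => m.
  rewrite mem_cat negb_or => /andP[ms mt]; apply/funext => x.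
  rewrite /partial_fun Fs // derive_cst if_same; case: ifP => // _.
  rewrite Fs ?mulr0 //; apply: contra mt => h; apply/mapP; exists ([ffun c' => (m c' + (c' == c))%N] : monom) => //.
  by apply/ffunP => c'; rewrite !ffunE addnK.
Qed.

Definition cinf_one : cinf := Cinf one_in.
Definition cinf_mul (f g : cinf) : cinf := Cinf (mul_in (cinfP f) (cinfP g)).
Definition partial c (f : cinf) : cinf := Cinf (partial_in c (cinfP f)).

Definition comp_fun (p : int) (F : monom -> point -> R^o) m : point -> R^o :=
  if (mdeg m)%:Z == p then F m else 0.

Lemma comp_in p F : F \in cinf_pred -> comp_fun p F \in cinf_pred.
Proof.
rewrite !inE => -[sF oF aF [s Fs]]; split.
- by move=> m; rewrite /comp_fun; case: ifP => // _; exact: smooth_cst (@gd_open R D) 0.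
- by move=> m x Ux; rewrite /comp_fun; case: ifP => // _; exact: oF.
- by move=> m am; rewrite /comp_fun; case: ifP => // _; exact: aF.
- by exists s => m ms; rewrite /comp_fun Fs // if_same.
Qed.

Definition cinf_comp p (f : cinf) : cinf := Cinf (comp_in p (cinfP f)).

Lemma cinf_comp_linear p : linear (cinf_comp p).
Proof.
move=> a f g; apply: cinf_eqP => m x; rewrite cinfZDE /= /comp_fun.
by case: ifP => //; rewrite mulr0 addr0.
Qed.

Lemma cinf_compK p q f :
  cinf_comp p (cinf_comp q f) = if p == q then cinf_comp q f else 0.
Proof.
apply: cinf_eqP => m x; rewrite /= /comp_fun.
case: (eqVneq p q) => [->|pq] /=; rewrite /comp_fun; first by case: ifP => // ->.
case: eqP => // mp; case: eqP => // mq.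
by move: pq; rewrite -mp -mq eqxx.
Qed.

Lemma cinf_sumE (I : Type) (s : seq I) (F : I -> cinf) m x :
  (\sum_(j <- s) F j) m x = \sum_(j <- s) F j m x.
Proof. by elim: s => [|j s IH]; rewrite ?big_nil ?big_cons // -IH. Qed.

Lemma cinf_comp_sum f :
  exists2 s : seq int, uniq s & f = \sum_(p <- s) cinf_comp p f.
Proof.
have := cinfP f; rewrite inE => -[_ _ _ [s Fs]].
exists (undup [seq (mdeg m)%:Z | m <- s]); first exact: undup_uniq.
apply: cinf_eqP => m x; rewrite cinf_sumE.
case: (boolP (m \in s)) => ms; last first.
  by rewrite Fs // big1 // => p _ /=; rewrite /comp_fun Fs // if_same.
rewrite (bigD1_seq ((mdeg m)%:Z)) ?undup_uniq //=; last first.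
  by rewrite mem_undup; apply/mapP; exists m.
rewrite /comp_fun eqxx big1 ?addr0 // => p /negPf pm.
by rewrite eq_sym pm.
Qed.

Definition Cinfty : gvect R :=
  GVect cinf_comp_linear cinf_compK cinf_comp_sum.

End Functions.

Section Darboux.
Variables (n m : nat) (r : nat -> nat) (s : nat).

(* The ordinal [k] stands for the degree [k.+1], so that degrees range over    *)
(* 1, ..., (n - 1) / 2 for [n] odd and 1, ..., n / 2 - 1 for [n] even;         *)
(* [r k.+1] is the number of coordinates psi of degree [k.+1].                 *)
Definition aux_index : finType := {k : 'I_(n.-1)./2 & 'I_(r k.+1)}.

Inductive dcoord :=
| crd_x of 'I_m | crd_psi of aux_index | crd_xi of 'I_s
| crd_chi of aux_index | crd_p of 'I_m.

Definition dcoord_sum (c : dcoord) :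
    ('I_m + 'I_m) + (aux_index + aux_index) + 'I_s :=
  match c with
  | crd_x i => inl (inl (inl i)) | crd_p i => inl (inl (inr i))
  | crd_psi a => inl (inr (inl a)) | crd_chi a => inl (inr (inr a))
  | crd_xi i => inr i
  end.

Definition sum_dcoord (c : ('I_m + 'I_m) + (aux_index + aux_index) + 'I_s) :
    dcoord :=
  match c with
  | inl (inl (inl i)) => crd_x i | inl (inl (inr i)) => crd_p i
  | inl (inr (inl a)) => crd_psi a | inl (inr (inr a)) => crd_chi a
  | inr i => crd_xi i
  end.

Lemma dcoord_sumK : cancel dcoord_sum sum_dcoord. Proof. by case. Qed.
HB.instance Definition _ := Finite.copy dcoord (can_type dcoord_sumK).

Definition dcoord_deg (c : dcoord) : nat :=
  match c with
  | crd_x _ => 0 | crd_psi a => (tag a).+1 | crd_xi _ => n./2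
  | crd_chi a => n - (tag a).+1 | crd_p _ => n
  end.

End Darboux.

(* An NP-manifold of degree [n] in Darboux coordinates: the symplectic form    *)
(* dx /\ dp + dpsi /\ dchi + (1/2) kappa_ab dxi^a /\ dxi^b is determined by     *)
(* the numbers of coordinates of each kind and by [np_kappa].                  *)
Record np_manifold (R : realType) (n : nat) := NPManifold {
  np_dim : nat;
  np_aux : nat -> nat;
  np_mid : nat;
  np_kappa : 'M[R]_np_mid;
  np_body : set 'rV[R]_#|[pred c : dcoord n np_dim np_aux np_mid |
                           dcoord_deg c == 0%N]|;
  np_body_open : open np_body;
  np_kappa_unit : np_kappa \in unitmx;
  np_kappa_sym : forall a b,
    np_kappa a b = - (-1) ^+ n./2 * np_kappa b a;
  np_mid_odd : odd n -> np_mid = 0%N;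
  np_dim0 : n = 0%N -> np_dim = 0%N }.

Section DRep.
Variables (R : realType) (n : nat) (V : np_manifold R n).

Definition np_domain : gdomain R := GDomain (@np_body_open R n V).
Local Notation A := (Cinfty np_domain).
Local Notation x_ mu := (crd_x _ _ _ mu : gd_coord np_domain).
Local Notation psi_ a := (crd_psi _ _ a : gd_coord np_domain).
Local Notation xi_ a := (crd_xi _ _ _ a : gd_coord np_domain).
Local Notation chi_ a := (crd_chi _ _ a : gd_coord np_domain).
Local Notation p_ mu := (crd_p _ _ _ mu : gd_coord np_domain).

(* The left derivative on the i-th factor of the pure tensor f_1 (x) ... f_N. *)
Definition tpartial N (c : gd_coord np_domain) (i : 'I_N) (f : 'I_N -> A) :
    'I_N -> A :=
  fun j => if j == i then partial c (f i)
           else if (j < i)%N then gv_sign (odd (gd_deg c)) (f j) else f j.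

Definition mu_ N (f : 'I_N -> A) : A :=
  \big[@cinf_mul R np_domain/@cinf_one R np_domain]_(i < N) f i.

(* A linear map out of the N-fold tensor power of A is given by its values [t] *)
(* on pure tensors; [comp_Delta t (i, j)] is its composite with Delta_ij. For  *)
(* [n] odd there is no xi and the last sum is empty.                           *)
Definition comp_Delta N (t : ('I_N -> A) -> A) (e : 'I_N * 'I_N)
    (f : 'I_N -> A) : A :=
  let: (i, j) := e in
  \sum_(mu < np_dim V) t (tpartial (x_ mu) i (tpartial (p_ mu) j f))
  + \sum_a t (tpartial (psi_ a) i (tpartial (chi_ a) j f))
  + \sum_a \sum_b (2^-1 * invmx (np_kappa V) a b) *:
      t (tpartial (xi_ a) i (tpartial (xi_ b) j f)).

Definition dRep N (g : seq ('I_N * 'I_N)) : ('I_N -> A) -> A :=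
  foldl (@comp_Delta N) (@mu_ N) g.

End DRep.
Arguments dRep {R n} V {N} g f.

(* Main.v *)
Require Import Defs.
From HB Require Import structures.
From mathcomp Require Import freeg.
From mathcomp Require Import all_boot all_order all_algebra all_fingroup.
From mathcomp Require Import all_classical all_reals all_analysis.
From mathcomp Require Import zify ring lra.

(* Write T_c,i for the derivative d/dz_c on the i-th tensor factor. These      *)
(* operators supercommute (Schwarz's theorem for the coordinates of degree 0), *)
(* so the Delta_ij, of degree -n, commute up to (-1)^n, which is the sign of   *)
(* a transposition of two edges. By the Leibniz rule a derivative of a product *)
(* of inserted factors is the sum of its derivatives on the single factors:    *)
(* moving Delta_ij through the multiplication at the vertex of insertion       *)
(* reconnects the edge in all possible ways. Conjugating T_c,i by a permutation *)
(* of the factors, with its Koszul sign, gives T_c,s(i), and the product is    *)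
(* graded commutative, whence equivariance.                                    *)

Set Implicit Arguments.
Unset Strict Implicit.
Unset Printing Implicit Defensive.

Import Order.TTheory GRing.Theory Num.Theory numFieldNormedType.Exports.
Local Open Scope classical_set_scope.
Local Open Scope ring_scope.

(** * Symmetry of second derivatives *)

(** A function is a finite sum of terms, each a smooth coefficient times one monomial. By additivity
    ([cinf_ind]) the algebra can be checked on single terms, where it becomes bookkeeping of
    reordering signs. The product is associative ([cinf_mulA]) and graded commutative ([cinf_mulC]),
    every partial derivative is a graded derivation ([leibniz]), and partial derivatives
    supercommute ([partialC]), the case of two degree 0 coordinates being Schwarz's theorem.

    Edge relations: derivatives on tensor factors supercommute ([precompC]), and the degrees of
    conjugate coordinates add up to n ([deg_source_target]). So each Delta has parity n, and two of
    them commute up to (-1)^n ([comp_DeltaC]). Permuting the edges by s therefore costs (-1)^(n s),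
    the sign imposed in dGra_(n+1) ([dRep_edge_perm]), and the action descends to classes of graphs.

    Composition: in dRep(g) applied to factors one of which is dRep(h) of a block, the edges of h
    are pulled out of the slot ([foldl_slot]). They produce exactly the Koszul sign of a map of
    parity n|E_h| moved past the factors on its left. What remains in the slot is a plain product,
    and [foldl_slot_mu] distributes every edge of g over the block by the Leibniz rule, which is the
    sum over reconnections. Associativity merges the two products ([mu_slot]); the result is
    [dRep_insertion].

    Equivariance: for factors of definite parity the product transforms by the Koszul sign
    ([mu_perm]), and each further Delta preserves this property with its vertices relabelled
    ([intertwines_comp_Delta]). Multilinearity extends it to all factors
    ([multilinear_parity_ext]). *)

Section Schwarz.
Variables (R : realType) (W : normedModType R).
Implicit Types (f : W -> R^o) (x u v : W).

Lemma is_derive_line f x u (t : R) : derivable f (x + t *: u) u ->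
  is_derive t (1 : R) (fun s : R => f (x + s *: u) : R^o) ('D_u f (x + t *: u)).
Proof.
have E : (fun h : R =>
      h^-1 *: (f (x + (h *: (1 : R^o) + t) *: u) - f (x + t *: u)))
  = (fun h : R => h^-1 *: (f (h *: u + (x + t *: u)) - f (x + t *: u))).
  apply/funext => h; congr (_ *: (f _ - _)).
  by rewrite scalerDl [h *: 1]mulr1 addrCA.
move=> df; apply: DeriveDef; first by rewrite /derivable /= E.
by rewrite /derive /= E.
Qed.

Definition second_difference f x u v : R :=
  f (x + u + v) - f (x + u) - f (x + v) + f x.

Lemma second_difference_sym f x u v :
  second_difference f x u v = second_difference f x v u.
Proof.
rewrite /second_difference (addrAC x u v); ring.
Qed.

(** Two uses of the mean value theorem: along u for the increment of f in the direction v, then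
    along v for the derivative ['D_u f]. The bound on h keeps the whole parallelogram inside the
    ball. *)
Lemma second_differenceE f x u v (r h : R) : 0 < h -> h * (`|u| + `|v|) < r ->
  (forall y, ball x r y -> derivable f y u) ->
  (forall y, ball x r y -> derivable ('D_u f : W -> R^o) y v) ->
  exists2 y, ball x r y &
    second_difference f x (h *: u) (h *: v) =
    h ^+ 2 * 'D_v ('D_u f : W -> R^o) y.
Proof.
move=> h0 hr du dv.
have inb (s t : R) : 0 <= s <= h -> 0 <= t <= h ->
  ball x r (x + s *: u + t *: v).
  move=> /andP[s0 sh] /andP[t0 th]; rewrite -ball_normE /ball_ /=.
  rewrite -addrA opprD addNKr normrN; apply: le_lt_trans hr.
  apply: le_trans (ler_normD _ _) _; rewrite !normrZ !ger0_norm // mulrDr.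
  by rewrite lerD // ler_wpM2r.
pose phi (s : R) : R^o := f (x + h *: v + s *: u) - f (x + s *: u).
pose dphi (s : R) : R^o := 'D_u f (x + h *: v + s *: u) - 'D_u f (x + s *: u).
have dphiE s : 0 <= s <= h -> is_derive s (1 : R) phi (dphi s).
  move=> sh; apply: is_deriveB.
    apply: is_derive_line; apply: du; rewrite addrAC; apply: inb => //.
    by rewrite lexx ltW.
  apply: is_derive_line; apply: du; rewrite -[x + _]addr0 -(scale0r v).
  by apply: inb => //; rewrite lexx ltW.
have oc (s : R) : s \in `]0, h[ -> 0 <= s <= h.
  by rewrite in_itv /= => /andP[s0 sh]; rewrite !ltW.
have [|s /oc sh Es] := @MVT R phi dphi 0 h h0 (fun s sh => dphiE s (oc s sh)).
  apply: derivable_within_continuous => s; rewrite in_itv /= => sh.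
  by have [] := dphiE s sh.
pose psi (t : R) : R^o := 'D_u f (x + s *: u + t *: v).
pose dpsi (t : R) : R^o := 'D_v ('D_u f : W -> R^o) (x + s *: u + t *: v).
have dpsiE t : 0 <= t <= h -> is_derive t (1 : R) psi (dpsi t).
  by move=> th; apply: is_derive_line; apply: dv; apply: inb.
have [|t /oc th Et] := @MVT R psi dpsi 0 h h0 (fun t th => dpsiE t (oc t th)).
  apply: derivable_within_continuous => t; rewrite in_itv /= => th.
  by have [] := dpsiE t th.
exists (x + s *: u + t *: v); first exact: inb.
have -> : second_difference f x (h *: u) (h *: v) = phi h - phi 0.
  rewrite /second_difference /phi !scale0r !addr0 (addrAC x (h *: v)); ring.
rewrite Es subr0 /dphi (addrAC x (h *: v)).
have -> : 'D_u f (x + s *: u) = psi 0 by rewrite /psi scale0r addr0.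
rewrite -[X in X - _]/(psi h) Et subr0 /dpsi; ring.
Qed.

(** The second difference is symmetric in u and v, so on arbitrarily small parallelograms the two
    mixed derivatives take a common value, at possibly different points. By continuity, mixed
    derivatives that differ at x cannot do this close to x. *)
Lemma schwarz f x u v (r : R) : 0 < r ->
  (forall y, ball x r y -> derivable f y u) ->
  (forall y, ball x r y -> derivable f y v) ->
  (forall y, ball x r y -> derivable ('D_u f : W -> R^o) y v) ->
  (forall y, ball x r y -> derivable ('D_v f : W -> R^o) y u) ->
  {for x, continuous ('D_v ('D_u f : W -> R^o) : W -> R^o)} ->
  {for x, continuous ('D_u ('D_v f : W -> R^o) : W -> R^o)} ->
  'D_v ('D_u f : W -> R^o) x = 'D_u ('D_v f : W -> R^o) x.
Proof.
move=> r0 du dv duv dvu cuv cvu; apply/eqP; apply: contraT => ne.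
pose e := `|'D_v ('D_u f : W -> R^o) x - 'D_u ('D_v f : W -> R^o) x| / 2.
have e0 : 0 < e by rewrite divr_gt0 // normr_gt0 subr_eq0.
have near_x (g : W -> R^o) : {for x, continuous g} ->
    exists2 s, 0 < s & forall y, ball x s y -> `|g x - g y| < e.
  by move=> /cvgrPdist_lt /(_ e e0) /nbhs_ballP[s s0 gs]; exists s.
have [r1 r10 c1] := near_x _ cuv; have [r2 r20 c2] := near_x _ cvu.
pose q := Num.min r (Num.min r1 r2).
have q0 : 0 < q by rewrite !lt_min r0 r10 r20.
(* The summand 1 keeps the denominator positive when u = v = 0. *)
pose h := q / (2 * (`|u| + `|v| + 1)).
have uv0 : 0 < `|u| + `|v| + 1 by rewrite ltr_wpDl // addr_ge0.
have h0 : 0 < h by rewrite divr_gt0 // mulr_gt0.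
have hq : h * (`|u| + `|v|) < q.
  rewrite /h mulrAC ltr_pdivrMr ?mulr_gt0 //.
  rewrite ltr_pM2l //; apply: (@lt_trans _ _ (`|u| + `|v| + 1));
    first by rewrite ltrDl.
  by rewrite mulr_natl mulr2n ltrDl.
have sub y : ball x q y -> [/\ ball x r y, ball x r1 y & ball x r2 y].
  by move=> bq; split; apply: le_ball bq; rewrite /q !ge_min lexx ?orbT.
have [y /sub[_ y1 _] E1] := second_differenceE h0 hq
  (fun y b => du y (let: And3 b _ _ := sub y b in b))
  (fun y b => duv y (let: And3 b _ _ := sub y b in b)).
have [z /sub[_ _ z2] E2] := second_differenceE (u := v) (v := u) h0
  (eq_rect _ (fun s => h * s < q) hq _ (addrC _ _))
  (fun y b => dv y (let: And3 b _ _ := sub y b in b))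
  (fun y b => dvu y (let: And3 b _ _ := sub y b in b)).
have yz : 'D_v ('D_u f : W -> R^o) y = 'D_u ('D_v f : W -> R^o) z.
  have h2 : h ^+ 2 != 0 by rewrite expf_neq0 // gt_eqF.
  have := second_difference_sym f x (h *: u) (h *: v).
  by rewrite E1 E2 => /(mulfI h2).
have l1 := c1 _ y1; have l2 := c2 _ z2; rewrite -yz distrC in l2.
have := ltrD l1 l2; rewrite /e -splitr => /(le_lt_trans (ler_distD _ _ _)).
by rewrite ltxx.
Qed.

End Schwarz.

Lemma smooth_schwarz (R : realType) b (U : set 'rV[R]_b) (f : 'rV[R]_b -> R^o)
    (j k : 'I_b) x : open U -> U x -> smooth U f ->
  'D_(delta_mx 0 j) (fun y => 'D_(delta_mx 0 k) f y : R^o) x =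
  'D_(delta_mx 0 k) (fun y => 'D_(delta_mx 0 j) f y : R^o) x.
Proof.
move=> oU Ux sf.
have /nbhs_ballP[r /= r0 rU] := open_nbhs_nbhs (conj oU Ux).
have df l y : U y -> derivable f y (delta_mx 0 l).
  by move=> Uy; have [_ /(_ l)[d _]] := sf 1%N; exact: d.
have ddf l l' y : U y -> derivable ('D_(delta_mx 0 l) f : _ ->
  R^o) y (delta_mx 0 l').
  by move=> Uy; have [_ /(_ l)[_ [_ /(_ l')[d _]]]] := sf 2%N; exact: d.
have cdf l l' : {for x, continuous
    ('D_(delta_mx 0 l') ('D_(delta_mx 0 l) f : _ -> R^o) : _ -> R^o)}.
  by have [_ /(_ l)[_ [_ /(_ l')[_ [c _]]]]] := sf 2%N; exact: c.
by apply: (schwarz r0) => [y /rU|y /rU|y /rU|y /rU||];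
  [exact: df|exact: df|exact: ddf|exact: ddf|exact: cdf|exact: cdf].
Qed.

(** * The graded commutative algebra of functions *)

Lemma derive_lin (R : realType) (W : normedModType R) (k : R) (f g : W -> R^o)
    (x v : W) : derivable f x v -> derivable g x v ->
  'D_v (k *: f + g) x = k * 'D_v f x + 'D_v g x.
Proof.
move=> df dg; rewrite deriveD; first by rewrite deriveZ.
  exact: derivableZ.
exact: dg.
Qed.

Section GradedAlgebra.
Variables (R : realType) (D : gdomain R).
Local Notation C := (gd_coord D).
Local Notation deg := (@gd_deg R D).
Local Notation U := (@gd_body R D).
Local Notation monom := (monom D).
Local Notation cinf := (cinf D).
Local Notation A := (Cinfty D).
Implicit Types (m a : monom) (c : C) (f g h : cinf).
Local Notation point := 'rV[R]_#|[pred c | deg c == 0%N]|.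
Implicit Type x : point.

(** * Exponents and reordering signs *)

Definition madd m m' : monom := [ffun c => (m c + m' c)%N].
Definition mono1 c : monom := [ffun c' => nat_of_bool (c' == c)].
(** The exponent of the sign of the left derivative d/dz_c on the monomial m; it is 0 when z_c is
    even. *)
Definition odd_below c m : nat :=
  \sum_(c' | before c' c && odd (deg c) && odd (deg c')) m c'.

Lemma cinf_smooth f m : smooth U (f m).
Proof. by have := cinfP f; rewrite inE => -[]. Qed.
Lemma cinf_out f m x : ~ U x -> f m x = 0.
Proof. by have := cinfP f; rewrite inE => -[_ h _ _]; exact: h. Qed.
Lemma cinf_adm f m : ~~ admissible m -> f m = 0.
Proof. by have := cinfP f; rewrite inE => -[_ _ h _]; exact: h. Qed.

Lemma cinf_fun_eqP f g : (forall m, f m = g m) -> f = g.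
Proof. by move=> fg; apply: cinf_eqP => m x; rewrite fg. Qed.

Lemma cinfZE (k : R) f m x : (k *: f) m x = k * f m x. Proof. by []. Qed.
Lemma cinfDE f g m x : (f + g) m x = f m x + g m x. Proof. by []. Qed.

Lemma unit_vec_delta c : deg c == 0%N ->
  exists j, @unit_vec R D c = delta_mx 0 j.
Proof.
move=> c0; exists (enum_rank_in (c0 : c \in [pred c | deg c == 0%N]) c).
apply/rowP => j; rewrite !mxE eqxx /=; congr (nat_of_bool _)%:R.
apply/eqP/eqP => [jc|->]; last by rewrite enum_rankK_in.
by apply: enum_val_inj; rewrite enum_rankK_in.
Qed.

Lemma derivable_unit c f m x : U x -> derivable (f m) x (unit_vec c).
Proof.
move=> Ux; case: (boolP (deg c == 0%N)) => c0.
  have [j ->] := unit_vec_delta c0.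
  by have [_ /(_ j)[d _]] := cinf_smooth f m 1%N; exact: d.
have -> : unit_vec c = 0.
  apply/rowP => j; rewrite !mxE; case: eqP => // jc.
  by case/negP: c0; rewrite -jc; have := enum_valP j.
exact: derivable0.
Qed.

Lemma partial0E c f m x : deg c == 0%N ->
  partial c f m x = if x \in U then 'D_(unit_vec c) (f m) x else 0.
Proof. by move=> c0; rewrite /= /partial_fun c0. Qed.

Lemma partialSE c f m x : deg c != 0%N ->
  partial c f m x =
  (-1) ^+ odd_below c m * (m c).+1%:R * f (madd m (mono1 c)) x.
Proof.
move=> /negPf c0; rewrite /= /partial_fun c0.
by congr (_ * f _ x); apply/ffunP => c'; rewrite !ffunE.
Qed.

Lemma partial_linear c : linear (@partial R D c).
Proof.
move=> k f g; apply: cinf_eqP => m x; rewrite cinfZDE.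
case: (boolP (deg c == 0%N)) => c0; last first.
  rewrite !partialSE // cinfZDE; ring.
rewrite !partial0E //; case: ifP => [xU|_]; last by rewrite mulr0 addr0.
have Ux : U x by rewrite inE in xU.
rewrite (_ : cinf_fun (k *: f + g) m = k *: (f m : point -> R^o) + g m);
  last by [].
by apply: derive_lin; apply: derivable_unit.
Qed.

Lemma cinf_mulE f g m x : cinf_mul f g m x =
  if admissible m then
    \sum_(a : {dffun forall c : C, 'I_(m c).+1})
      (-1) ^+ reorder [ffun c => nat_of_ord (a c)] [ffun c => (m c - a c)%N]
        * f [ffun c => nat_of_ord (a c)] x * g [ffun c => (m c - a c)%N] x else 0.
Proof. by []. Qed.

Lemma cinf_mul_linearl g : linear (fun f => cinf_mul f g).
Proof.
move=> k f f'; apply: cinf_eqP => m x; rewrite cinfZDE !cinf_mulE.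
case: (admissible m); last by rewrite mulr0 addr0.
rewrite mulr_sumr -big_split; apply: eq_bigr => a _.
rewrite cinfZDE /=; ring.
Qed.

Lemma cinf_mul_linearr f : linear (cinf_mul f).
Proof.
move=> k g g'; apply: cinf_eqP => m x; rewrite cinfZDE !cinf_mulE.
case: (admissible m); last by rewrite mulr0 addr0.
rewrite mulr_sumr -big_split; apply: eq_bigr => a _.
rewrite cinfZDE /=; ring.
Qed.

Lemma admissibleP m : reflect (forall c,
    (deg c == 0%N -> m c = 0%N) /\ (odd (deg c) ->
      (m c <= 1)%N)) (admissible m).
Proof.
apply: (iffP forallP) => h c; have := h c.
  by move=> /andP[/implyP h1 /implyP h2]; split=> // /h1 /eqP.
by move=> [h1 h2]; apply/andP; split; apply/implyP => // /h1 ->.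
Qed.

Lemma admissible_le m m' : (forall c, (m c <= m' c)%N) -> admissible m' ->
  admissible m.
Proof.
move=> le /admissibleP h; apply/admissibleP => c; have [h1 h2] := h c; split.
  by move=> /h1 e; apply/eqP; rewrite -leqn0 -e.
by move=> /h2; apply: leq_trans.
Qed.

Lemma madd_admissiblel m m' : admissible (madd m m') -> admissible m.
Proof. by apply: admissible_le => c; rewrite ffunE leq_addr. Qed.
Lemma madd_admissibler m m' : admissible (madd m m') -> admissible m'.
Proof. by apply: admissible_le => c; rewrite ffunE leq_addl. Qed.

Lemma maddA m m' m'' : madd m (madd m' m'') = madd (madd m m') m''.
Proof. by apply/ffunP => c; rewrite !ffunE addnA. Qed.
Lemma maddC m m' : madd m m' = madd m' m.
Proof. by apply/ffunP => c; rewrite !ffunE addnC. Qed.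
Lemma maddI m : injective (madd m).
Proof.
by move=> a b /ffunP e; apply/ffunP => c; have := e c; rewrite !ffunE => /addnI.
Qed.

Lemma mdegD m m' : mdeg (madd m m') = (mdeg m + mdeg m')%N.
Proof. by rewrite /mdeg -big_split; apply: eq_bigr => c _;
  rewrite ffunE mulnDl. Qed.
Lemma mdeg_mono1 c : mdeg (mono1 c) = deg c.
Proof.
rewrite /mdeg (bigD1 c) //= ffunE eqxx mul1n big1 ?addn0 // => c' /negPf ne.
by rewrite ffunE ne.
Qed.

Lemma reorderDl m m' a : reorder (madd m m') a = (reorder m a + reorder m' a)%N.
Proof.
rewrite /reorder -big_split; apply: eq_bigr => c _ /=.
by rewrite -big_split; apply: eq_bigr => c' _ /=; rewrite ffunE mulnDl.
Qed.
Lemma reorderDr m m' a : reorder a (madd m m') = (reorder a m + reorder a m')%N.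
Proof.
rewrite /reorder -big_split; apply: eq_bigr => c _ /=.
by rewrite -big_split; apply: eq_bigr => c' _ /=; rewrite ffunE mulnDr.
Qed.
Lemma odd_belowD c m m' :
  odd_below c (madd m m') = (odd_below c m + odd_below c m')%N.
Proof. by rewrite /odd_below -big_split; apply: eq_bigr => c' _;
  rewrite ffunE. Qed.

Lemma reorder_mono1l c m : reorder (mono1 c) m = odd_below c m.
Proof.
rewrite /reorder (bigD1 c) //= [X in (_ + X)%N]big1 ?addn0.
  by apply: eq_bigr => c' _; rewrite ffunE eqxx mul1n.
by move=> c' /negPf ne; apply: big1 => c'' _; rewrite ffunE ne.
Qed.

Lemma odd_mdeg m : odd (mdeg m) = odd (\sum_(c | odd (deg c)) m c).
Proof.
rewrite /mdeg !(big_morph odd oddD (erefl : odd 0 = false)) [RHS]big_mkcond.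
by apply: eq_bigr => c _; rewrite oddM; case: (odd (deg c));
  rewrite ?andbT ?andbF.
Qed.

Lemma beforeNC c c' : c != c' -> before c c' = ~~ before c' c.
Proof.
move=> ne; rewrite /before -leqNgt ltn_neqAle.
suff -> : (nat_of_ord (enum_rank c) != nat_of_ord (enum_rank c')) by [].
by apply: contra ne => /eqP/val_inj/enum_rank_inj ->.
Qed.

(** For z_c odd, the two numbers count the odd factors of m before and after z_c, together all odd
    factors of m other than z_c itself. Their parity is that of |m| corrected by the exponent of
    z_c. *)
Lemma odd_below_reorder c m : (odd (odd_below c m) (+) odd (reorder m (mono1 c)))
  = odd (deg c) && (odd (mdeg m) (+) odd (m c)).
Proof.
have -> : reorder m (mono1 c) =
    \sum_(c' | before c c' && odd (deg c') && odd (deg c)) m c'.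
  rewrite /reorder [RHS]big_mkcond; apply: eq_bigr => c' _ /=.
  rewrite (big_mkcond (fun i => before i c' && _ && _)) (bigD1 c) //=.
  rewrite ffunE eqxx muln1 [X in (_ + X)%N]big1 ?addn0 // => c'' /negPf ne.
  by rewrite ffunE ne muln0 if_same.
rewrite /odd_below odd_mdeg -oddD.
case oc: (odd (deg c)); last first.
  rewrite [X in odd (X + _)]big1 => [|c']; last by rewrite andbF.
  by rewrite big1 // => c'; rewrite andbF.
rewrite [in RHS](bigD1 c) //= [in RHS]oddD [in RHS]addbAC addbb addFb.
rewrite [in RHS](bigID (fun c' => before c' c)) /=; congr (odd (_ + _)).
  apply: eq_bigl => c'; rewrite andbT; case: (eqVneq c' c) => [->|_].
    by rewrite /before ltnn andbF.
  by rewrite andbC andbT.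
apply: eq_bigl => c'; rewrite andbT; case: (eqVneq c' c) => [->|ne].
  by rewrite /before ltnn andbF.
by rewrite beforeNC 1?eq_sym // andbC andbT.
Qed.

(** * Functions with a single monomial *)

Definition supp_at m f := forall m', m' != m -> f m' = 0.

Definition cut_fun m (F : monom -> point -> R^o) m' : point -> R^o :=
  if m' == m then F m else 0.

Lemma cut_in m F : F \in @cinf_pred R D -> cut_fun m F \in @cinf_pred R D.
Proof.
rewrite !inE => -[sF oF aF [s Fs]]; split.
- by move=> m'; rewrite /cut_fun; case: ifP => // _;
  exact: smooth_cst (@gd_open R D) 0.
- by move=> m' x Ux; rewrite /cut_fun; case: ifP => // _; exact: oF.
- by move=> m' am; rewrite /cut_fun; case: eqP => // e; rewrite -e; exact: aF.
- by exists s => m' ms; rewrite /cut_fun; case: eqP => // e; rewrite -e;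
  exact: Fs.
Qed.

Definition cut m f : cinf := Cinf (cut_in m (cinfP f)).

Lemma cut_supp m f : supp_at m (cut m f).
Proof. by move=> m' /negPf e; rewrite /= /cut_fun e. Qed.

(** Reduces an additive property to functions with one term. The premise [f m <> 0] transfers a
    degree or a parity known for f to the monomials that have to be treated. *)
Lemma cinf_ind f (P : cinf -> Prop) : P 0 -> (forall g h, P g -> P h ->
  P (g + h)) ->
  (forall m g, f m <> 0 -> supp_at m g -> P g) -> P f.
Proof.
move=> P0 PD Ps; have := cinfP f; rewrite inE => -[_ _ _ [s Fs]].
(* The list s only contains the support, so it is filtered down to the monomials that occur in f. *)
have -> : f = \sum_(m <- [seq m <- undup s | `[< f m <> 0 >]]) cut m f.
  apply: cinf_eqP => m x; rewrite cinf_sumE.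
  case: (pselect (f m = 0)) => [fm0|fm].
    rewrite fm0 big1 // => m' _; rewrite /= /cut_fun; case: eqP => // <-.
    by rewrite fm0.
  rewrite (bigD1_seq m) ?filter_uniq ?undup_uniq //=; last first.
    rewrite mem_filter mem_undup; apply/andP; split; first exact/asboolP.
    by apply: contraT => /Fs.
  rewrite /cut_fun eqxx big1 ?addr0 // => m' /negPf ne.
  by rewrite eq_sym ne.
elim: s {Fs} => [|m s IH] /=; first by rewrite big_nil.
case: ifP => //= _; case: ifP => [/asboolP fm|_] //.
rewrite big_cons; apply: PD => //; by apply: (Ps m) => //; exact: cut_supp.
Qed.

Lemma cinf_mul_supp m1 m2 f g m x : supp_at m1 f -> supp_at m2 g ->
  cinf_mul f g m x = if (m == madd m1 m2) && admissible m then
    (-1) ^+ reorder m1 m2 * f m1 x * g m2 x else 0.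
Proof.
move=> sf sg; rewrite cinf_mulE andbC; case: (admissible m) => //=.
case: eqVneq => [->|ne]; last first.
  apply: big1 => a _; set a1 := [ffun c => _]; set a2 := [ffun c => (_ - _)%N].
  case: (eqVneq a1 m1) => [e1|/sf ->]; last by rewrite mulr0 mul0r.
  case: (eqVneq a2 m2) => [e2|/sg ->]; last by rewrite mulr0.
  case/negP: ne; rewrite -e1 -e2; apply/eqP/ffunP => c;
    rewrite !ffunE subnKC //.
  by rewrite -ltnS.
have le c : (m1 c < (madd m1 m2 c).+1)%N by rewrite ltnS ffunE leq_addr.
(* The only splitting of m1 + m2 whose two coefficients can both be nonzero. *)
pose a0 : {dffun forall c : C, 'I_(madd m1 m2 c).+1} :=
  finfun (fun c => Ordinal (le c)).
have a0E c : a0 c = m1 c :> nat by rewrite /a0 (ffunE (fun c =>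
  Ordinal (le c))).
have e1 : [ffun c => nat_of_ord (a0 c)] = m1 by apply/ffunP => c;
  rewrite ffunE a0E.
have e2 : [ffun c => (madd m1 m2 c - a0 c)%N] = m2.
  by apply/ffunP => c; rewrite ffunE a0E ffunE addKn.
rewrite (bigD1 a0) //= e1 e2 big1 ?addr0 // => a /eqP ne.
rewrite [f _](sf _) ?mulr0 ?mul0r //; apply/eqP => e; apply: ne.
apply/ffunP => c; apply/val_inj; rewrite /= a0E.
by have /ffunP/(_ c) := e; rewrite ffunE.
Qed.

Lemma cinf_mul_supp_at m1 m2 f g : supp_at m1 f -> supp_at m2 g ->
  supp_at (madd m1 m2) (cinf_mul f g).
Proof.
move=> sf sg m /negPf ne; apply/funext => x.
by rewrite (cinf_mul_supp _ _ sf sg) ne.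
Qed.

Lemma cinf_mul0l g : cinf_mul 0 g = 0.
Proof. by have := cinf_mul_linearl g (-1) 0 0; rewrite !scaleN1r !addNr. Qed.
Lemma cinf_mul0r f : cinf_mul f 0 = 0.
Proof. by have := cinf_mul_linearr f (-1) 0 0; rewrite !scaleN1r !addNr. Qed.
Lemma cinf_mulDl f g h : cinf_mul (f + g) h = cinf_mul f h + cinf_mul g h.
Proof. by have := cinf_mul_linearl h 1 f g; rewrite !scale1r. Qed.
Lemma cinf_mulDr f g h : cinf_mul f (g + h) = cinf_mul f g + cinf_mul f h.
Proof. by have := cinf_mul_linearr f 1 g h; rewrite !scale1r. Qed.
Lemma cinf_mulZl k f g : cinf_mul (k *: f) g = k *: cinf_mul f g.
Proof. by have := cinf_mul_linearl g k f 0; rewrite cinf_mul0l !addr0. Qed.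
Lemma cinf_mulZr k f g : cinf_mul f (k *: g) = k *: cinf_mul f g.
Proof. by have := cinf_mul_linearr f k g 0; rewrite cinf_mul0r !addr0. Qed.
Lemma partial0 c : partial c (0 : cinf) = 0.
Proof. by have := partial_linear c (-1) 0 0; rewrite !scaleN1r !addNr. Qed.
Lemma partialD c f g : partial c (f + g) = partial c f + partial c g.
Proof. by have := partial_linear c 1 f g; rewrite !scale1r. Qed.
Lemma partialZ c k f : partial c (k *: f) = k *: partial c f.
Proof. by have := partial_linear c k f 0; rewrite partial0 !addr0. Qed.

(** * Associativity, unit and exchange of two terms *)

Lemma cinf_mulA : associative (@cinf_mul R D).
Proof.
move=> f g h; move: f g h; have P3 f g h : cinf_mul f (cinf_mul g h) =
  cinf_mul (cinf_mul f g) h; last exact: P3.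
pattern f; apply: cinf_ind => [|f1 f2 h1 h2|m1 f1 _ s1].
- by rewrite !cinf_mul0l.
- by rewrite !cinf_mulDl h1 h2.
pattern g; apply: cinf_ind => [|g1 g2 h1 h2|m2 g1 _ s2].
- by rewrite !(cinf_mul0l, cinf_mul0r).
- by rewrite !(cinf_mulDl, cinf_mulDr) h1 h2.
pattern h; apply: cinf_ind => [|k1 k2 h1 h2|m3 k1 _ s3].
- by rewrite !cinf_mul0r.
- by rewrite !cinf_mulDr h1 h2.
apply: cinf_eqP => m x.
rewrite (cinf_mul_supp _ _ s1 (cinf_mul_supp_at s2 s3)).
rewrite (cinf_mul_supp _ _ (cinf_mul_supp_at s1 s2) s3) maddA.
case: eqVneq => [->|_]; rewrite ?andFb ?andTb //; case: ifP => // am.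
rewrite (cinf_mul_supp _ _ s2 s3) (cinf_mul_supp _ _ s1 s2) !eqxx !andTb.
rewrite (madd_admissiblel am); move: am; rewrite -maddA => /madd_admissibler ->.
(* The reordering exponent is biadditive, so both bracketings give the sum of the exponents over the
   three pairs of monomials. *)
rewrite reorderDl reorderDr !exprD; ring.
Qed.

Lemma cinf_one_supp : supp_at [ffun=> 0%N] (@cinf_one R D).
Proof. by move=> m /negPf ne; apply/funext => x;
  rewrite /cinf_one /= /Defs.one_fun ne. Qed.

Lemma cinf_oneE x : @cinf_one R D [ffun=> 0%N] x = if x \in U then 1 else 0.
Proof. by rewrite /cinf_one /= /Defs.one_fun eqxx. Qed.

Lemma madd0 m : madd [ffun=> 0%N] m = m.
Proof. by apply/ffunP => c; rewrite !ffunE. Qed.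

Lemma cinf_mul1l : left_id (@cinf_one R D) (@cinf_mul R D).
Proof.
move=> f; pattern f; apply: cinf_ind => [|f1 f2 h1 h2|m1 f1 _ s1].
- by rewrite cinf_mul0r.
- by rewrite cinf_mulDr h1 h2.
apply: cinf_eqP => m x; rewrite (cinf_mul_supp _ _ cinf_one_supp s1) madd0 cinf_oneE.
case: eqVneq => [->|/s1 -> //]; rewrite andTb;
  case: ifP => [_|/negbT/cinf_adm -> //].
rewrite /reorder big1 ?mul1r => [|c _]; last by apply: big1 => c' _;
  rewrite ffunE.
(* The unit is 1 on the body only; outside the body both sides vanish. *)
case: ifP => xU; first by rewrite mul1r.
by rewrite mul0r cinf_out // => /mem_set; rewrite xU.
Qed.

Lemma cinf_mul1r : right_id (@cinf_one R D) (@cinf_mul R D).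
Proof.
move=> f; pattern f; apply: cinf_ind => [|f1 f2 h1 h2|m1 f1 _ s1].
- by rewrite cinf_mul0l.
- by rewrite cinf_mulDl h1 h2.
apply: cinf_eqP => m x; rewrite (cinf_mul_supp _ _ s1 cinf_one_supp) maddC madd0 cinf_oneE.
case: eqVneq => [->|/s1 -> //]; rewrite andTb;
  case: ifP => [_|/negbT/cinf_adm -> //].
rewrite /reorder big1 ?mul1r => [|c _]; last by apply: big1 => c' _;
  rewrite !ffunE muln0.
case: ifP => xU; first by rewrite mulr1.
by rewrite mulr0 cinf_out // => /mem_set; rewrite xU.
Qed.

(** Every pair of distinct odd coordinates is counted by exactly one of the two exponents. A pair of
    equal ones contributes m1(c) m2(c) = 0, since an admissible monomial contains an odd coordinate
    at most once. Hence the exponents add up to the product of the numbers of odd factors. *)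
Lemma reorder_sym m1 m2 : admissible (madd m1 m2) ->
  odd (reorder m1 m2) = odd (reorder m2 m1) (+) (odd (mdeg m1) && odd (mdeg m2)).
Proof.
move=> /admissibleP adm.
have E m : (\sum_(c | odd (deg c)) m c)%N = \sum_c (odd (deg c) * m c)%N.
  by rewrite big_mkcond; apply: eq_bigr => c _; case: (odd _); rewrite ?mul1n.
have rE m m' : reorder m m' =
    \sum_c \sum_c' (before c' c * (odd (deg c) * m c) * (odd (deg c') * m' c'))%N.
  apply: eq_bigr => c _; rewrite big_mkcond; apply: eq_bigr => c' _.
  by case: before; case: (odd (deg c)); case: (odd (deg c'));
    rewrite /= ?mul1n ?mul0n ?muln0.
suff e : (reorder m1 m2 + reorder m2 m1 =
    (\sum_(c | odd (deg c)) m1 c) * (\sum_(c | odd (deg c)) m2 c))%N.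
  by rewrite !odd_mdeg -oddM -e oddD addbCA addbb addbF.
rewrite !E big_distrl /= !rE [X in (_ + X)%N]exchange_big -big_split.
apply: eq_bigr => c _; rewrite big_distrr -big_split; apply: eq_bigr => c' _ /=.
case: (eqVneq c c') => [<-|ne]; last first.
  by rewrite (beforeNC ne); case: before; rewrite /= ?mul1n ?mul0n ?addn0 ?add0n // mulnC.
have [_] := adm c; rewrite /before ltnn ffunE !mul0n.
case: (odd _); rewrite ?mul1n ?mul0n // => /(_ isT).
by case: (m1 c) => [|[|k]]; case: (m2 c) => [|[|l]] //=; rewrite ?addSn ?addnS.
Qed.

Lemma cinf_mul_suppC m1 m2 f g : supp_at m1 f -> supp_at m2 g ->
  cinf_mul f g = (-1) ^+ (odd (mdeg m1) && odd (mdeg m2)) *: cinf_mul g f.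
Proof.
move=> sf sg; apply: cinf_eqP => m x; rewrite cinfZE.
rewrite (cinf_mul_supp _ _ sf sg) (cinf_mul_supp _ _ sg sf) maddC.
case: eqVneq => [->|_]; last by rewrite mulr0.
rewrite !andTb.
case: ifP => [|_]; last by rewrite mulr0.
rewrite maddC => /reorder_sym e.
rewrite -[in LHS]signr_odd e signr_addb signr_odd; ring.
Qed.

(** * The Leibniz rule on single terms *)

Lemma supp_adm m f x : f m x != 0 -> admissible m.
Proof. by move=> h; apply: contraNT h => /cinf_adm ->. Qed.

Lemma madd_mono1_sub c m : (0 < m c)%N -> exists m0, m = madd m0 (mono1 c).
Proof.
move=> mc; exists [ffun c' => (m c' - (c' == c))%N]; apply/ffunP => c'.
rewrite !ffunE; case: eqVneq => [->|_]; last by rewrite subn0 addn0.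
by rewrite subnK.
Qed.

Lemma madd_mono1_eq c m m' :
  (madd m (mono1 c) == madd m' (mono1 c)) = (m == m').
Proof. by rewrite !(maddC _ (mono1 c)); apply: inj_eq; exact: maddI. Qed.

Lemma mono1E c : mono1 c c = 1%N. Proof. by rewrite ffunE eqxx. Qed.

Lemma admissible_mono1 c m : deg c != 0%N -> admissible m ->
  (odd (deg c) -> m c = 0%N) -> admissible (madd m (mono1 c)).
Proof.
move=> c0 /admissibleP adm mc; apply/admissibleP => c'; rewrite !ffunE.
case: (eqVneq c' c) => [->|_]; last by rewrite addn0; exact: adm.
by split=> [e|/mc -> //]; rewrite e in c0.
Qed.

Lemma odd_below_self c c' : odd_below c (mono1 c') =
  [&& before c' c, odd (deg c) & odd (deg c')].
Proof.
rewrite /odd_below big_mkcond (bigD1 c') //= ffunE eqxx big1 ?addn0 =>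
  [|c'' /negPf ne].
  by rewrite andbA; case: ifP.
by rewrite ffunE ne if_same.
Qed.

Lemma mul_derive_term (k : R) b (f1 f2 : 'rV[R]_b -> R^o) (x v : 'rV[R]_b) :
  derivable f1 x v -> derivable f2 x v ->
  'D_v ((fun y => k * f1 y * f2 y) : _ -> R^o) x =
  k * 'D_v f1 x * f2 x + k * f1 x * 'D_v f2 x.
Proof.
move=> d1 d2.
have -> : (fun y => k * f1 y * f2 y) = k *: (f1 * f2) :> ('rV[R]_b -> R^o).
  by apply/funext => y; rewrite -mulrA.
rewrite deriveZ; last exact: derivableM.
rewrite deriveM //.
change (k * (f1 x * 'D_v f2 x + f2 x * 'D_v f1 x) =
  k * 'D_v f1 x * f2 x + k * f1 x * 'D_v f2 x); ring.
Qed.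

Lemma partial0_supp_at c m f : deg c == 0%N -> supp_at m f ->
  supp_at m (partial c f).
Proof.
move=> c0 sf m' ne; apply/funext => x; rewrite partial0E // (sf _ ne).
by case: ifP => // _; rewrite derive_cst.
Qed.

Lemma leibniz0 c m1 m2 f g : deg c == 0%N -> supp_at m1 f -> supp_at m2 g ->
  partial c (cinf_mul f g) = cinf_mul (partial c f) g + cinf_mul f (partial c g).
Proof.
move=> c0 sf sg; apply: cinf_eqP => m x; rewrite cinfDE partial0E //.
rewrite (cinf_mul_supp _ _ (partial0_supp_at c0 sf) sg).
rewrite (cinf_mul_supp _ _ sf (partial0_supp_at c0 sg)) !partial0E //.
have -> : cinf_mul f g m = if (m == madd m1 m2) && admissible m then
    (fun y => (-1) ^+ reorder m1 m2 * f m1 y * g m2 y) else (fun=> 0).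
  by apply/funext => y; rewrite (cinf_mul_supp _ _ sf sg); case: ifP.
case: ifP => xU; last by case: ifP; rewrite ?(mulr0, mul0r) addr0.
have Ux : U x by rewrite inE in xU.
case: ifP => _; last by rewrite derive_cst addr0.
by apply: mul_derive_term; apply: derivable_unit.
Qed.

Lemma partialS_supp_at c m f : deg c != 0%N -> supp_at (madd m (mono1 c)) f ->
  supp_at m (partial c f).
Proof.
move=> c0 sf m' ne; apply/funext => x; rewrite partialSE //.
rewrite [f _](sf _) ?mulr0 //; apply: contra ne => /eqP.
by rewrite maddC [RHS]maddC => /maddI ->.
Qed.

Lemma partialS_supp0 c m f : deg c != 0%N -> supp_at m f -> m c = 0%N ->
  partial c f = 0.
Proof.
move=> c0 sf mc; apply: cinf_eqP => m' x; rewrite partialSE //.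
rewrite [f _](sf _) ?mulr0 //; apply/eqP => e; have := congr1 (fun m => m c) e.
by rewrite !ffunE eqxx addn1 mc.
Qed.

Lemma eq_signr (n1 n2 : nat) : odd n1 = odd n2 -> (-1) ^+ n1 = (-1) ^+ n2 :> R.
Proof. by move=> e; rewrite -signr_odd e signr_odd. Qed.

(* In both terms of the Leibniz rule the exponent is written with m, m1, m2    *)
(* only (and not with m1 - c or m2 - c), so that they can be compared.         *)
Lemma leibnizS_l c m1 m2 f g m x : deg c != 0%N -> supp_at m1 f ->
  supp_at m2 g ->
  cinf_mul (partial c f) g m x =
  if (madd m (mono1 c) == madd m1 m2) && admissible m then
    (-1) ^+ (odd_below c m + reorder m1 m2) * (m1 c)%:R * f m1 x * g m2 x else 0.
Proof.
move=> c0 sf sg; case: (posnP (m1 c)) => [m1c|/madd_mono1_sub[m0 e]].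
  rewrite (partialS_supp0 c0 sf m1c) cinf_mul0l m1c mulr0 !mul0r.
  by case: ifP.
rewrite e in sf *; rewrite (cinf_mul_supp _ _ (partialS_supp_at c0 sf) sg).
rewrite -(maddA m0) (maddC (mono1 c)) (maddA m0) madd_mono1_eq.
case: eqVneq => [->|_]; rewrite ?andTb ?andFb //; case: ifP => // _.
rewrite partialSE // ffunE mono1E addn1 odd_belowD reorderDl reorder_mono1l.
(* The count of the odd factors of m2 before z_c enters twice and cancels modulo 2. *)
rewrite (_ : (-1) ^+ (_ + _) = (-1) ^+ (odd_below c m0 + reorder m0 m2));
  last first.
  apply: eq_signr; rewrite !oddD.
  by move: (odd (odd_below c m0)) (odd (odd_below c m2)) (odd (reorder m0 m2)) => [] [] [].
by rewrite exprD; ring.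
Qed.

(** The extra exponent, compared with the term where f is differentiated, counts modulo 2 the odd
    factors of m1 other than z_c when z_c is odd; it comes from [odd_below_reorder]. *)
Lemma leibnizS_r c m1 m2 f g m x : deg c != 0%N -> supp_at m1 f ->
  supp_at m2 g ->
  cinf_mul f (partial c g) m x =
  if (madd m (mono1 c) == madd m1 m2) && admissible m then
    (-1) ^+ (odd_below c m + reorder m1 m2 + odd (deg c) * (mdeg m1 + m1 c))
      * (m2 c)%:R * f m1 x * g m2 x else 0.
Proof.
move=> c0 sf sg; case: (posnP (m2 c)) => [m2c|/madd_mono1_sub[m0 e]].
  rewrite (partialS_supp0 c0 sg m2c) cinf_mul0r m2c mulr0 !mul0r.
  by case: ifP.
rewrite e in sg *; rewrite (cinf_mul_supp _ _ sf (partialS_supp_at c0 sg)).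
rewrite maddA madd_mono1_eq.
case: eqVneq => [->|_]; rewrite ?andTb ?andFb //; case: ifP => // _.
rewrite partialSE // ffunE mono1E addn1 odd_belowD reorderDr.
rewrite (_ : (-1) ^+ (_ + _) = (-1) ^+ (odd_below c m0 + reorder m1 m0));
  last first.
  apply: eq_signr; have := odd_below_reorder c m1.
  rewrite !oddD oddM oddD oddb => <-.
  by move: (odd (odd_below c m0)) (odd (odd_below c m1)) (odd (reorder m1 m0))
    (odd (reorder m1 (mono1 c))) => [] [] [] [].
by rewrite exprD; ring.
Qed.

(** For z_c even the factors m1(c) and m2(c) add up to m(c) + 1. For z_c odd, either exactly one of
    the two terms survives, or z_c occurs in both factors; then the product is 0 because z_c squares
    to 0, and the two terms cancel. *)
Lemma leibnizS c m1 m2 f g : deg c != 0%N -> supp_at m1 f -> supp_at m2 g ->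
  partial c (cinf_mul f g) = cinf_mul (partial c f) g +
    (-1) ^+ (odd (deg c) && odd (mdeg m1)) *: cinf_mul f (partial c g).
Proof.
move=> c0 sf sg; apply: cinf_eqP => m x; rewrite cinfDE cinfZE.
rewrite (leibnizS_l _ _ c0 sf sg) (leibnizS_r _ _ c0 sf sg) partialSE //.
rewrite (cinf_mul_supp _ _ sf sg).
case: (eqVneq (madd m (mono1 c)) (madd m1 m2)) => e; last first.
  by rewrite ?andFb !mulr0 addr0.
rewrite !andTb.
have mc : (m c).+1 = (m1 c + m2 c)%N.
  by have /ffunP/(_ c) := e; rewrite !ffunE eqxx addn1.
case: (eqVneq (f m1 x) 0) => [->|/supp_adm/admissibleP/(_ c)[_ a1]].
  by rewrite !(mulr0, mul0r, if_same, addr0).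
case: (eqVneq (g m2 x) 0) => [->|/supp_adm/admissibleP/(_ c)[_ a2]].
  by rewrite !(mulr0, mul0r, if_same, addr0).
case: (boolP (admissible (madd m (mono1 c)))) => adm.
  rewrite (madd_admissiblel adm) mc natrD.
  have [_ +] := admissibleP _ adm c; rewrite !ffunE eqxx addn1.
  case: (boolP (odd (deg c))) => [oc /(_ isT) h|_ _].
    have [[-> ->]|[-> ->]] :
        (m1 c = 1%N /\ m2 c = 0%N) \/ (m1 c = 0%N /\ m2 c = 1%N) by lia.
      by rewrite exprD; ring.
    rewrite mul1n addn0 andTb signr_odd !exprD.
    have s2 : (-1) ^+ mdeg m1 * (-1) ^+ mdeg m1 = 1 :> R.
      by rewrite -exprMn mulrNN mulr1 expr1n.
    transitivity ((-1) ^+ odd_below c m *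
      ((-1) ^+ reorder m1 m2 * f m1 x * g m2 x) *
      ((-1) ^+ mdeg m1 * (-1) ^+ mdeg m1)).
      rewrite s2; ring.
    ring.
  rewrite mul0n addn0 andFb expr0 mul1r exprD; ring.
rewrite !mulr0; case: (boolP (admissible m)) => am; last by rewrite mulr0 addr0.
(* Here m is admissible but m z_c is not, which leaves only an odd z_c already present in m. *)
have {adm} /andP[oc m0] : odd (deg c) && (0 < m c)%N.
  apply: contraR adm; rewrite negb_and => h; apply: admissible_mono1 => // oc.
  by move: h; rewrite oc /= -eqn0Ngt => /eqP.
have {mc m0} [m1c m2c] : m1 c = 1%N /\ m2 c = 1%N.
  by have := a1 oc; have := a2 oc; lia.
rewrite m1c m2c oc mul1n addn1 andTb signr_odd !exprD exprS.
have s2 : (-1) ^+ mdeg m1 * (-1) ^+ mdeg m1 = 1 :> R.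
  by rewrite -exprMn mulrNN mulr1 expr1n.
set s := (-1) ^+ mdeg m1 in s2 *.
transitivity ((1 - s * s) * ((-1) ^+ odd_below c m * (-1) ^+ reorder m1 m2 * f m1 x * g m2 x)).
  by rewrite s2 subrr mul0r.
ring.
Qed.

(** * Parity of functions *)

Lemma gv_sign_sum (K : fieldType) (V : gvect K) b (I : Type) (s : seq I) (F : I -> V) :
  gv_sign b (\sum_(i <- s) F i) = \sum_(i <- s) gv_sign b (F i).
Proof.
elim: s => [|i s IH]; rewrite ?big_nil ?big_cons.
  by have := gv_sign_linear b (-1) (0 : V) 0; rewrite !scaleN1r !addNr.
by rewrite -[F i]scale1r gv_sign_linear IH !scale1r.
Qed.

Lemma gv_compE p (f : A) m : (gv_comp p f : cinf) m =
  if (mdeg m)%:Z == p then f m else 0.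
Proof. by []. Qed.

Lemma gv_signE b (f : A) m x :
  (gv_sign b f : cinf) m x = (-1) ^+ (b && odd (mdeg m)) * (f : cinf) m x.
Proof.
have [s [_ e _]] := gv_comp_fin f.
rewrite {2}e {1}e gv_sign_sum !cinf_sumE mulr_sumr; apply: eq_bigr => p _.
have hp : Defs.hom p (gv_comp p f) by rewrite /Defs.hom gv_compK eqxx.
rewrite (gv_sign_hom b hp) cinfZE !gv_compE.
by case: eqP => [<-|_]; rewrite ?mulr0 ?/parity //.
Qed.

Lemma gv_sign_supp b m (f : A) : supp_at m f ->
  gv_sign b f = (-1) ^+ (b && odd (mdeg m)) *: f.
Proof.
move=> sf; apply: cinf_eqP => m' x; rewrite gv_signE.
rewrite -[RHS]/((-1) ^+ (b && odd (mdeg m)) * (f : cinf) m' x).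
by case: (eqVneq m' m) => [->|/sf ->] //; rewrite !mulr0.
Qed.

Lemma gv_signD b (f g : A) : gv_sign b (f + g) = gv_sign b f + gv_sign b g.
Proof. by have := gv_sign_linear b 1 f g; rewrite !scale1r. Qed.
Lemma gv_sign0 b : gv_sign b (0 : A) = 0.
Proof. by have := gv_sign_linear b (-1) (0 : A) 0;
  rewrite !scaleN1r !addNr. Qed.

Lemma gv_sign_comp (a b : bool) (f : A) : gv_sign a (gv_sign b f) =
  gv_sign (a (+) b) f.
Proof.
apply: cinf_eqP => m x; rewrite !gv_signE mulrA -signr_addb.
by rewrite andb_addl.
Qed.

Lemma cinf_mul_sign b (f g : A) :
  gv_sign b (cinf_mul f g : A) = cinf_mul (gv_sign b f) (gv_sign b g).
Proof.
pattern f; apply: cinf_ind => [|f1 f2 h1 h2|m1 f1 _ s1].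
- by rewrite gv_sign0 !cinf_mul0l gv_sign0.
- by rewrite gv_signD !cinf_mulDl gv_signD h1 h2.
pattern g; apply: cinf_ind => [|g1 g2 h1 h2|m2 g1 _ s2].
- by rewrite gv_sign0 !cinf_mul0r gv_sign0.
- by rewrite gv_signD !cinf_mulDr gv_signD h1 h2.
rewrite (gv_sign_supp b s1) (gv_sign_supp b s2).
rewrite (gv_sign_supp b (cinf_mul_supp_at s1 s2)) cinf_mulZl cinf_mulZr.
by rewrite scalerA mdegD oddD andb_addr signr_addb.
Qed.

Lemma leibniz c (f g : A) : partial c (cinf_mul f g) =
  cinf_mul (partial c f) g + cinf_mul (gv_sign (odd (deg c)) f) (partial c g) :> A.
Proof.
pattern f; apply: cinf_ind => [|f1 f2 h1 h2|m1 f1 _ s1].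
- by rewrite gv_sign0 partial0 !cinf_mul0l partial0 addr0.
- by rewrite gv_signD partialD !cinf_mulDl partialD h1 h2 addrACA.
pattern g; apply: cinf_ind => [|g1 g2 h1 h2|m2 g1 _ s2].
- by rewrite partial0 !cinf_mul0r partial0 addr0.
- by rewrite partialD !cinf_mulDr partialD h1 h2 addrACA.
rewrite (gv_sign_supp _ s1) cinf_mulZl.
case: (boolP (deg c == 0%N)) => c0; last exact: (leibnizS c0 s1 s2).
by rewrite (eqP c0) scale1r; exact: (leibniz0 c0 s1 s2).
Qed.

(** A derivative sends a term to a term of degree lower by deg c, or kills it; signs and degrees of
    derivatives are read off from this. *)
Lemma partial_supp c m f : supp_at m f -> partial c f = 0 \/
  exists2 m0, (mdeg m0 + deg c)%N = mdeg m & supp_at m0 (partial c f).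
Proof.
case: (boolP (deg c == 0%N)) => c0 sf.
  by right; exists m; [rewrite (eqP c0) addn0|exact: partial0_supp_at].
case: (posnP (m c)) => [mc|/madd_mono1_sub[m0 e]].
  by left; exact: partialS_supp0 sf mc.
right; exists m0; first by rewrite e mdegD mdeg_mono1.
by apply: partialS_supp_at => //; rewrite -e.
Qed.

Lemma partial_sign c b (f : A) : gv_sign b (partial c f : A) =
  (-1) ^+ (b && odd (deg c)) *: (partial c (gv_sign b f) : A).
Proof.
pattern f; apply: cinf_ind => [|f1 f2 h1 h2|m1 f1 _ s1].
- by rewrite gv_sign0 partial0 gv_sign0 scaler0.
- by rewrite gv_signD !partialD gv_signD h1 h2 scalerDr.
rewrite (gv_sign_supp _ s1) partialZ.
have [->|[m0 e s0]] := partial_supp c s1; first by rewrite gv_sign0 !scaler0.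
rewrite (gv_sign_supp _ s0) scalerA -signr_addb -andb_addr -e oddD.
by rewrite addbC addbK.
Qed.

(** An eigenvalue equation for the parity operator, so that 0 has both parities. *)
Definition has_parity (a : bool) (f : A) : Prop := gv_sign true f = (-1) ^+ a *: f.

Lemma gv_sign_parity (a b : bool) (f : A) : has_parity a f ->
  gv_sign b f = (-1) ^+ (b && a) *: f.
Proof. by case: b => // _; rewrite expr0 scale1r. Qed.

(** A coefficient at a monomial of the other parity equals its own negative, hence vanishes over the
    reals. *)
Lemma has_parityP (a : bool) (f : A) m : has_parity a f -> (f : cinf) m <> 0 ->
  odd (mdeg m) = a.
Proof.
move=> hf fm; apply/eqP; apply: contra_notT fm => ne; apply/funext => x.
have : (gv_sign true f : cinf) m x = (-1) ^+ a * (f : cinf) m x by rewrite hf.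
rewrite gv_signE andTb; clear hf; have two (r : R) : r = - r -> r = 0.
  by move=> /eqP; rewrite -subr_eq0 opprK -mulr2n mulrn_eq0 => /eqP.
move: ne; case: (odd _); case: a => //= _; rewrite !(expr0, expr1, mulN1r, mul1r).
  by move=> /esym; exact: two.
exact: two.
Qed.

Lemma cinf_mulC (a b : bool) (f g : A) : has_parity a f -> has_parity b g ->
  cinf_mul f g = (-1) ^+ (a && b) *: (cinf_mul g f : A) :> A.
Proof.
move=> hf hg.
pattern f; apply: cinf_ind => [|f1 f2 h1 h2|m1 f1 /(has_parityP hf) e1 s1].
- by rewrite cinf_mul0l cinf_mul0r scaler0.
- by rewrite cinf_mulDl cinf_mulDr h1 h2 scalerDr.
pattern g; apply: cinf_ind => [|g1 g2 h1 h2|m2 g1 /(has_parityP hg) e2 s2].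
- by rewrite cinf_mul0l cinf_mul0r scaler0.
- by rewrite cinf_mulDl cinf_mulDr h1 h2 scalerDr.
by rewrite (cinf_mul_suppC s1 s2) e1 e2.
Qed.

Lemma has_parity_partial (a : bool) c (f : A) : has_parity a f ->
  has_parity (a (+) odd (deg c)) (partial c f).
Proof.
by move=> hf; rewrite /has_parity partial_sign hf partialZ scalerA -signr_addb addbC.
Qed.

Lemma has_parity_sign (a b : bool) (f : A) : has_parity a f ->
  has_parity a (gv_sign b f).
Proof.
move=> hf; rewrite /has_parity gv_sign_comp addbC -gv_sign_comp hf.
by rewrite -[_ *: f]addr0 gv_sign_linear gv_sign0 addr0.
Qed.

Lemma has_parity_par (a : bool) (f : A) : has_parity a (gv_par a f).
Proof.
have [s [us e es]] := gv_comp_fin f; rewrite (gv_parE a us es).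
rewrite /has_parity -big_filter gv_sign_sum scaler_sumr !big_filter.
apply: eq_bigr => p /eqP pa.
have hp : Defs.hom p (gv_comp p f) by rewrite /Defs.hom gv_compK eqxx.
by rewrite (gv_sign_hom true hp) pa.
Qed.

Lemma gv_par_split (f : A) : f = gv_par true f + gv_par false f.
Proof.
have [s [us e es]] := gv_comp_fin f; rewrite !(gv_parE _ us es) {1}e.
rewrite (bigID (fun p => parity p == true)) /=; congr (_ + _).
by apply: eq_bigl => p; case: (parity p).
Qed.

(** * Homogeneous functions *)

Lemma homP p (f : A) : Defs.hom p f <-> (forall m, (mdeg m)%:Z != p ->
  (f : cinf) m = 0).
Proof.
split=> [hf m mp|h].
  by have := congr1 (fun g : A => (g : cinf) m) hf;
    rewrite /= -[X in X = _]/(if (mdeg m)%:Z == p then f m else 0) (negPf mp) => <-.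
by apply: cinf_fun_eqP => m; rewrite gv_compE; case: eqVneq => // /h ->.
Qed.

Lemma homD p (f g : A) : Defs.hom p f -> Defs.hom p g -> Defs.hom p (f + g).
Proof. by move=> hf hg; rewrite -[f]scale1r; apply: homZD. Qed.

Lemma supp_hom m (f : A) : supp_at m f -> Defs.hom (mdeg m)%:Z f.
Proof.
by move=> sf; apply/homP => m' ne; apply: sf; apply: contraNneq ne => ->.
Qed.

Lemma hom_deg p (f : A) m : Defs.hom p f -> (f : cinf) m <> 0 ->
  (mdeg m)%:Z = p.
Proof. by move=> /homP hf fm; apply/eqP; apply: contra_notT fm; exact: hf. Qed.

Lemma hom_mul p q (f g : A) : Defs.hom p f -> Defs.hom q g ->
  Defs.hom (p + q) (cinf_mul f g : A).
Proof.
move=> hf hg.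
pattern f; apply: cinf_ind => [|f1 f2 h1 h2|m1 f1 /(hom_deg hf) <- s1].
- by rewrite cinf_mul0l; exact: hom0.
- by rewrite cinf_mulDl; exact: homD.
pattern g; apply: cinf_ind => [|g1 g2 h1 h2|m2 g1 /(hom_deg hg) <- s2].
- by rewrite cinf_mul0r; exact: hom0.
- by rewrite cinf_mulDr; exact: homD.
by rewrite -PoszD -mdegD; apply: supp_hom; exact: cinf_mul_supp_at.
Qed.

Lemma hom_one : Defs.hom 0 (@cinf_one R D : A).
Proof.
have -> : 0 = (mdeg ([ffun=> 0%N] : monom))%:Z.
  by rewrite /mdeg big1 // => c _; rewrite ffunE.
by apply: supp_hom; exact: cinf_one_supp.
Qed.

Lemma hom_partial p c (f : A) : Defs.hom p f -> Defs.hom (p - (deg c)%:Z)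
  (partial c f : A).
Proof.
move=> hf; pattern f; apply: cinf_ind => [|f1 f2 h1 h2|m1 f1 /(hom_deg hf) <- s1].
- by rewrite partial0; exact: hom0.
- by rewrite partialD; exact: homD.
have [->|[m0 e s0]] := partial_supp c s1; first exact: hom0.
by rewrite -e PoszD addrK; exact: supp_hom.
Qed.

(** * Partial derivatives supercommute *)

Lemma partial00 c c' f : deg c == 0%N -> deg c' == 0%N ->
  partial c (partial c' f) = partial c' (partial c f).
Proof.
move=> c0 c0'; apply: cinf_eqP => m x; rewrite !partial0E //.
case: ifP => // xU; have Ux : U x by rewrite inE in xU.
have E k k' (k0 : deg k == 0%N) (k0' : deg k' == 0%N) :
    'D_(unit_vec k) (partial k' f m) x =
    'D_(unit_vec k) (fun y => 'D_(unit_vec k') (f m) y : R^o) x.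
  (* The inner derivative is cut off to 0 outside the body; as the body is open, this does not
     affect derivatives at its points. *)
  apply: near_eq_derive; apply: (near_U (@gd_open R D) Ux) => y Uy.
  by rewrite partial0E // mem_set.
have [j ej] := unit_vec_delta c0; have [j' ej'] := unit_vec_delta c0'.
rewrite (E _ _ c0 c0') (E _ _ c0' c0) ej ej'.
exact: (smooth_schwarz j j' (@gd_open R D) Ux (cinf_smooth f m)).
Qed.

Lemma partial0S c c' f : deg c == 0%N -> deg c' != 0%N ->
  partial c (partial c' f) = partial c' (partial c f).
Proof.
move=> c0 c0'; apply: cinf_eqP => m x; rewrite [RHS]partialSE // !partial0E //.
case: ifP => // xU; last by rewrite mulr0.
have Ux : U x by rewrite inE in xU.
set k := (-1) ^+ _ * _.
have -> : partial c' f m = k *: f (madd m (mono1 c')).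
  by apply/funext => y; rewrite partialSE.
by rewrite deriveZ //; apply: derivable_unit.
Qed.

(** For distinct odd coordinates, the one that comes later in the order passes the other in exactly
    one of the two orders of differentiation, whence the sign. For equal odd ones both sides read a
    coefficient at an inadmissible monomial. *)
Lemma partialSS c c' f : deg c != 0%N -> deg c' != 0%N ->
  partial c (partial c' f) =
  (-1) ^+ (odd (deg c) && odd (deg c')) *: partial c' (partial c f).
Proof.
move=> c0 c0'; apply: cinf_eqP => m x; rewrite cinfZE !partialSE //.
rewrite -!maddA (maddC (mono1 c')) !odd_belowD !odd_below_self !ffunE.
case: (eqVneq c c') => [<-|ne].
  case oc: (odd (deg c)); last by rewrite expr0 mul1r.
  rewrite [f _]cinf_adm ?mulr0 //; apply/negP => /admissibleP/(_ c)[_].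
  by rewrite oc !ffunE eqxx addnC => /(_ isT).
rewrite (beforeNC ne) !addn0 [odd (deg c') && _]andbC.
case: (odd _ && odd _); last by rewrite !andbF !addn0 expr0; ring.
by case: before; rewrite !andbT /= ?addn0 ?addn1 ?exprS ?expr0; ring.
Qed.

Lemma partialC c c' (f : A) : partial c (partial c' f) =
  (-1) ^+ (odd (deg c) && odd (deg c')) *: (partial c' (partial c f) : A) :> A.
Proof.
case: (boolP (deg c == 0%N)) => c0; case: (boolP (deg c' == 0%N)) => c0'.
- by rewrite (eqP c0) scale1r; exact: partial00.
- by rewrite (eqP c0) scale1r; exact: partial0S.
- by rewrite (eqP c0') andbF scale1r; apply/esym/partial0S.
- exact: partialSS.
Qed.

End GradedAlgebra.

(** * Derivatives on the factors of a tensor product *)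

Section Multilinear.
Variables (K : fieldType) (V : gvect K).

Lemma multilinear_scale_at N (t : ('I_N -> V) -> V) i (k : K) (g h : 'I_N ->
  V) :
  multilinear t -> (forall j, j != i -> h j = g j) -> h i = k *: g i ->
    t h = k *: t g.
Proof.
move=> tl hg hi.
have -> : h = upd g i (k *: g i + 0).
  by apply/funext => j; rewrite /upd addr0; case: eqVneq => [->|/hg].
rewrite tl [t (upd g i 0)](@endo_upd0 _ _ _ _ tl _ i) ?addr0 /upd ?eqxx //.
by congr (_ *: t _); apply/funext => j; case: eqVneq => [->|].
Qed.

Lemma multilinear_sum_at N (t : ('I_N -> V) -> V) f i (I : Type) (s : seq I)
    (k : I -> K) (F : I -> V) : multilinear t ->
  t (upd f i (\sum_(j <- s) k j *: F j)) = \sum_(j <- s) k j *: t (upd f i (F j)).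
Proof.
move=> tl; elim: s => [|j s IH].
  by rewrite !big_nil (@endo_upd0 _ _ _ _ tl _ i) // /upd eqxx.
by rewrite !big_cons tl IH.
Qed.

Lemma multilinear_scale N (t : ('I_N -> V) -> V) (k : 'I_N -> K) f :
  multilinear t -> t (fun i => k i *: f i) = (\prod_i k i) *: t f.
Proof.
move=> tl.
suff H (s : seq 'I_N) : uniq s ->
    t (fun i => if i \in s then k i *: f i else f i) =
      (\prod_(i <- s) k i) *: t f.
  rewrite -big_enum -(H (enum 'I_N) (enum_uniq _)); congr t; apply/funext => i.
  by rewrite mem_enum.
elim: s => [|i s IH] /=; first by rewrite big_nil scale1r.
move=> /andP[/negPf is_ /IH e]; rewrite big_cons -scalerA -e.
apply: (@multilinear_scale_at _ _ i) => // [j /negPf ji|].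
  by rewrite inE ji.
by rewrite mem_head is_.
Qed.

Lemma multilinear_lincomb N (I : Type) (s : seq I) (k : I -> K)
    (t : I -> ('I_N -> V) -> V) : (forall j, multilinear (t j)) ->
  multilinear (fun f => \sum_(j <- s) k j *: t j f).
Proof.
move=> tl f i b u v; rewrite scaler_sumr -big_split; apply: eq_bigr => j _ /=.
by rewrite tl scalerDr !scalerA mulrC.
Qed.

End Multilinear.

Section TensorCalculus.
Variables (R : realType) (n : nat) (V : np_manifold R n).
Local Notation D := (np_domain V).
Local Notation A := (Cinfty D).
Local Notation C := (gd_coord D).
Local Notation deg := (@gd_deg R D).
Implicit Type c : C.

(** The derivative on the i-th factor acts factor by factor; this is its effect on the j-th one. *)
Definition tpartial_op N c (i j : 'I_N) (x : A) : A :=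
  if j == i then partial c x else gv_sign ((j < i)%N && odd (deg c)) x.

Lemma tpartialE N c (i : 'I_N) (f : 'I_N -> A) j :
  tpartial c i f j = tpartial_op c i j (f j).
Proof.
rewrite /tpartial /tpartial_op; case: eqVneq => [->|] //.
by case: (j < i)%N.
Qed.

Lemma tpartial_op_linear N c (i j : 'I_N) : linear (tpartial_op c i j).
Proof.
move=> k u v; rewrite /tpartial_op; case: eqP => _; first exact: partial_linear.
exact: gv_sign_linear.
Qed.

Lemma tpartial_upd N c (i : 'I_N) (f : 'I_N -> A) j x :
  tpartial c i (upd f j x) = upd (tpartial c i f) j (tpartial_op c i j x).
Proof.
by apply/funext => k; rewrite tpartialE /upd; case: eqVneq => [->|_] //;
  rewrite tpartialE.
Qed.

Definition precomp N c (i : 'I_N) (t : ('I_N -> A) -> A) (f : 'I_N -> A) : A :=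
  t (tpartial c i f).

Lemma multilinear_precomp N c (i : 'I_N) (t : ('I_N -> A) -> A) :
  multilinear t -> multilinear (precomp c i t).
Proof.
by move=> tl f j k u v; rewrite /precomp !tpartial_upd tpartial_op_linear tl.
Qed.

(** If i < j, only the i-th factor sees a difference: there d/dz_c is exchanged with the parity
    operator left by d/dz_c' on its way to j. If i = j this is [partialC]. *)
Lemma precompC N c c' (i j : 'I_N) (t : ('I_N -> A) -> A) f : multilinear t ->
  t (tpartial c i (tpartial c' j f)) =
  (-1) ^+ (odd (deg c) && odd (deg c')) *: t (tpartial c' j (tpartial c i f)).
Proof.
have lt c1 c2 (i1 i2 : 'I_N) : (i1 < i2)%N -> multilinear t ->
    t (tpartial c1 i1 (tpartial c2 i2 f)) =
    (-1) ^+ (odd (deg c1) && odd (deg c2)) *: t (tpartial c2 i2 (tpartial c1 i1 f)).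
  move=> i12 tl; have ne : i1 != i2 by apply: contraTneq i12 => ->;
    rewrite ltnn.
  apply: (@multilinear_scale_at _ _ _ _ i1) => // [k ki|]; rewrite !tpartialE.
    rewrite /tpartial_op (negPf ki); case: (eqVneq k i2) => [->|_].
      by rewrite ltnNge (ltnW i12).
    by rewrite !gv_sign_comp addbC.
  rewrite /tpartial_op eqxx (negPf ne) i12 andTb partial_sign scalerA -signr_addb.
  by rewrite [odd (deg c2) && _]andbC addbb scale1r.
move=> tl; case: (ltngtP i j) => [ij|ji|/val_inj ->]; first exact: lt.
  by rewrite (lt c' c j i) // scalerA [odd (deg c') && _]andbC -signr_addb addbb scale1r.
apply: (@multilinear_scale_at _ _ _ _ j) => // [k kj|]; rewrite !tpartialE.
  by rewrite /tpartial_op (negPf kj); rewrite !gv_sign_comp addbC.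
by rewrite /tpartial_op eqxx partialC.
Qed.

Lemma precompCC N c1 c2 c3 c4 (i1 i2 i3 i4 : 'I_N) (t : ('I_N -> A) -> A) f :
  multilinear t ->
  t (tpartial c1 i1 (tpartial c2 i2 (tpartial c3 i3 (tpartial c4 i4 f)))) =
  (-1) ^+ ((odd (deg c1) (+) odd (deg c2)) && (odd (deg c3) (+) odd (deg c4))) *:
    t (tpartial c3 i3 (tpartial c4 i4 (tpartial c1 i1 (tpartial c2 i2 f)))).
Proof.
move=> tl.
have tl1 c i : multilinear (precomp c i t) by exact: multilinear_precomp.
(* Each swap of neighbours takes place under outer derivatives; these are absorbed into the
   multilinear map by [precomp], and the ascription unfolds them again. *)
rewrite (precompC c2 c3 i2 i3 (tpartial c4 i4 f) (tl1 c1 i1) :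
  t (tpartial c1 i1 (tpartial c2 i2 (tpartial c3 i3 (tpartial c4 i4 f)))) =
  _ *: t (tpartial c1 i1 (tpartial c3 i3 (tpartial c2 i2 (tpartial c4 i4 f))))).
rewrite (precompC c1 c3 i1 i3 _ tl).
rewrite (precompC c2 c4 i2 i4 f (multilinear_precomp c1 i1 (tl1 c3 i3)) :
  t (tpartial c3 i3 (tpartial c1 i1 (tpartial c2 i2 (tpartial c4 i4 f)))) =
  _ *: t (tpartial c3 i3 (tpartial c1 i1 (tpartial c4 i4 (tpartial c2 i2 f))))).
rewrite (precompC c1 c4 i1 i4 (tpartial c2 i2 f) (tl1 c3 i3) :
  t (tpartial c3 i3 (tpartial c1 i1 (tpartial c4 i4 (tpartial c2 i2 f)))) =
  _ *: t (tpartial c3 i3 (tpartial c4 i4 (tpartial c1 i1 (tpartial c2 i2 f))))).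
rewrite !scalerA andb_addl !andb_addr !signr_addb; congr (_ *: _); ring.
Qed.

(** * The operators Delta *)

Local Notation dterm := (('I_(np_dim V) + aux_index n (np_aux V)) +
  'I_(np_mid V) * 'I_(np_mid V))%type.

(** With [dtarget] and [dcoef], presents the three sums of Delta_ij as one sum over [dterm] of a
    coefficient times a derivative at i and a derivative at j. *)
Definition dsource (k : dterm) : C :=
  match k with
  | inl (inl mu) => crd_x _ _ _ mu | inl (inr a) => crd_psi _ _ a
  | inr (a, b) => crd_xi _ _ _ a end.
Definition dtarget (k : dterm) : C :=
  match k with
  | inl (inl mu) => crd_p _ _ _ mu | inl (inr a) => crd_chi _ _ a
  | inr (a, b) => crd_xi _ _ _ b end.
Definition dcoef (k : dterm) : R :=
  match k with
  | inl _ => 1 | inr (a, b) => 2^-1 * invmx (np_kappa V) a b end.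

Lemma comp_DeltaE N (t : ('I_N -> A) -> A) (e : 'I_N * 'I_N) f :
  comp_Delta t e f = \sum_(k : dterm) dcoef k *:
    t (tpartial (dsource k) e.1 (tpartial (dtarget k) e.2 f)).
Proof.
case: e => i j; rewrite big_sumType big_sumType /comp_Delta /=.
congr (_ + _ + _).
- by apply: eq_bigr => mu _; rewrite scale1r.
- by apply: eq_bigr => mu _; rewrite scale1r.
by rewrite (pair_bigA _ (fun a b => (2^-1 * invmx (np_kappa V) a b) *:
   t (tpartial (crd_xi _ _ _ a : C) i (tpartial (crd_xi _ _ _ b : C) j f)))) /=;
  apply: eq_bigr => -[a b].
Qed.

Lemma deg_source_target (k : dterm) : (deg (dsource k) + deg (dtarget k) = n)%N.
Proof.
case: k => [[mu|[k a]]|[a b]] //=.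
  have := ltn_ord k; lia.
have := @np_mid_odd _ _ V; case: (odd n) (odd_double_half n) =>
  [_ /(_ isT) m0|].
  by have := ltn_ord a; rewrite {2}m0.
by rewrite -addnn.
Qed.

Lemma multilinear_comp_Delta N (t : ('I_N -> A) -> A) e :
  multilinear t -> multilinear (comp_Delta t e).
Proof.
move=> tl.
have -> : comp_Delta t e = fun f => \sum_(k : dterm) dcoef k *:
    precomp (dtarget k) e.2 (precomp (dsource k) e.1 t) f.
  by apply/funext => f; rewrite comp_DeltaE.
by apply: multilinear_lincomb => k; do 2 apply: multilinear_precomp.
Qed.

Lemma comp_Delta_lincomb N (I : Type) (s : seq I) (k : I -> R)
    (t : I -> ('I_N -> A) -> A) e f :
  comp_Delta (fun f => \sum_(j <- s) k j *: t j f) e f =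
  \sum_(j <- s) k j *: comp_Delta (t j) e f.
Proof.
rewrite comp_DeltaE; under eq_bigr => l _ do rewrite scaler_sumr.
rewrite exchange_big /=; apply: eq_bigr => j _.
rewrite comp_DeltaE scaler_sumr; apply: eq_bigr => l _.
by rewrite !scalerA mulrC.
Qed.

Lemma foldl_lincomb N (I : Type) (s : seq I) (k : I -> R)
    (t : I -> ('I_N -> A) -> A) (g : seq ('I_N * 'I_N)) f :
  foldl (@comp_Delta R n V N) (fun f => \sum_(j <- s) k j *: t j f) g f =
  \sum_(j <- s) k j *: foldl (@comp_Delta R n V N) (t j) g f.
Proof.
elim: g t => //= e g IH t; rewrite -IH; congr (foldl _ _ _ _).
by apply/funext => f'; rewrite comp_Delta_lincomb.
Qed.

Lemma foldl_scale N (k : R) (t : ('I_N -> A) -> A) (g : seq ('I_N * 'I_N)) f :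
  foldl (@comp_Delta R n V N) (fun f => k *: t f) g f =
  k *: foldl (@comp_Delta R n V N) t g f.
Proof.
have := foldl_lincomb [:: tt] (fun=> k) (fun=> t) g f.
by under [X in foldl _ X]eq_fun => f' do rewrite big_seq1; rewrite big_seq1.
Qed.

(** Each term of a Delta is a pair of derivatives of total parity n, so two terms commute up to
    (-1)^(n n) = (-1)^n. *)
Lemma comp_DeltaC N (t : ('I_N -> A) -> A) e e' f : multilinear t ->
  comp_Delta (comp_Delta t e) e' f = (-1) ^+ n *: comp_Delta (comp_Delta t e') e f.
Proof.
move=> tl; rewrite !comp_DeltaE scaler_sumr.
under eq_bigr => k' _ do rewrite comp_DeltaE scaler_sumr.
under [RHS]eq_bigr => k _ do rewrite comp_DeltaE !scaler_sumr.
rewrite exchange_big /=; apply: eq_bigr => k _; apply: eq_bigr => k' _.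
rewrite precompCC // -!oddD !deg_source_target andbb signr_odd !scalerA.
by congr (_ *: _); ring.
Qed.
End TensorCalculus.

(** * Products inserted at a vertex *)

Section Circ.
Variables (R : realType) (n : nat) (V : np_manifold R n).
Local Notation D := (np_domain V).
Local Notation A := (Cinfty D).
Local Notation C := (gd_coord D).
Local Notation deg := (@gd_deg R D).
Implicit Type c : C.

Lemma mu_recl N (f : 'I_N.+1 -> A) :
  mu_ f = cinf_mul (f ord0) (mu_ (fun i => f (lift ord0 i))).
Proof. by rewrite /mu_ big_ord_recl. Qed.

Lemma mu_0 (f : 'I_0 -> A) : mu_ f = @cinf_one R D.
Proof. by rewrite /mu_ big_ord0. Qed.

Lemma upd_lift N (f : 'I_N.+1 -> A) k x :
  (fun i => upd f (lift ord0 k) x (lift ord0 i)) =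
    upd (fun i => f (lift ord0 i)) k x.
Proof. by apply/funext => i; rewrite /upd (inj_eq (@lift_inj _ ord0)). Qed.

Lemma multilinear_mu N : multilinear (@mu_ R n V N).
Proof.
elim: N => [|N IH] f i a u v; first by case: i.
rewrite !mu_recl; case: (unliftP ord0 i) => [k|] ->.
  rewrite !upd_lift IH /upd /=; exact: cinf_mul_linearr.
rewrite /upd eqxx /=; exact: cinf_mul_linearl.
Qed.

Lemma gv_sign_one b : gv_sign b (@cinf_one R D : A) = @cinf_one R D.
Proof.
rewrite (gv_sign_supp _ (@cinf_one_supp R D)).
by rewrite /mdeg big1 ?andbF ?scale1r // => c _; rewrite ffunE.
Qed.

Lemma partial_one c : partial c (@cinf_one R D) = 0.
Proof.
(* Differentiating 1 = 1 1 gives twice the derivative of 1. *)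
have := leibniz c (@cinf_one R D : A) (@cinf_one R D).
rewrite gv_sign_one !cinf_mul1l cinf_mul1r => /esym/eqP.
by rewrite -subr_eq0 addrK => /eqP.
Qed.

Lemma tpartial_lift N c (k : 'I_N) (f : 'I_N.+1 -> A) :
  (fun i => tpartial c (lift ord0 k) f (lift ord0 i)) =
  tpartial c k (fun i => f (lift ord0 i)).
Proof.
apply/funext => i; rewrite !tpartialE /tpartial_op (inj_eq (@lift_inj _ ord0)).
by rewrite !lift0 ltnS.
Qed.

Lemma partial_mu N c (f : 'I_N -> A) :
  partial c (mu_ f) = \sum_i mu_ (tpartial c i f) :> A.
Proof.
elim: N f => [|N IH] f; first by rewrite mu_0 partial_one big_ord0.
rewrite mu_recl leibniz IH big_ord_recl mu_recl; congr (_ + _).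
rewrite (big_morph (cinf_mul (gv_sign (odd (deg c)) (f ord0)))
  (@cinf_mulDr R D _) (@cinf_mul0r R D _)).
by apply: eq_bigr => i _; rewrite mu_recl tpartial_lift.
Qed.

Lemma gv_sign_mu N b (f : 'I_N -> A) :
  gv_sign b (mu_ f) = mu_ (fun i => gv_sign b (f i)).
Proof.
elim: N f => [|N IH] f; first by rewrite !mu_0 gv_sign_one.
by rewrite !mu_recl cinf_mul_sign IH.
Qed.

Lemma hom_mu N (f : 'I_N -> A) (d : 'I_N -> int) :
  (forall i, Defs.hom (d i) (f i)) -> Defs.hom (\sum_i d i) (mu_ f).
Proof.
elim: N f d => [|N IH] f d hf; first by rewrite mu_0 big_ord0; exact: hom_one.
by rewrite mu_recl big_ord_recl; apply: hom_mul => //; apply: IH.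
Qed.

Lemma hom_tpartial N c (i : 'I_N) (f : 'I_N -> A) (d : 'I_N -> int) :
  (forall j, Defs.hom (d j) (f j)) ->
  forall j, Defs.hom (d j - (if j == i then (deg c)%:Z else 0)) (tpartial c i f j).
Proof.
move=> hf j; rewrite tpartialE /tpartial_op; case: eqP => _.
  exact: hom_partial.
by rewrite subr0 (gv_sign_hom _ (hf j)); apply: homZ.
Qed.

Lemma map_degree_comp_Delta N p (t : ('I_N -> A) -> A) e :
  map_degree p t -> map_degree (p - n%:Z) (comp_Delta t e).
Proof.
move=> tp d f hf; rewrite comp_DeltaE.
apply: (big_ind (fun x : A => Defs.hom _ x)) => [|x y|k _];
  [exact: hom0|exact: homD|].
apply: homZ.
have := tp _ _ (hom_tpartial (dsource k) e.1 (hom_tpartial (dtarget k) e.2 hf)).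
rewrite !sumrB -!big_mkcond !big_pred1_eq -[in n%:Z](deg_source_target k) PoszD opprD.
by congr Defs.hom; ring.
Qed.

Lemma multilinear_foldl N (t : ('I_N -> A) -> A) g : multilinear t ->
  multilinear (foldl (@comp_Delta R n V N) t g).
Proof. by elim: g t => //= e g IH t tl; apply: IH;
  exact: multilinear_comp_Delta. Qed.

Lemma multilinear_dRep N (g : seq ('I_N * 'I_N)) : multilinear (dRep V g).
Proof. by apply: multilinear_foldl; exact: multilinear_mu. Qed.

Lemma map_degree_dRep N (g : seq (edge N)) :
  map_degree (graph_deg n.+1 g) (dRep V g).
Proof.
rewrite /dRep; elim/last_ind: g => [|g e IH].
  by move=> d f hf; rewrite /graph_deg mul0r add0r; exact: hom_mu.
rewrite foldl_rcons.
have -> : graph_deg n.+1 (rcons g e) = graph_deg n.+1 g - n%:Z.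
  by rewrite /graph_deg size_rcons -addn1 -[n.+1]addn1 !PoszD; ring.
exact: map_degree_comp_Delta.
Qed.

(** * Edges at the vertex of insertion *)

Section Insert.
Variables (M N : nat) (i : 'I_M.+1).
Local Notation E := ('I_(M + N).+1 * 'I_(M + N).+1)%type.

(* [b] is the parity of [tau], moved past the factors left of the slot. *)
Definition slot b (tau : ('I_N.+1 -> A) -> A) (f : 'I_(M + N).+1 -> A) : 'I_M.+1 -> A :=
  fun j => if j == i then tau (fun w => f (inner i w))
           else gv_sign ((j < i)%N && b) (f (outer N i j)).

Lemma inner_lt (w w' : 'I_N.+1) : (inner i w < inner i w')%N = (w < w')%N.
Proof. by rewrite !innerE ltn_add2l. Qed.
Lemma outer_lt j j' : (outer N i j < outer N i j')%N = (j < j')%N.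
Proof. rewrite !outerE; case: ifP; case: ifP; lia. Qed.
Lemma outer_lt_inner j (w : 'I_N.+1) : j != i ->
  (outer N i j < inner i w)%N = (j < i)%N.
Proof.
by rewrite -val_eqE /= => ji; rewrite outerE innerE; have := ltn_ord w;
  case: ifP; lia.
Qed.
Lemma inner_lt_outer j (w : 'I_N.+1) : j != i ->
  (inner i w < outer N i j)%N = (i < j)%N.
Proof.
by rewrite -val_eqE /= => ji; rewrite outerE innerE; have := ltn_ord w;
  case: ifP; lia.
Qed.

(** A derivative aimed at an inserted factor passes the outer factors left of the slot; its sign
    there is accounted for by letting the parity of [tau] grow by that of z_c. *)
Lemma slot_tpartial_inner b tau c w f :
  slot b tau (tpartial c (inner i w) f) = slot (b (+) odd (deg c)) (precomp c w tau) f.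
Proof.
apply/funext => j; rewrite /slot /precomp; case: eqVneq => [_|ji].
  congr tau; apply/funext => w'; rewrite !tpartialE /tpartial_op inner_lt.
  by rewrite (inj_eq (@inner_inj M N i)).
rewrite tpartialE /tpartial_op eq_sym (negPf (inner_neq_outer _ ji)).
by rewrite outer_lt_inner // gv_sign_comp andb_addr.
Qed.

Lemma slot_upd b tau f : slot b tau f =
  upd (slot b tau f) i (tau (fun w => f (inner i w))).
Proof. by apply/funext => j; rewrite /upd /slot; case: eqP. Qed.

(** The source of all reconnections. At a = i the derivative of the inserted product is spread over
    its factors by the Leibniz rule; at another vertex it has a single preimage under [collapse]. *)
Lemma slot_mu_tpartial (t : ('I_M.+1 -> A) -> A) c a f : multilinear t ->
  t (tpartial c a (slot false (@mu_ R n V N.+1) f)) =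
  \sum_(v | collapse i v == a) t (slot false (@mu_ R n V N.+1) (tpartial c v f)).
Proof.
move=> tl; rewrite big_mkcond (big_insertion i) /=.
have [->|ai] := eqVneq a i.
  rewrite [X in _ + X]big1 ?addr0 => [|j /negPf ji];
    last by rewrite collapse_outer ji.
  under eq_bigr => w _ do rewrite collapse_inner eqxx slot_tpartial_inner.
  (* Only the outer entries of G matter: the entry at i is overwritten, and 0 is a placeholder. *)
  set G : 'I_M.+1 -> A := slot (odd (deg c)) (fun=> 0) f.
  transitivity (t (upd G i (\sum_w 1 *: mu_ (tpartial c w (fun w =>
    f (inner i w)))))).
    congr t; apply/funext => j; rewrite tpartialE /tpartial_op /slot /upd /G /slot.
    case: eqVneq => [_|ji]; last by rewrite andbF.
    by rewrite partial_mu; apply: eq_bigr => w _; rewrite scale1r.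
  rewrite (multilinear_sum_at _ _ _ _ _ tl); apply: eq_bigr => w _;
    rewrite scale1r.
  by congr t; apply/funext => j; rewrite /upd /G /slot; case: eqP.
rewrite [X in X + _]big1 ?add0r => [|w _]; last first.
  by rewrite collapse_inner eq_sym (negPf ai).
rewrite (bigD1 a) //= collapse_outer eqxx [X in _ + X]big1 ?addr0 =>
  [|j /andP[_ ja]]; last first.
  by rewrite collapse_outer (negPf ja).
congr t; apply/funext => j; rewrite tpartialE /slot.
case: (eqVneq j i) => [->|ji].
  (* The parity operator is multiplicative, so passing the product means passing each of its
     factors. *)
  rewrite /tpartial_op eq_sym (negPf ai) gv_sign_mu; congr mu_;
    apply/funext => w.
  by rewrite tpartialE /tpartial_op (negPf (inner_neq_outer _ ai))
    inner_lt_outer.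
rewrite tpartialE /tpartial_op (inj_eq (@outer_inj M N i)) outer_lt !andbF.
by case: eqP.
Qed.

Lemma slot_mu_comp_Delta (t : ('I_M.+1 -> A) -> A) e f : multilinear t ->
  comp_Delta t e (slot false (@mu_ R n V N.+1) f) =
  \sum_(e' | (collapse i e'.1, collapse i e'.2) == e)
    comp_Delta (fun f => t (slot false (@mu_ R n V N.+1) f)) e' f.
Proof.
move=> tl; rewrite comp_DeltaE; under [RHS]eq_bigr =>
  e' _ do rewrite comp_DeltaE.
rewrite exchange_big /=; apply: eq_bigr => k _.
rewrite -scaler_sumr; congr (_ *: _).
(* The derivative at the target is distributed first, with the one at the source regarded as part of
   t. *)
have := slot_mu_tpartial (dtarget k) e.2 f (multilinear_precomp (dsource k) e.1 tl).
rewrite /precomp => ->.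
under eq_bigr => v _ do rewrite (slot_mu_tpartial _ _ _ tl).
rewrite exchange_big pair_big_dep /=; apply: eq_bigl => -[v v'] /=.
by rewrite -pair_eqE.
Qed.

(** Edge by edge, [slot_mu_comp_Delta] replaces an edge by the sum of the edges that collapse to it;
    the independent choices form the tuples r. The map t varies, as each edge of g changes it. *)
Lemma foldl_slot_mu k (g : k.-tuple ('I_M.+1 * 'I_M.+1)) (t : ('I_M.+1 -> A) ->
  A) f :
  multilinear t ->
  foldl (@comp_Delta R n V _) t g (slot false (@mu_ R n V N.+1) f) =
  \sum_(r : k.-tuple ('I_(M + N).+1 * 'I_(M + N).+1)
        | [seq (collapse i e.1, collapse i e.2) | e <- r] == g)
    foldl (@comp_Delta R n V _) (fun f => t (slot false (@mu_ R n V N.+1) f)) r f.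
Proof.
elim: k g t f => [|k IH] g t f tl.
  rewrite (tuple0 g) (big_pred1 [tuple]) // => r; by rewrite (tuple0 r).
case/tupleP: g => e g; rewrite [LHS]/= IH; last exact: multilinear_comp_Delta.
rewrite (reindex (fun p : E * k.-tuple E => [tuple of p.1 :: p.2])) /=;
  last first.
  exists (fun r => (thead r, [tuple of behead r])) => [[e' r] _|r _] /=.
    by congr pair; apply/val_inj.
  by rewrite -tuple_eta.
rewrite (eq_bigl (fun p : E * k.-tuple E => ((collapse i p.1.1,
  collapse i p.1.2) == e) &&
   ([seq (collapse i e.1, collapse i e.2) | e <- p.2] == g))); last first.
  by move=> [e' r]; rewrite eqseq_cons.
rewrite -(pair_big (fun e' : E => (collapse i e'.1, collapse i e'.2) == e)
   (fun r : k.-tuple E => [seq (collapse i e.1, collapse i e.2) | e <- r] == g)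
   (fun e' (r : k.-tuple E) => foldl (@comp_Delta R n V _)
     (comp_Delta (fun f => t (slot false (@mu_ R n V N.+1) f)) e') r f)).
rewrite exchange_big /=; apply: eq_bigr => r _.
rewrite -big_filter; set s := [seq e' <- _ | _].
have := foldl_lincomb s (fun=> 1) (comp_Delta (fun f =>
  t (slot false (@mu_ R n V N.+1) f))) r f.
under [X in _ = X]eq_bigr => e' _ do rewrite scale1r.
move=> <-; congr (foldl _ _ _ _); apply/funext => f'.
rewrite (slot_mu_comp_Delta _ _ tl) -big_filter.
by apply: eq_bigr => e' _; rewrite scale1r.
Qed.

(** Both derivatives of a term enter the slot, and their parities add up to n whatever the term. *)
Lemma comp_Delta_slot b (t : ('I_M.+1 -> A) -> A) tau e : multilinear t ->
  comp_Delta (fun f => t (slot b tau f)) (inner i e.1, inner i e.2) =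
  fun f => t (slot (b (+) odd n) (comp_Delta tau e) f).
Proof.
move=> tl; apply/funext => f; rewrite comp_DeltaE.
under eq_bigr => k _ do rewrite !slot_tpartial_inner /= -addbA -oddD
  deg_source_target.
rewrite [in RHS]slot_upd comp_DeltaE (multilinear_sum_at _ _ _ _ _ tl).
apply: eq_bigr => k _; congr (_ *: t _); rewrite slot_upd.
by apply/funext => j; rewrite /upd /slot; case: eqP.
Qed.

Lemma foldl_slot b (t : ('I_M.+1 -> A) -> A) tau (h : seq (edge N)) :
  multilinear t ->
  foldl (@comp_Delta R n V _) (fun f => t (slot b tau f))
     [seq (inner i e.1, inner i e.2) | e <- h] =
  fun f => t (slot (b (+) (odd (size h) && odd n)) (foldl (@comp_Delta R n V _) tau h) f).
Proof.
move=> tl; elim: h b tau => [|e h IH] b tau /=; first by rewrite addbF.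
rewrite comp_Delta_slot // IH; apply/funext => f; congr (t (slot _ _ _)).
by rewrite -addbA; congr (_ (+) _); case: (odd (size h)); case: (odd n).
Qed.
End Insert.
End Circ.

(** * Permutations of edges and of tensor factors *)

(** Sets up inductions on permutations: the element s(0) is brought to the front, then the remaining
    ones are permuted. *)
Lemma perm_lift_decomp N (s : 'S_N.+1) :
  exists s' : 'S_N, s = lift_perm ord0 (s ord0) s'.
Proof.
pose F k := odflt k (unlift (s ord0) (s (lift ord0 k))).
have FE k : s (lift ord0 k) = lift (s ord0) (F k).
  rewrite /F; case: unliftP => [j -> //|/perm_inj/esym/eqP].
  by rewrite (negPf (neq_lift _ _)).
have Finj : injective F.
  by move=> a b /(congr1 (lift (s ord0))); rewrite -!FE => /perm_inj/lift_inj.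
exists (perm Finj); apply/permP => k; case: (unliftP ord0 k) => [a|] ->.
  by rewrite lift_perm_lift permE FE.
by rewrite lift_perm_id.
Qed.

Lemma lift_lift0 N (j : 'I_N.+1) (a : 'I_N) :
  lift (lift ord0 j) (lift ord0 a) = lift ord0 (lift j a).
Proof. by apply/val_inj; rewrite /= /bump /= !add1n ltnS; case: leqP. Qed.

Lemma lift_lift00 N (j : 'I_N.+1) : lift (lift ord0 j) ord0 = ord0.
Proof. exact/val_inj. Qed.

Lemma bump_lt (j a b : nat) : (bump j a < bump j b)%N = (a < b)%N.
Proof. by rewrite /bump; case: leqP; case: leqP; lia. Qed.

Lemma prod_signM (R : comNzRingType) (I : finType) (F : I -> bool) :
  (\prod_i (-1) ^+ F i) * (\prod_i (-1) ^+ F i) = 1 :> R.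
Proof.
by rewrite -big_split big1 // => i _ /=; rewrite -signr_addb addbb.
Qed.

(** * Koszul signs *)

Section KoszulSign.
Variables (R : comNzRingType).

(** The Koszul sign with the conditions on the pair moved into the exponent, so that the products
    run over full ranges and can be split and reindexed. *)
Definition inversion_sign N (s : 'S_N) (e : 'I_N -> bool) : R :=
  \prod_(a < N) \prod_(b < N) (-1) ^+ [&& (a < b)%N, (s b < s a)%N, e a & e b].

Lemma inversion_signM N (s : 'S_N) e : inversion_sign s e * inversion_sign s e = 1.
Proof.
rewrite /inversion_sign -big_split big1 // => a _; exact: (prod_signM R).
Qed.

Definition flip_at N (e : 'I_N -> bool) k x a := e a (+) ((a == k) && x).

(** Changing the parity of the k-th factor affects the inversions involving k, and b forms one with
    k exactly when one but not both of b < k and s(b) < s(k) holds. The two products are the signs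
    of an operator of parity x reaching that factor before and after the permutation. *)
Lemma inversion_sign_flip N (s : 'S_N) e k x :
  inversion_sign s (flip_at e k x) * (\prod_(b < N) (-1) ^+ ((b < k)%N && x && e b)) =
  inversion_sign s e * (\prod_(b < N) (-1) ^+ ((s b < s k)%N && x && e b)).
Proof.
pose p1 (a b : 'I_N) : R := (-1) ^+ [&& (a < b)%N, (s b < s a)%N, a == k, x & e b].
pose p2 (a b : 'I_N) : R := (-1) ^+ [&& (a < b)%N, (s b < s a)%N, e a, b == k & x].
have -> : inversion_sign s (flip_at e k x) = inversion_sign s e *
    (\prod_(a < N) \prod_(b < N) p1 a b) * (\prod_(a < N) \prod_(b < N) p2 a b).
  rewrite -!big_split; apply: eq_bigr => a _; rewrite -!big_split.
  apply: eq_bigr => b _; rewrite /p1 /p2 {p1 p2} /= -!signr_addb /flip_at.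
  congr ((-1) ^+ nat_of_bool _).
  have : (a < b)%N ==> ~~ ((a == k) && (b == k)).
    by apply/implyP => ab; apply/andP => -[/eqP ak /eqP bk];
      rewrite ak bk ltnn in ab.
  by move: (a < b)%N (s b < s a)%N (a == k) (b == k) (e a) (e b) x
    => [] [] [] [] [] [] [].
rewrite -!mulrA; congr (_ * _).
have -> : \prod_(a < N) \prod_(b < N) p1 a b = \prod_(b < N) p1 k b.
  rewrite (bigD1 k) //= [X in _ * X]big1 ?mulr1 // => a /negPf ak.
  by apply: big1 => b _; rewrite /p1 ak !andbF.
have -> : \prod_(a < N) \prod_(b < N) p2 a b = \prod_(a < N) p2 a k.
  apply: eq_bigr => a _; rewrite (bigD1 k) //= [X in _ * X]big1 ?mulr1 // => b /negPf bk.
  by rewrite /p2 bk !andbF.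
rewrite -!big_split; apply: eq_bigr => b _ /=;
  rewrite /p1 /p2 {p1 p2} -!signr_addb.
congr ((-1) ^+ nat_of_bool _); rewrite eqxx /=.
have := inj_eq (@perm_inj _ s) b k; rewrite -!val_eqE /=.
by case: (ltngtP b k); case: (ltngtP (s b) (s k)); case: (e b); case: x.
Qed.

(** The inverse sends j to 0, so j is inverted with precisely the indices below it; the other
    inversions are those of the inverse of u. *)
Lemma inversion_sign_lift N (u : 'S_N) (j : 'I_N.+1) e :
  inversion_sign (lift_perm ord0 j u)^-1 e =
  (\prod_(a < N.+1) (-1) ^+ [&& (a < j)%N, e a & e j]) * inversion_sign u^-1
    (fun a => e (lift j a)).
Proof.
rewrite lift_permV /inversion_sign (bigD1_ord j) //= big1 ?mul1r => [|b _];
  last first.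
  by rewrite lift_perm_id ltn0 andbF.
under eq_bigr => a _ do rewrite (bigD1_ord j) // lift_perm_id lift_perm_lift.
rewrite big_split /= [X in _ = X * _](bigD1_ord j) //= ltnn expr0 mul1r.
congr (_ * _).
apply: eq_bigr => a _; apply: eq_bigr => b _.
by rewrite lift_perm_lift /= !bump_lt.
Qed.
End KoszulSign.

Lemma koszul_signE (K : fieldType) N (s : 'S_N) (e : {ffun 'I_N -> bool}) :
  koszul_sign K s e = inversion_sign K s e.
Proof.
apply: eq_bigr => a _; rewrite big_mkcond; apply: eq_bigr => b _.
by case: (a < b)%N; case: (s b < s a)%N.
Qed.

Section Symmetry.
Variables (R : realType) (n : nat) (V : np_manifold R n).
Local Notation D := (np_domain V).
Local Notation A := (Cinfty D).
Local Notation C := (gd_coord D).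
Local Notation deg := (@gd_deg R D).
Implicit Type c : C.

(** The j-th edge passes j earlier edges, each at the price (-1)^n. *)
Lemma foldl_front N k (F : 'I_k.+1 -> 'I_N * 'I_N) (j : 'I_k.+1) (t : ('I_N ->
  A) -> A) f :
  multilinear t ->
  foldl (@comp_Delta R n V N) t [seq F a | a <- enum 'I_k.+1] f =
  (-1) ^+ (odd n && odd j) *:
  foldl (@comp_Delta R n V N) t (F j :: [seq F (lift j a) | a <- enum 'I_k]) f.
Proof.
elim: k F j t => [|k IH] F j t tl.
  by rewrite (ord1 j) andbF scale1r enum_ordSl /= -map_comp.
rewrite enum_ordSl /= -map_comp; case: (unliftP ord0 j) => [j'|] ->; last first.
  by rewrite andbF scale1r.
rewrite (IH (F \o lift ord0) j') /=; last exact: multilinear_comp_Delta.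
rewrite -[in RHS]/(map _ _) enum_ordSl /= -map_comp lift_lift00.
rewrite [comp_Delta (comp_Delta t (F ord0)) _](_ : _ =
    fun f => (-1) ^+ odd n *: comp_Delta (comp_Delta t (F (lift ord0 j'))) (F
      ord0) f); last first.
  by apply/funext => g; rewrite comp_DeltaC // signr_odd.
rewrite foldl_scale scalerA.
rewrite -signr_addb.
rewrite (eq_map (g := fun a => F (lift (lift ord0 j') (lift ord0 a))));
  last first.
  by move=> a /=; rewrite lift_lift0.
congr (_ ^+ nat_of_bool _ *: _).
by rewrite /= /bump /=; case: (odd n); rewrite //= addbT.
Qed.

Lemma foldl_perm N k (F : 'I_k -> 'I_N * 'I_N) (s : 'S_k) (t : ('I_N -> A) ->
  A) f :
  multilinear t ->
  foldl (@comp_Delta R n V N) t [seq F (s a) | a <- enum 'I_k] f =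
  (-1) ^+ (odd n && s) *:
  foldl (@comp_Delta R n V N) t [seq F a | a <- enum 'I_k] f.
Proof.
elim: k F s t => [|k IH] F s t tl.
  by rewrite enum_ord0 /= (_ : s = 1%g) ?odd_perm1 ?andbF ?scale1r //;
    apply/permP => -[].
have [s' es] := perm_lift_decomp s; move: es; set j := s ord0 => es.
rewrite (foldl_front F j _ tl) scalerA -signr_addb.
rewrite [in LHS]enum_ordSl /= -map_comp -/j.
rewrite (eq_map (g := fun a => F (lift j (s' a)))); last first.
  by move=> a /=; rewrite es lift_perm_lift.
rewrite (IH (F \o lift j)); last exact: multilinear_comp_Delta.
congr (_ ^+ nat_of_bool _ *: _).
by rewrite [in RHS]es odd_lift_perm /=; case: (odd n); case: (odd j);
  case: (odd_perm s').
Qed.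

Lemma dRep_edge_perm N k (g : k.-tuple (edge N)) (s : 'S_k) f :
  dRep V (edge_perm s g) f = edge_sign R n.+1 s *: dRep V g f.
Proof.
rewrite /dRep /edge_perm [tval [tuple _ | _ < _]]/= (foldl_perm (tnth g));
  last exact: multilinear_mu.
rewrite -[in RHS](map_tnth_enum g) /edge_sign oddS; congr (_ *: _).
by case: (odd n).
Qed.

(** * Equivariance under permutations of the factors *)

Lemma mu_front N (f : 'I_N.+1 -> A) (e : 'I_N.+1 -> bool) (j : 'I_N.+1) :
  (forall i, has_parity (e i) (f i)) ->
  mu_ f = (\prod_(a < N.+1) (-1) ^+ [&& (a < j)%N, e a & e j]) *:
    (cinf_mul (f j) (mu_ (fun a => f (lift j a))) : A).
Proof.
elim: N f e j => [|N IH] f e j hf.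
  by rewrite (ord1 j) big_ord1 scale1r mu_recl.
rewrite mu_recl big_ord_recl; case: (unliftP ord0 j) => [j'|] ->; last first.
  by rewrite big1 ?mulr1 ?scale1r.
rewrite (IH _ (fun a => e (lift ord0 a)) j') // cinf_mulZr.
rewrite (mu_recl (fun a => f (lift (lift ord0 j') a))) lift_lift00.
rewrite !cinf_mulA (cinf_mulC (hf ord0) (hf (lift ord0 j'))) cinf_mulZl scalerA.
rewrite mulrC; congr (_ * _ *: cinf_mul _ (mu_ _)).
  by apply/funext => a; rewrite lift_lift0.
Qed.

Lemma mu_perm N (f : 'I_N -> A) (e : 'I_N -> bool) (u : 'S_N) :
  (forall i, has_parity (e i) (f i)) ->
  mu_ (fun i => f (u i)) = inversion_sign R u^-1 e *: mu_ f.
Proof.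
elim: N f e u => [|N IH] f e u hf.
  by rewrite !mu_0 /inversion_sign big_ord0 scale1r.
have [u' eu] := perm_lift_decomp u; move: eu; set j := u ord0 => eu.
rewrite mu_recl -/j [mu_ f](mu_front j hf) scalerA eu inversion_sign_lift mulrAC.
rewrite (prod_signM R) mul1r.
have -> : (fun i => f (lift_perm ord0 j u' (lift ord0 i))) =
    (fun i => f (lift j (u' i))).
  by apply/funext => i; rewrite lift_perm_lift.
by rewrite (IH (fun i => f (lift j i)) (fun i => e (lift j i))) // cinf_mulZr.
Qed.

(** The relation t' = t . s in the endomorphism operad, tested on factors of definite parity, where
    a single Koszul sign occurs. *)
Definition intertwines N (s : 'S_N) (t t' : ('I_N -> A) -> A) : Prop :=
  forall f e, (forall i, has_parity (e i) (f i)) ->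
    t' f = inversion_sign R s e *: t (fun i => f (s^-1%g i)).

Lemma intertwines_mu N (s : 'S_N) : intertwines s (@mu_ R n V N) (@mu_ R n V N).
Proof.
by move=> f e hf; rewrite (mu_perm _ hf) invgK scalerA inversion_signM scale1r.
Qed.

Lemma intertwines_precomp N (s : 'S_N) (t t' : ('I_N -> A) -> A) c i :
  multilinear t -> intertwines s t t' ->
  intertwines s (precomp c i t) (precomp c (s^-1%g i) t').
Proof.
move=> tl h f e hf; rewrite /precomp; set k := s^-1%g i.
have sk : s k = i by rewrite /k permKV.
rewrite (h _ (flip_at e k (odd (deg c)))); last first.
  move=> j; rewrite tpartialE /tpartial_op /flip_at; case: eqVneq => [->|_].
    exact: has_parity_partial.
  by rewrite addbF; exact: has_parity_sign.
(* Both sides are t of the same factors F up to scalars: [k1] collects the signs of a derivative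
   acting before the permutation, [k2] those of one acting after it. *)
pose F (b : 'I_N) : A := if b == i then partial c (f k) else f (s^-1%g b).
pose k1 (b : 'I_N) : R := (-1) ^+ ((s^-1%g b < k)%N && odd (deg c) && e (s^-1%g b)).
pose k2 (b : 'I_N) : R := (-1) ^+ ((b < i)%N && odd (deg c) && e (s^-1%g b)).
have -> : (fun b => tpartial c k f (s^-1%g b)) = fun b => k1 b *: F b.
  apply/funext => b; rewrite tpartialE /tpartial_op /F /k1 (inj_eq (@perm_inj _ _)).
  case: eqVneq => [->|_]; first by rewrite -/k ltnn scale1r.
  exact: gv_sign_parity.
have -> : tpartial c i (fun b => f (s^-1%g b)) = fun b => k2 b *: F b.
  apply/funext => b; rewrite tpartialE /tpartial_op /F /k2.
  case: eqVneq => [->|_]; first by rewrite -/k ltnn scale1r.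
  exact: gv_sign_parity.
rewrite !(multilinear_scale _ _ tl) !scalerA; congr (_ *: _).
rewrite (reindex_inj (@perm_inj _ s)) [X in _ =
  _ * X](reindex_inj (@perm_inj _ s)).
have := inversion_sign_flip R s e k (odd (deg c)); rewrite sk => E.
rewrite [LHS](_ : _ = inversion_sign R s (flip_at e k (odd (deg c))) *
    \prod_(b < N) (-1) ^+ ((b < k)%N && odd (deg c) && e b)); last first.
  by congr (_ * _); apply: eq_bigr => b _; rewrite /k1 permK.
rewrite E; congr (_ * _); apply: eq_bigr => b _; by rewrite /k2 permK.
Qed.

Lemma intertwines_comp_Delta N (s : 'S_N) (t t' : ('I_N -> A) ->
  A) (e : 'I_N * 'I_N) :
  multilinear t -> intertwines s t t' ->
  intertwines s (comp_Delta t e) (comp_Delta t' (s^-1%g e.1, s^-1%g e.2)).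
Proof.
move=> tl h f a hf; rewrite !comp_DeltaE scaler_sumr; apply: eq_bigr => k _ /=.
have := intertwines_precomp (dtarget k) e.2 (multilinear_precomp (dsource k) e.1 tl)
  (intertwines_precomp (dsource k) e.1 tl h).
by move/(_ f a hf); rewrite /precomp => ->; rewrite !scalerA mulrC.
Qed.

Lemma intertwines_dRep N (s : 'S_N.+1) (g : seq (edge N)) :
  intertwines s (dRep V g) (dRep V (relabel s g)).
Proof.
rewrite /dRep; elim/last_ind: g => [|g e IH]; first exact: intertwines_mu.
rewrite /relabel map_rcons !foldl_rcons; apply: intertwines_comp_Delta => //.
by apply: multilinear_foldl; exact: multilinear_mu.
Qed.

Lemma gv_par_parity (a b : bool) (f : A) : has_parity a f ->
  gv_par b f = if a == b then f else 0.
Proof.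
move=> hf; have two (x : A) : x = - x -> x = 0.
  move=> /eqP; rewrite -subr_eq0 opprK -mulr2n -scaler_nat scaler_eq0.
  by rewrite pnatr_eq0 => /eqP.
have : gv_par false f - gv_par true f = (-1) ^+ a *: f by rewrite -hf.
have := gv_par_split f; set p := gv_par true f; set q := gv_par false f => e.
rewrite {1}e {hf}; case: a => /=; rewrite ?expr1 ?expr0 ?scale1r ?scaleN1r => h.
  have q0 : q = 0 by apply: two; apply: (addIr (- p)); rewrite h opprD addrC.
  by case: b; rewrite /= -/p -/q ?q0 // e q0 addr0.
have p0 : p = 0.
  by apply: two; apply: (addIr q); rewrite -h addrC.
by case: b; rewrite /= -/p -/q ?p0 // e p0 add0r.
Qed.

(** The factors are split into even and odd parts one at a time; k bounds the slots that still carry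
    no parity. *)
Lemma multilinear_parity_ext N (t t' : ('I_N -> A) -> A) :
  multilinear t -> multilinear t' ->
  (forall (e : 'I_N -> bool) f, (forall i, has_parity (e i) (f i)) ->
    t f = t' f) ->
  forall f, t f = t' f.
Proof.
move=> tl tl' h f.
suff H k : (k <= N)%N -> forall f, (forall i : 'I_N, (k <= i)%N ->
  exists a, has_parity a (f i)) ->
    t f = t' f by apply: (H N) => // i; rewrite leqNgt ltn_ord.
elim: k => [_ g hg|k IH kN g hg].
  have /choice[e he] : forall i, exists a, has_parity a (g i) by move=> i;
    exact: hg.
  exact: h he.
pose i := Ordinal kN.
have -> : g = upd g i (1 *: gv_par true (g i) + gv_par false (g i)).
  by apply/funext => j; rewrite /upd; case: eqP => // ->;
    rewrite scale1r -gv_par_split.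
rewrite tl tl'; congr (_ *: _ + _); apply: IH (ltnW kN) _ _ => j kj;
  rewrite /upd.
  case: eqVneq => [_|ji]; first by exists true; exact: has_parity_par.
  by apply: hg; rewrite ltn_neqAle kj andbT; move: ji; rewrite -val_eqE eq_sym.
case: eqVneq => [_|ji]; first by exists false; exact: has_parity_par.
by apply: hg; rewrite ltn_neqAle kj andbT; move: ji; rewrite -val_eqE eq_sym.
Qed.

Lemma end_act_intertwines N p (s : 'S_N.+1) (t : endo A N p) (t' : ('I_N.+1 ->
  A) -> A) :
  multilinear t' -> intertwines s t t' -> t' = end_act_fun s t.
Proof.
move=> tl' h; apply/funext; apply: multilinear_parity_ext => //.
  exact: (endo_lin (end_act s t)).
move=> e f hf; rewrite (h f e hf) /end_act_fun (bigD1 (finfun e)) //=.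
rewrite [X in _ + X]big1 ?addr0 => [|e' ne].
  rewrite koszul_signE (_ : inversion_sign R s (finfun e) =
    inversion_sign R s e).
    by congr (_ *: t _); apply/funext => i; rewrite (gv_par_parity _ (hf _)) ffunE eqxx.
  by apply: eq_bigr => a _; apply: eq_bigr => b _; rewrite !ffunE.
have [i ei] : exists i, e i != e' i.
  apply/existsP; apply: contraNT ne; rewrite negb_exists => /forallP ee.
  by apply/eqP/ffunP => i; rewrite ffunE; apply/esym/eqP; have := ee i;
    rewrite negbK.
(* A term of the sum with other parities than e contains a vanishing projection, so only the term of
   e remains. *)
rewrite (@endo_upd0 _ _ _ _ (endo_lin t) _ (s i)) ?scaler0 // permK.
by rewrite (gv_par_parity _ (hf i)) (negPf ei).
Qed.
End Symmetry.

(** * The morphism of operads *)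

Lemma freeg_linear_ext (K : fieldType) (G : choiceType) (L : lmodType K)
    (F F' : {freeg G / K} -> L) : linear F -> linear F' ->
  (forall h, F << 1 *g h >> = F' << 1 *g h >>) -> forall x, F x = F' x.
Proof.
move=> Fl F'l FF' x.
have F0 (H : {freeg G / K} -> L) : linear H -> H 0 = 0.
  by move=> Hl; have := Hl (-1) 0 0; rewrite !scaleN1r !addNr.
rewrite -[x]freeg_sumE; elim: (freeg.dom x) => [|g s IH].
  by rewrite big_nil !F0.
rewrite big_cons.
have -> : << coeff g x *g g >> = coeff g x *: << 1 *g g >> :> {freeg G / K}.
  by apply/eqP/freeg_eqP => k; rewrite coeffZ !coeffU mul1r.
by rewrite Fl F'l FF' IH.
Qed.

Section MuSlot.
Variables (R : realType) (n : nat) (V : np_manifold R n).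
Local Notation D := (np_domain V).
Local Notation A := (Cinfty D).

HB.instance Definition _ := Monoid.isLaw.Build (cinf D) (@cinf_one R D)
  (@cinf_mul R D) (@cinf_mulA R D) (@cinf_mul1l R D) (@cinf_mul1r R D).

Lemma mu_nat N (f : 'I_N.+1 -> A) :
  mu_ f = \big[@cinf_mul R D/@cinf_one R D]_(0 <= k < N.+1) (f (inord k) : cinf D).
Proof. by rewrite big_mkord; apply: eq_bigr => k _; rewrite inord_val. Qed.

(** By associativity: the inserted vertices are the consecutive labels i, ..., i + N, so bracketing
    them changes neither the order nor the value of the product. *)
Lemma mu_slot M N (i : 'I_M.+1) (f : 'I_(M + N).+1 -> A) :
  mu_ (slot i false (@mu_ R n V N.+1) f) = mu_ f.
Proof.
have iM := ltn_ord i.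
rewrite [LHS]mu_nat [RHS]mu_nat (big_cat_nat (n := i)) ?(ltnW iM) //=.
rewrite [RHS](big_cat_nat (n := i)) //=; last by lia.
congr cinf_mul.
  apply: eq_big_nat => j /andP[_ ji]; rewrite /slot.
  have jE : (inord j : 'I_M.+1) = j :> nat by rewrite inordK //; lia.
  rewrite -val_eqE /= jE (ltn_eqF ji) andbF; congr f; apply/val_inj.
  by rewrite /= outerE jE ji inordK //; lia.
rewrite big_ltn // [RHS](big_cat_nat (n := (i + N).+1)) //=; try lia.
congr cinf_mul.
  have -> : (i + N).+1 = (N.+1 + i)%N by lia.
  rewrite inord_val /slot eqxx mu_nat -[X in \big[_/_]_(X <= _ < _ + _) _]add0n.
  rewrite big_addn addnK; apply: eq_big_nat => w wN; congr f; apply/val_inj.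
  by rewrite /= innerE !inordK //; lia.
rewrite -[(i + N).+1]addSn big_addn subSn ?leq_addl // addnK.
apply: eq_big_nat => j /andP[ij jM]; rewrite /slot.
have jE : (inord j : 'I_M.+1) = j :> nat by rewrite inordK.
rewrite -val_eqE /= jE (gtn_eqF ij) andbF; congr f; apply/val_inj.
by rewrite /= outerE jE ltnNge (ltnW ij) inordK //; lia.
Qed.
End MuSlot.

Section Representation.
Variables (R : realType) (n : nat) (V : np_manifold R n).
Local Notation A := (Cinfty (np_domain V)).

Lemma dRep_in N (g : seq (edge N)) : dRep V g \in @end_pred R A N (graph_deg n.+1 g).
Proof. by rewrite inE; split; [exact: multilinear_dRep|exact: map_degree_dRep].
  Qed.

(* The zero map if [g] does not have degree [p]. *)
Definition dRep_endo N p (g : seq (edge N)) : endo A N p := insubd 0 (dRep V g).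

Lemma dRep_endoE N p (g : seq (edge N)) : graph_deg n.+1 g = p ->
  endo_fun (dRep_endo p g) = dRep V g.
Proof. by move=> <-; rewrite -[LHS]/(val _) insubdK //; exact: dRep_in. Qed.

Definition dRep_free N p : {freeg (hgraph n.+1 N p) / R} -> endo A N p :=
  fglift (fun h : hgraph n.+1 N p => dRep_endo p (val h)).

Lemma dRep_free_linear N p : linear (@dRep_free N p).
Proof. exact: fglift_linear. Qed.

Lemma dRep_free_gvec N p g :
  dRep_free (gvec R n.+1 p g : {freeg (hgraph n.+1 N p) / R}) =
  if graph_deg n.+1 g == p then dRep_endo p g else 0.
Proof. by rewrite /dRep_free (lift_gvec _ _ (@dRep_endo N p)). Qed.

Lemma dRep_free_rel N p (x : {freeg (hgraph n.+1 N p) / R}) :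
  edge_rel x -> dRep_free x = 0.
Proof.
elim=> [|c k g s y _ IH]; first exact: fglift0.
rewrite dRep_free_linear IH addr0 addrC -scaleNr dRep_free_linear
  !dRep_free_gvec.
rewrite /graph_deg size_edge_perm; case: eqP => [gp|_]; last first.
  by rewrite scaler0 addr0 scaler0.
apply/eqP; rewrite scaler_eq0; apply/orP; right; apply/eqP.
rewrite addrC scaleNr; apply/eqP; rewrite subr_eq0; apply/eqP/val_inj => /=.
apply/funext => f; rewrite dRep_endoE; last by rewrite /graph_deg
  size_edge_perm.
by rewrite dRep_edge_perm -[RHS]/(edge_sign R n.+1 s *: dRep_endo p g f) dRep_endoE.
Qed.

Definition dRep_mor N p (x : dgra R n.+1 N p) : endo A N p := dRep_free (grepr x).

(** The morphism is computed on a chosen representative; another one differs by edge relations,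
    which [dRep_free_rel] annihilates. *)
Lemma dRep_morE N p (y : {freeg (hgraph n.+1 N p) / R}) :
  dRep_mor (gclass y) = dRep_free y.
Proof.
have : dRep_free (-1 *: y + grepr (gclass y)) = 0.
  apply: dRep_free_rel; rewrite scaleN1r addrC; apply/gclass_eq.
  by rewrite greprK.
by rewrite dRep_free_linear scaleN1r addrC => /eqP; rewrite subr_eq0 => /eqP.
Qed.

Lemma dRep_mor_linear N p : linear (@dRep_mor N p).
Proof.
move=> k x y; rewrite -(greprK x) -(greprK y) !dRep_morE -dRep_free_linear -dRep_morE.
by congr dRep_mor; rewrite /gclass lmclass_linear.
Qed.
HB.instance Definition _ N p :=
  GRing.isLinear.Build R (dgra R n.+1 N p) (endo A N p) *:%R (@dRep_mor N p)
    (@dRep_mor_linear N p).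

Lemma dRep_mor_act N p (s : 'S_N.+1) (x : dgra R n.+1 N p) :
  dRep_mor (dgra_act s x) = end_act s (dRep_mor x).
Proof.
rewrite -(greprK x) dgra_act_class !dRep_morE.
move: (grepr x) => {x}; apply: freeg_linear_ext.
- by move=> k x y; rewrite /act_free fglift_linear dRep_free_linear.
- move=> k x y; rewrite dRep_free_linear; apply/val_inj/funext => f /=.
  rewrite -[RHS]/(k *: end_act_fun s (dRep_free x) f + end_act_fun s (dRep_free y) f).
  rewrite /end_act_fun scaler_sumr -big_split; apply: eq_bigr => e _ /=.
  by rewrite scalerDr !scalerA mulrC.
move=> h; rewrite /act_free liftU scale1r -gvec_in !dRep_free_gvec (valP h).
have gp : graph_deg n.+1 (relabel s (val h)) = p.
  by rewrite /graph_deg size_map; apply/eqP; exact: (valP h).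
rewrite gp eqxx; apply/val_inj => /=; rewrite dRep_endoE //.
apply: end_act_intertwines; first exact: multilinear_dRep.
by rewrite dRep_endoE; [exact: intertwines_dRep|exact/eqP/(valP h)].
Qed.

Lemma endo_sumE N p (I : Type) (s : seq I) (P : pred I) (F : I ->
  endo A N p) f :
  (\sum_(j <- s | P j) F j : endo A N p) f = \sum_(j <- s | P j) F j f.
Proof. by elim/big_rec2: _ => // j x y _ <-. Qed.

Lemma dRep_free_sum N p (I : Type) (s : seq I) (P : pred I)
    (F : I -> {freeg (hgraph n.+1 N p) / R}) :
  dRep_free (\sum_(j <- s | P j) F j) = \sum_(j <- s | P j) dRep_free (F j).
Proof.
elim/big_rec2: _ => [|j x y _ <-]; first exact: fglift0.
by rewrite -[F j]scale1r dRep_free_linear !scale1r.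
Qed.

(** Compatibility with composition on single graphs. Pulling the edges of h out of the slot and then
    distributing those of g yields the operators of the lists r followed by the edges of h, the edge
    order prescribed in dGra. *)
Lemma dRep_insertion M N (i : 'I_M.+1) (g : seq (edge M)) (h : seq (edge N)) p q f :
  graph_deg n.+1 g = p -> graph_deg n.+1 h = q ->
  endo_fun (dRep_free (insertion R n.+1 (p + q) i g h)) f =
  end_circ_fun q i (dRep V g) (dRep V h) f.
Proof.
move=> gp hq.
have tg : multilinear (dRep V g) by exact: multilinear_dRep.
have -> : end_circ_fun q i (dRep V g) (dRep V h) f =
    dRep V g (slot i (odd (size h) && odd n) (dRep V h) f).
  congr (dRep V g _); apply/funext => j; rewrite /slot; case: eqP => // _.
  (* The degree q is |E_h| (1 - d) = - n |E_h|, so the sign of [end_circ_fun] is the one collected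
     by [foldl_slot]. *)
  have -> : parity q = odd (size h) && odd n.
    rewrite -hq /parity /graph_deg abszM oddM; congr (_ && odd _).
    by rewrite -[n.+1]add1n PoszD opprD addrA subrr add0r abszN.
  by case: (j < i)%N.
have := foldl_slot i false (@mu_ R n V N.+1) h tg; rewrite addFb => E.
rewrite -[RHS]/((fun f => dRep V g (slot i (odd (size h) && odd n) (dRep V h) f)) f) -E.
have -> : (fun f => dRep V g (slot i false (@mu_ R n V N.+1) f)) = fun f =>
   \sum_(r <- [seq r <- index_enum {: (size g).-tuple (edge (M + N))}
        | [seq (collapse i e.1, collapse i e.2) | e <- val r] == g]) 1 *: dRep V (val r) f.
  apply/funext => f'; rewrite big_filter.
  have := foldl_slot_mu i (in_tuple g) f' (@multilinear_mu R n V M.+1).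
  rewrite -[LHS]/(dRep V g _) => ->; apply: eq_bigr => r _; rewrite scale1r.
  by congr (foldl _ _ _ _); apply/funext => f''; rewrite mu_slot.
rewrite foldl_lincomb big_filter /insertion dRep_free_sum endo_sumE.
apply: eq_bigr => r _; rewrite scale1r dRep_free_gvec.
have -> : graph_deg n.+1 (r ++ [seq (inner i e.1,
  inner i e.2) | e <- h]) = p + q.
  by rewrite -gp -hq /graph_deg size_cat size_tuple size_map PoszD mulrDl.
rewrite eqxx dRep_endoE; last first.
  by rewrite -gp -hq /graph_deg size_cat size_tuple size_map PoszD mulrDl.
by rewrite /dRep foldl_cat.
Qed.

Lemma dRep_mor_circ M N p q (i : 'I_M.+1) (x : dgra R n.+1 M p) (y : dgra R n.+1 N q) :
  dRep_mor (dgra_circ i x y) = end_circ i (dRep_mor x) (dRep_mor y).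
Proof.
rewrite -(greprK x) -(greprK y) dgra_circ_class !dRep_morE.
move: (grepr x) (grepr y) => {x} {y} x y; move: x; apply: freeg_linear_ext.
- by move=> k u v; rewrite /circ_free fglift_linear dRep_free_linear.
- by move=> k u v; rewrite dRep_free_linear; apply/val_inj/funext => f.
move=> g; move: y; apply: freeg_linear_ext.
- by move=> k u v; rewrite circ_free_linear dRep_free_linear.
- move=> k u v; rewrite dRep_free_linear; apply/val_inj/funext => f.
  set t := dRep_free _; pose G (j : 'I_M.+1) : A :=
    if (j < i)%N then gv_sign (parity q) (f (outer N i j)) else f (outer N i j).
  have E t' : end_circ_fun q i t t' f = t (upd G i (t' (fun w =>
    f (inner i w)))).
    by congr (endo_fun t _); apply/funext => j; rewrite /upd /G; case: eqP.
  rewrite -[LHS]/(end_circ_fun q i t (k *: dRep_free u + dRep_free v : endo A N q) f).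
  rewrite -[RHS]/(k *: end_circ_fun q i t (dRep_free u) f + end_circ_fun q i t
    (dRep_free v) f).
  by rewrite !E -[in LHS]/(k *: dRep_free u _ + dRep_free v _) (endo_lin t).
move=> h; rewrite /circ_free !liftU !scale1r -!gvec_in !dRep_free_gvec.
rewrite (valP g) (valP h); apply/val_inj/funext => f.
have gp := eqP (valP g); have hq := eqP (valP h).
rewrite -[LHS]/(endo_fun _ f) dRep_insertion //.
by rewrite -[RHS]/(end_circ_fun q i _ _ f) !dRep_endoE.
Qed.

Lemma dRep_mor_unit :
  dRep_mor (gclass (gvec R n.+1 0 [::] : {freeg (hgraph n.+1 0 0) / R})) =
  op_unit (EndOp A).
Proof.
rewrite dRep_morE dRep_free_gvec; have -> : graph_deg n.+1 ([::] : seq (edge 0)) = 0.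
  by rewrite /graph_deg mul0r.
rewrite eqxx; apply/val_inj/funext => f; rewrite -[LHS]/(endo_fun _ f) dRep_endoE.
  by rewrite -[LHS]/(mu_ f) mu_recl mu_0; exact: cinf_mul1r.
by rewrite /graph_deg mul0r.
Qed.

Definition dRep_operad_mor : operad_mor (dGra R n.+1) (EndOp A) :=
  @OperadMor R (dGra R n.+1) (EndOp A) (fun N p => @dRep_mor N p)
    dRep_mor_act dRep_mor_circ dRep_mor_unit.
End Representation.

Theorem proposition4p1 (R : realType) (n : nat) (V : np_manifold R n) :
  exists Phi : operad_mor (dGra R n.+1) (EndOp (Cinfty (np_domain V))),
    forall (N : nat) (g : seq (edge N)),
      endo_fun (Phi N (graph_deg n.+1 g) (graph_class R n.+1 g)) = dRep V g.
Proof.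
exists (dRep_operad_mor V) => N g.
rewrite -[LHS]/(endo_fun (dRep_mor V (gclass _))) dRep_morE dRep_free_gvec eqxx.
exact: dRep_endoE.
Qed.
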